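(* Let $\mathcal{P}$ be a (not necessarily rational) $d$-polytope in $\mathbb{R}^d$, and let $\mathrm{cone}(\mathcal{P})=\{(\alpha,s)\in\mathbb{R}^{d+1}: s\ge 0,\ \alpha\in s\mathcal{P}\}$. Suppose $\{(s_i,K_i^{v_i}):1\le i\le N\}$ is a signed simplicial cone decomposition of $\mathrm{cone}(\mathcal{P})$ with $\dim(K_i^{v_i})\le d+1$ for all $i$. Then for any $\beta\in\mathbb{Z}^d$ admissible for all $K_i^{v_i}$, $$\mathrm{vol}(\mathcal{P})=\frac{1}{d!}\sum_{i=1}^N s_i\,\mathrm{Vol}_d^\beta K_i^{v_i}.$$
   Context: A pointed simplicial cone is $K^v(\mu_1,\dots,\mu_h)=v+\{k_1\mu_1+\cdots+k_h\mu_h: k_j\ge 0\}$ with $\mu_1,\dots,\mu_h$ linearly independent. For $S\subset\mathbb{R}^{m}$ let $\sigma_S(\mathbf{y})=\sum_{\alpha\in S\cap\mathbb{Z}^{m}}\mathbf{y}^\alpha$. A collection $\{(s_i,K_i^{v_i})\}$ with $s_i\in\mathbb{Z}$ and $K_i^{v_i}$ pointed simplicial cones is a signed simplicial cone decomposition of $\mathrm{cone}(\mathcal{P})$ if $\sigma_{\mathrm{cone}(\mathcal{P})}=\sum_i s_i\sigma_{K_i^{v_i}}$. For $K^v=K^v(\mu_1,\dots,\mu_h)$ in $\mathbb{R}^{d+1}$, $h\le d+1$, write $\mu_j=(\nu_j^T,m_j)^T$ with $\nu_j\in\mathbb{R}^d$, $m_j\in\mathbb{R}$; $\beta$ is admissible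 for $K^v$ if for all $j$, $\beta^T\nu_j$ and $m_j$ are not both $0$. Define $\mathrm{Vol}_d^\beta K^v:=|\det(\mu_1,\dots,\mu_{d+1})|\,\mathrm{CT}_q\dfrac{1}{\prod_{i=1}^{d+1}(m_i-(\beta^T\nu_i)q)}$ if $h=d+1$ and $0$ if $h<d+1$, where $\mathrm{CT}_q$ is the constant term of the Laurent expansion in $q$ at $q=0$. Here $\mathrm{vol}$ is the Lebesgue volume. *)

(* Defs.v *)
From HB Require Import structures.
From mathcomp Require Import all_boot all_order all_algebra.
From mathcomp Require Import all_classical all_reals all_analysis.

Set Implicit Arguments.
Unset Strict Implicit.
Unset Printing Implicit Defensive.

Import Order.TTheory GRing.Theory Num.Theory.

Local Open Scope classical_set_scope.
Local Open Scope ring_scope.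

(* A finite set of points of R^d is given by the columns of V : 'M_(d, n). *)
Definition conv_hull (R : realType) (d n : nat) (V : 'M[R]_(d, n)) :
    set 'cV[R]_d :=
  [set x | exists w : 'cV[R]_n,
    [/\ forall i, 0 <= w i 0, \sum_i w i 0 = 1 & x = V *m w]].

Definition affine_hull (R : realType) (d n : nat) (V : 'M[R]_(d, n)) :
    set 'cV[R]_d :=
  [set x | exists w : 'cV[R]_n, \sum_i w i 0 = 1 /\ x = V *m w].

(* Polytopes of full dimension d in R^d: the affine hull of a polytope is the
   affine hull of any finite set of which it is the convex hull. *)
Definition full_dim_polytope (R : realType) (d : nat) (P : set 'cV[R]_d) :=
  exists (n : nat) (V : 'M[R]_(d, n)),
    P = conv_hull V /\ affine_hull V = setT.

(* Vectors of R^(d+1) are pairs (alpha, s), with alpha in R^d the upper block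
   and s the last coordinate. *)
Definition last_coord (R : realType) (d : nat) (x : 'cV[R]_(d + 1)) : R :=
  dsubmx x 0 0.

Definition cone_over (R : realType) (d : nat) (P : set 'cV[R]_d) :
    set 'cV[R]_(d + 1) :=
  [set x | 0 <= last_coord x /\
           exists2 p, P p & usubmx x = last_coord x *: p].

Definition box (R : realType) (d : nat) (a b : 'cV[R]_d) : set 'cV[R]_d :=
  [set x | forall i, a i 0 <= x i 0 <= b i 0].

Definition box_volume (R : realType) (d : nat) (a b : 'cV[R]_d) : R :=
  \prod_(i < d) (b i 0 - a i 0).

(* Lebesgue (outer) measure on R^d: infimum of the total volumes of the
   countable covers by boxes. The covers are indexed by a subset D of nat, so
   that finite covers are covers also when d = 0, where every box has
   volume 1. *)
Definition vol (R : realType) (d : nat) (A : set 'cV[R]_d) : \bar R :=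
  ereal_inf [set r : \bar R |
    exists (D : set nat) (a b : nat -> 'cV[R]_d),
      [/\ forall n i, a n i 0 <= b n i 0,
          A `<=` \bigcup_(n in D) box (a n) (b n) &
          r = \esum_(n in D) (box_volume (a n) (b n))%:E]].

(* The generators mu_1, .., mu_h are the columns of gens. *)
Record pointed_simplicial_cone (R : realType) (m : nat) :=
  PointedSimplicialCone {
    apex : 'cV[R]_m;
    ngens : nat;
    gens : 'M[R]_(m, ngens);
    gens_free : row_free gens^T
  }.

Definition cone_set (R : realType) (m : nat)
    (K : pointed_simplicial_cone R m) : set 'cV[R]_m :=
  [set x | exists k : 'cV[R]_(ngens K),
    (forall j, 0 <= k j 0) /\ x = apex K + gens K *m k].

(* The formal series sigma_S(y) in y_1^{+-1}, .., y_m^{+-1}, as the function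
   mapping an exponent alpha in Z^m to the coefficient of y^alpha. *)
Definition sigma (R : realType) (m : nat) (S : set 'cV[R]_m) :
    'cV[int]_m -> int :=
  fun alpha => (`[< S (map_mx intr alpha) >])%:R.

Definition signed_simplicial_cone_decomposition (R : realType) (d N : nat)
    (P : set 'cV[R]_d) (s : 'I_N -> int)
    (K : 'I_N -> pointed_simplicial_cone R (d + 1)) :=
  forall alpha : 'cV[int]_(d + 1),
    sigma (cone_over P) alpha = \sum_(i < N) s i * sigma (cone_set (K i)) alpha.

(* mu_j = (nu_j, m_j) *)
Definition gen_m (R : realType) (d : nat)
    (K : pointed_simplicial_cone R (d + 1)) (j : 'I_(ngens K)) : R :=
  dsubmx (gens K) 0 j.

Definition gen_beta_nu (R : realType) (d : nat) (beta : 'cV[int]_d)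
    (K : pointed_simplicial_cone R (d + 1)) (j : 'I_(ngens K)) : R :=
  ((map_mx intr beta)^T *m usubmx (gens K)) 0 j.

Definition admissible (R : realType) (d : nat) (beta : 'cV[int]_d)
    (K : pointed_simplicial_cone R (d + 1)) :=
  forall j : 'I_(ngens K), ~ (gen_beta_nu beta j = 0 /\ gen_m j = 0).

(* c is the coefficient sequence of a formal Laurent series in q, with
   finitely many negative powers, whose product with p(q) is 1. *)
Definition is_laurent_inv (R : realType) (p : {poly R}) (c : int -> R) :=
  (exists n0 : int, forall n : int, n < n0 -> c n = 0) /\
  (forall n : int, \sum_(j < size p) p`_j * c (n - j%:Z) = (n == 0)%:R).

(* Coefficients of the Laurent expansion of 1 / p(q) at q = 0; meaningful for
   p != 0 by laurent_inv_exists and laurent_inv_unique. *)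
Definition laurent_inv (R : realType) (p : {poly R}) : int -> R :=
  xget (fun=> 0) [set c | is_laurent_inv p c].

Definition CT_inv (R : realType) (p : {poly R}) : R := laurent_inv p 0.

Definition Vol (R : realType) (d : nat) (beta : 'cV[int]_d)
    (K : pointed_simplicial_cone R (d + 1)) : R :=
  match ngens K =P (d + 1)%N with
  | ReflectT h_eq =>
      `|\det (castmx (erefl (d + 1)%N, h_eq) (gens K))| *
      CT_inv (\prod_(j < ngens K) ((gen_m j)%:P - gen_beta_nu beta j *: 'X))
  | ReflectF _ => 0
  end.

Lemma poly_ord (R : realType) (p : {poly R}) : p != 0 ->
  exists k, p`_k != 0 /\ forall j, (j < k)%N -> p`_j = 0.
Proof.
move=> p0; have ex : exists k, p`_k != 0.
  by exists (size p).-1; rewrite -lead_coefE lead_coef_eq0.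
exists (ex_minn ex); case: ex_minnP => k pk kmin; split => // j jk.
by apply/eqP; apply: contraTT jk => /kmin; rewrite -leqNgt.
Qed.

Lemma laurent_inv_unique (R : realType) (p : {poly R}) (c c' : int -> R) :
  p != 0 -> is_laurent_inv p c -> is_laurent_inv p c' -> c = c'.
Proof.
move=> /poly_ord[k [pk pj]] [[n0 c0] cE] [[n0' c0'] cE'].
pose n1 := Num.min n0 n0'.
have low n : n < n1 -> c n = c' n.
  by rewrite lt_min => /andP[/c0 -> /c0' ->].
have up (m : nat) : c (n1 + m%:Z) = c' (n1 + m%:Z).
  elim/ltn_ind: m => m IH.
  have kp : (k < size p)%N.
    by rewrite ltnNge; apply: contra pk => /(nth_default 0) ->.
  have := cE (n1 + m%:Z + k%:Z); rewrite -(cE' (n1 + m%:Z + k%:Z)).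
  rewrite (bigD1 (Ordinal kp))//= [in RHS](bigD1 (Ordinal kp))//= !addrK.
  set A := \sum_(_ < _ | _) _; set B := \sum_(_ < _ | _) _.
  have -> : A = B.
    apply: eq_bigr => j jk; have [jltk|kltj|kj] := ltngtP j k.
    - by rewrite pj// !mul0r.
    - congr (_ * _); have [mj|jm] := leqP (j - k)%N m.
        have -> : n1 + m%:Z + k%:Z - j%:Z = n1 + (m - (j - k))%N%:Z.
          by rewrite -subzn// -[(j - k)%N%:Z]subzn ?(ltnW kltj)// opprB !addrA.
        by apply: IH; rewrite ltn_subrL subn_gt0 kltj (leq_trans _ mj)// subn_gt0.
      apply: low; rewrite -!addrA gtrDl addrA subr_lt0 -PoszD ltz_nat.
      by rewrite -ltn_subRL ltn_subRL addnC -ltn_subRL.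
    - by move: jk; rewrite -val_eqE /= kj eqxx.
  by move=> /addIr /(mulfI pk).
apply/funext => n; have [/low//|n1n] := ltP n n1.
have -> : n = n1 + `|n - n1|%N%:Z.
  by rewrite gez0_abs ?subr_ge0// subrKC.
exact: up.
Qed.

Lemma laurent_inv_exists (R : realType) (p : {poly R}) :
  p != 0 -> is_laurent_inv p (laurent_inv p).
Proof.
move=> p0; have [k [pk pj]] := poly_ord p0.
pose fix g (n : nat) : nat -> R := match n with
  | 0%N => fun i => (p`_k)^-1
  | n'.+1 => fun i => if i == n'.+1 then
     - (p`_k)^-1 * \sum_(j < n'.+1) p`_(k + j.+1) * g n' (n' - j)%N else g n' i
  end.
pose e n := g n n.
have gE n i : (i <= n)%N -> g n i = e i.
  elim: n => [|n IH]; first by rewrite leqn0 => /eqP ->.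
  rewrite leq_eqVlt => /orP[/eqP ->//|ilt] /=.
  by rewrite ltn_eqF// IH.
have eS n : p`_k * e n.+1 = - \sum_(j < n.+1) p`_(k + j.+1) * e (n - j)%N.
  rewrite {1}/e /= eqxx mulNr mulrN mulVKf//; congr (- _).
  by apply: eq_bigr => j _; rewrite gE// leq_subr.
pose E (n : int) : R := if n is Posz m then e m else 0.
have E0 n : n < 0 -> E n = 0 by case: n.
suff : [set c | is_laurent_inv p c] (fun n => E (n + k%:Z)).
  by move=> /(@xgetI _ (fun=> 0)).
split; first by exists (- k%:Z) => n nk; apply: E0; rewrite -ltrBrDr sub0r.
move=> n; pose F (j : nat) := p`_j * E (n - j%:Z + k%:Z).
rewrite -[LHS]/(\sum_(j < size p) F j).
have [n0|] := ltP n 0.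
  rewrite lt_eqF// big1// => j _; rewrite /F.
  have [/pj ->|kj] := ltnP j k; first by rewrite mul0r.
  rewrite E0 ?mulr0// -addrA addrC (le_lt_trans _ n0)// gerDr.
  by rewrite addrC subr_le0 lez_nat.
case: n @F => // n F _.
pose M := (size p + (k + n.+1))%N.
have -> : \sum_(j < size p) F j = \sum_(j < M) F j.
  rewrite /M big_split_ord /= [X in _ + X]big1 ?addr0// => j _.
  by rewrite /F nth_default ?leq_addr// mul0r.
rewrite /M addnC big_split_ord /= [X in _ + X]big1 ?addr0; last first.
  move=> j _; rewrite /F E0 ?mulr0//.
  by rewrite addrAC subr_lt0 -PoszD ltz_nat addnC -addnA ltn_add2l addSn ltnS leq_addr.
rewrite big_split_ord /= big1 ?add0r; last first.
  by move=> j _; rewrite /F pj// mul0r.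
have -> : \sum_(i < n.+1) F (k + i)%N = \sum_(i < n.+1) p`_(k + i) * e (n - i)%N.
  apply: eq_bigr => i _; rewrite /F PoszD opprD addrA addrAC subrK.
  by rewrite subzn// -ltnS.
rewrite big_ord_recl addn0 subn0; case: n {F M} => [|n].
  by rewrite big_ord0 addr0 mulfV.
rewrite eS addrC; apply/eqP; rewrite subr_eq0; apply/eqP.
by apply: eq_bigr => i _.
Qed.

(* Main.v *)
(* At a point x off the boundaries of the cones, the decomposition identity at a
   lattice point near t x (t large) says that the indicators of the
   full-dimensional recession cones add up to that of cone(P); so it holds almost
   everywhere.
   Write E(x) = exp(- <xi, x>).  If C is generated by mu_1, .., mu_n, the product
   of the difference operators f |-> f - f(. - mu_j) turns the indicator of C into
   that of a half-open parallelepiped and multiplies integrals against E by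
   \prod_j (1 - E(mu_j)).  This assigns to the possibly divergent integral of E
   over C the value |det mu| / \prod_j <xi, mu_j>, linearly and compatibly with
   identities holding almost everywhere, and for xi near (0, 1) it assigns to
   cone(P) its convergent integral.  For xi = (- q beta, 1) this gives
     \sum_i s_i |det mu_i| / \prod_j (m_ij - q beta.nu_ij)
       = \int_cone(P) exp (q beta.alpha - s) d(alpha, s)  -->  d! vol(P)
   as q -> 0, and the limit of a Laurent polynomial is its constant term.
   The integral is a translation invariant mean of the periodization
   v |-> \sum_(a in Z^n) f (v + a): it is total on bounded functions of bounded
   support and agrees with vol on convex bodies, so no measurability is needed. *)
Require Import Defs.
From HB Require Import structures.
From mathcomp Require Import all_boot all_order all_algebra.
From mathcomp Require Import all_classical all_reals all_analysis.
From mathcomp Require Import fingroup perm finmap ring lra zify.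
Import Order.TTheory GRing.Theory Num.Theory.
Import numFieldNormedType.Exports.
Local Open Scope classical_set_scope.
Local Open Scope ring_scope.

Set Implicit Arguments.
Unset Strict Implicit.
Unset Printing Implicit Defensive.

(** * Invariant means on an abelian group *)

Section InvariantMean.
Variables (R : realType) (V : zmodType).
Implicit Types (f g : V -> R) (s : seq V).

(** The generators are real vectors, so the series [sigma] of a cone need not be a rational function
    that could be evaluated; only coefficients can be compared. Hence the passage to lattice points
    near t x, where the apexes cost a bounded error and the lower-dimensional cones can be dodged. A
    generator may pair with xi to a value of either sign, so single cones have divergent integrals,
    and single terms may have a pole at q = 0; only the sum has a limit. The value by differences
    merely needs every pairing to be nonzero, which admissibility ensures for small q > 0. A
    finitely additive translation invariant integral need not be determined by its normalization
    outside convex bodies, so every volume formula (the determinant, base against cone) comes from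
    uniqueness of contents on convex bodies, and slicing by height is replaced by squeezing between
    prisms or frozen exponentials. The factor d! arises as follows: the cone below height s has
    volume s^(d+1) vol(P) / (d+1), and the integral of exp(- s) against d(s^(d+1)) is (d+1)!. *)

Definition bounded_function f := exists B, forall x, `|f x| <= B.

(** A Følner average: the mean of f over the sums c_1 v_1 + .. + c_k v_k with 0 <= c_i <= N, where
    v_1, .., v_k are the entries of [s]. *)
Fixpoint avg (N : nat) s f : R :=
  if s is v :: s' then
    N.+1%:R^-1 * \sum_(c < N.+1) avg N s' (fun x => f (x + v *+ c))
  else f 0.

Lemma avg_linear N s a f g :
  avg N s (fun x => a * f x + g x) = a * avg N s f + avg N s g.
Proof.
elim: s f g => [//|v s IH] f g /=.
rewrite mulrCA -mulrDr; congr (_ * _); rewrite mulr_sumr -big_split /=.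
by apply: eq_bigr => c _; rewrite -IH.
Qed.

Lemma avg_ge0 N s f : (forall x, 0 <= f x) -> 0 <= avg N s f.
Proof.
elim: s f => [|v s IH] f f0 /=; first exact: f0.
by rewrite mulr_ge0 ?invr_ge0// sumr_ge0// => c _; exact: IH.
Qed.

Lemma avg_cst N s (a : R) : avg N s (fun=> a) = a.
Proof.
elim: s => [//|v s IH] /=; under eq_bigr do rewrite IH.
by rewrite sumr_const card_ord -(mulr_natl a) mulKf// pnatr_eq0.
Qed.

Lemma avg_le N s f g : (forall x, f x <= g x) -> avg N s f <= avg N s g.
Proof.
move=> fg; rewrite -subr_ge0.
have -> : avg N s g - avg N s f = avg N s (fun x => -1 * f x + g x).
  by rewrite avg_linear mulN1r addrC.
by apply: avg_ge0 => x; rewrite mulN1r addrC subr_ge0.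
Qed.

Lemma avg_bound N s f (B : R) : (forall x, `|f x| <= B) -> `|avg N s f| <= B.
Proof.
move=> fB; rewrite ler_norml -{1}(avg_cst N s (- B)) -{2}(avg_cst N s B).
by apply/andP; split; apply: avg_le => x; have := fB x; rewrite ler_norml => /andP[].
Qed.

(* Averaging over c <= N of the translates by c v telescopes against one more
   translation by v. *)
Lemma avg_shift N s f v (B : R) : (forall x, `|f x| <= B) -> v \in s ->
  `|avg N s (fun x => f (x + v)) - avg N s f| <= N.+1%:R^-1 * (B + B).
Proof.
elim: s f => [//|w s IH] f fB /=; rewrite inE -mulrBr -sumrB.
have [-> _|vw /= vs] := eqVneq v w; last first.
  rewrite normrM ger0_norm ?invr_ge0// ler_pM2l ?invr_gt0//.
  apply: (le_trans (ler_norm_sum _ _ _)).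
  apply: (@le_trans _ _ (\sum_(c < N.+1) N.+1%:R^-1 * (B + B))).
    apply: ler_sum => c _.
    have -> : (fun x => f (x + w *+ c + v)) = (fun x => f (x + v + w *+ c)).
      by apply/funext => x; rewrite addrAC.
    exact: (IH (fun x => f (x + w *+ c))).
  by rewrite sumr_const card_ord -[leLHS]mulr_natl mulVKf// pnatr_eq0.
rewrite normrM ger0_norm ?invr_ge0// ler_pM2l ?invr_gt0//.
rewrite -(big_mkord xpredT (fun c => avg N s (fun x => f (x + w *+ c + w)) -
   avg N s (fun x => f (x + w *+ c)))).
under eq_bigr => c _.
  have -> : (fun x => f (x + w *+ c + w)) = (fun x => f (x + w *+ c.+1)).
    by apply/funext => x; rewrite mulrSr addrA.
  over.
rewrite (telescope_sumr (fun c => avg N s (fun x => f (x + w *+ c))))//.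
by rewrite (le_trans (ler_normB _ _))// lerD// avg_bound.
Qed.

Lemma ultra_fmap (T U : Type) (F : set_system T) (h : T -> U) :
  UltraFilter F -> UltraFilter (h @ F).
Proof.
move=> UF; split; first exact: fmap_proper_filter.
move=> G PG FG; apply/seteqP; split; last exact: FG.
move=> A GA; have [//|] := in_ultra_setVsetC (h @^-1` A) UF.
rewrite preimage_setC => /FG GnA.
have G0 : G set0 by rewrite -(setICr A); exact: filterI.
by have := @filter_not_empty _ G PG G0.
Qed.

Lemma ultra_bounded_cvg (T : Type) (F : set_system T) (h : T -> R) (B : R) :
  UltraFilter F -> (forall x, `|h x| <= B) -> cvg (h @ F).
Proof.
move=> UF hB.
have := @segment_compact R (- B) B; rewrite compact_ultra => /(_ (h @ F)).
case=> [||l [_ hl]]; [exact: ultra_fmap| |by apply/cvg_ex; exists l].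
change (F (h @^-1` [set` `[- B, B]%R])); apply: filterE => x /=.
by rewrite in_itv/= -ler_norml.
Qed.

(** Limit of the averages along an ultrafilter for which [s] eventually contains any given vectors
    and N is large; it exists by compactness of [-B, B]. Translation by v changes an average over a
    list containing v by at most 2 B / (N+1), which dies in the limit. *)
Lemma invariant_mean : exists m : (V -> R) -> R,
  [/\ forall a f g, bounded_function f -> bounded_function g ->
        m (fun x => a * f x + g x) = a * m f + m g,
      forall f, bounded_function f -> (forall x, 0 <= f x) -> 0 <= m f,
      m (fun=> 1) = 1 &
      forall f v, bounded_function f -> m (fun x => f (x + v)) = m f].
Proof.
pose F : set_system (seq V * nat) := [set A | exists s0 N0,
  forall s N, {subset s0 <= s} -> (N0 <= N)%N -> A (s, N)].
have FF : ProperFilter F.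
  split.
    by move=> [s0 [N0]] /(_ s0 N0 (fun _ => id) (leqnn _)).
  split.
  - by exists [::], 0%N.
  - move=> A B [sA [NA AA]] [sB [NB BB]].
    exists (sA ++ sB), (maxn NA NB) => s N ss; rewrite geq_max => /andP[? ?].
    split; [apply: AA|apply: BB] => // x xs; apply: ss; rewrite mem_cat xs//.
    by rewrite orbT.
  - by move=> A B AB [s0 [N0 h]]; exists s0, N0 => s N ss NN; apply/AB/h.
have [U [UU FU]] := ultraFilterLemma FF.
pose a f (p : seq V * nat) := avg p.2 p.1 f.
have cv f : bounded_function f -> cvg (a f @ U).
  move=> [B fB]; apply: (@ultra_bounded_cvg _ _ _ B) => p; exact: avg_bound.
exists (fun f => lim (a f @ U)); split.
- move=> c f g bf bg.
  have -> : a (fun x => c * f x + g x) = (fun p => c * a f p + a g p).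
    by apply/funext => p; rewrite /a avg_linear.
  apply/cvg_lim => //; apply: cvgD; last exact: cv.
  by apply: cvgM; [exact: cvg_cst|exact: cv].
- move=> f bf f0; apply: limr_ge; first exact: cv.
  by apply: filterE => p; exact: avg_ge0.
- have -> : a (fun=> 1) = cst 1 by apply/funext => p; exact: avg_cst.
  exact: lim_cst.
- move=> f v [B fB].
  have bf : bounded_function f by exists B.
  have bfv : bounded_function (fun x => f (x + v)) by exists B.
  apply/eqP; rewrite -subr_eq0; apply/eqP.
  rewrite -(limB (cv _ bfv) (cv _ bf)).
  apply/cvg_lim => //; apply/cvgrPdist_le => e e0.
  apply: FU; exists [:: v], (Num.truncn ((B + B) / e)) => s N vs NN /=.
  rewrite sub0r normrN (le_trans (avg_shift _ fB _))//.
    by apply: vs; rewrite inE.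
  rewrite ler_pdivrMl// -ler_pdivrMr//=.
  by rewrite (le_trans (ltW (truncnS_gt _)))// ler_nat.
Qed.

End InvariantMean.

(** * A translation invariant integral on R^n *)

Definition int_box (n M : nat) : set 'cV[int]_n :=
  [set a | forall i, `|a i 0| <= M%:Z].

Lemma finite_int_box n M : finite_set (@int_box n M).
Proof.
pose h (p : {ffun 'I_n -> 'I_(M + M).+1}) : 'cV[int]_n :=
  \col_i ((p i)%:Z - M%:Z).
apply: (@sub_finite_set _ _ (h @` setT)); last exact/finite_image/finite_finset.
move=> a aM; exists [ffun i => inord (absz (a i 0 + M%:Z))] => //.
apply/colP => i; rewrite mxE ffunE inordK; have := aM i; lia.
Qed.


Section Integral.
Variables (R : realType) (n : nat).
Implicit Types (f g : 'cV[R]_n -> R) (x y v : 'cV[R]_n).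

Definition bounded_support f :=
  exists M : nat, forall x,
    `|f x| <= M%:R /\ (f x != 0 -> forall i, `|x i 0| <= M%:R).

Definition unit_cube : set 'cV[R]_n := [set x | forall i, 0 <= x i 0 < 1].

(* L is defined on all functions; no measurability is required. *)
Definition is_integral (L : ('cV[R]_n -> R) -> R) :=
  [/\ forall a f g, bounded_support f -> bounded_support g ->
        L (fun x => a * f x + g x) = a * L f + L g,
      forall f, bounded_support f -> (forall x, 0 <= f x) -> 0 <= L f,
      L \1_unit_cube = 1 &
      forall f v, bounded_support f -> L (fun x => f (x + v)) = L f].

(** A sum with finite support; bounded support of f makes it finite at every v. *)
Definition periodization f v : R :=
  \sum_(a \in [set: 'cV[int]_n]) f (v + map_mx intr a).

Let fracv v : 'cV[R]_n := v - map_mx intr (\col_i Num.floor (v i 0)).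

Let fracv_itv v i : 0 <= fracv v i 0 < 1.
Proof.
by rewrite !mxE subr_ge0 ltrBlDr addrC -intrD1 floor_le floorD1_gt.
Qed.

(** Moving v to its fractional part makes the range of summation independent of v, which gives both
    linearity and a uniform bound. *)
Let periodizationE f v (M : nat) :
  (forall x, f x != 0 -> forall i, `|x i 0| <= M%:R) ->
  periodization f v =
  \sum_(a <- fset_set (@int_box n M.+1)) f (fracv v + map_mx intr a).
Proof.
move=> fM; rewrite /periodization.
pose w : 'cV[int]_n := \col_i Num.floor (v i 0).
rewrite (reindex_fsbigT (fun a => a - w)); last first.
  by exists (fun a => a + w) => a; rewrite ?subrK ?addrK.
rewrite -fsbig_finite; last exact: finite_int_box.
symmetry.
have E a : fracv v + map_mx intr a = v + map_mx intr (a - w).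
  by rewrite /fracv -/w map_mxB addrAC -addrA.
under eq_fsbigr do rewrite E.
apply: fsbig_widen => // a [_ aM] /=; apply/eqP; apply: contra_notT aM.
rewrite -E => /fM fa i; have := fa i; have := fracv_itv v i.
rewrite !mxE; set t := _ - _; set s := a i 0.
move=> /andP[t0 t1]; rewrite ler_norml => /andP[h1 h2].
have h3 : s%:~R <= (M.+1%:Z)%:~R :> R by rewrite -pmulrn -natr1; lra.
have h4 : (- M.+1%:Z)%:~R <= s%:~R :> R.
  by rewrite mulrNz -pmulrn -natr1; lra.
by move: h3 h4; rewrite !ler_int ler_norml => -> ->.
Qed.

Let bounded_periodization f :
  bounded_support f -> bounded_function (periodization f).
Proof.
move=> [M fM]; exists (\sum_(a <- fset_set (@int_box n M.+1)) M%:R) => v.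
rewrite (@periodizationE _ _ M) => [|x fx]; last exact: (fM x).2.
by rewrite (le_trans (ler_norm_sum _ _ _))// ler_sum// => a _; case: (fM (fracv v + map_mx intr a)).
Qed.

(** For n > 0 an invariant mean kills functions of bounded support, so the mean is applied to
    periodizations. The normalization holds because each v has exactly one integer translate in the
    half-open cube. *)
Lemma integral_exists : exists L, is_integral L.
Proof.
have [m [mlin mpos m1 mT]] := @invariant_mean R 'cV[R]_n.
exists (fun f => m (periodization f)); split.
- move=> a f g bf bg; rewrite -mlin; [|exact: bounded_periodization..].
  congr m; apply/funext => v; case: bf bg => [M fM] [M' gM].
  rewrite !(@periodizationE _ _ (maxn M M')).
  + by rewrite mulr_sumr -big_split.
  + move=> x gx i; rewrite (le_trans ((gM x).2 gx i))// ler_nat leq_max leqnn.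
    by rewrite orbT.
  + move=> x gx i; rewrite (le_trans ((fM x).2 gx i))// ler_nat leq_max leqnn.
    by [].
  + move=> x fg i; have [fx|/(fM x).2/(_ i) fx] := eqVneq (f x) 0.
      have gx : g x != 0 by move: fg; rewrite fx mulr0 add0r.
      by rewrite (le_trans ((gM x).2 gx i))// ler_nat leq_max leqnn orbT.
    by rewrite (le_trans fx)// ler_nat leq_max leqnn.
- move=> f bf f0; apply: mpos; first exact: bounded_periodization.
  move=> v; case: bf => M fM.
  rewrite (@periodizationE _ _ M) => [|x fx]; last exact: (fM x).2.
  by apply: sumr_ge0 => a _.
- rewrite -[RHS]m1; congr m; apply/funext => v; rewrite /periodization.
  pose w : 'cV[int]_n := - \col_i Num.floor (v i 0).
  rewrite -(fsbig_widen [set w])//; last first.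
    move=> a [_ aw] /=; rewrite indicE; apply/eqP; rewrite pnatr_eq0 eqb0.
    apply/negP => /set_mem va; apply: aw; apply/colP => i; have := va i.
    rewrite !mxE => /andP[h1 h2]; apply/eqP; rewrite eq_sym eqr_oppLR.
    rewrite floor_eq; apply/andP; split.
      by rewrite mulrNz; lra.
    by rewrite intrD1 mulrNz; lra.
  rewrite fsbig_set1 indicE mem_set//= => i.
  by have := fracv_itv v i; rewrite !mxE mulrNz.
- move=> f v bf; rewrite -[RHS](mT _ v (bounded_periodization bf)); congr m.
  apply/funext => x; apply: eq_fsbigr => a _; by rewrite addrAC.
Qed.
End Integral.

(** * Bounded support and linearity of the integral *)

Section BoundedSupport.
Variables (R : realType) (n : nat).
Implicit Types (f g : 'cV[R]_n -> R) (x y v : 'cV[R]_n) (A B : set 'cV[R]_n).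

Definition bounded_cV A := exists M : nat, forall x, A x -> forall i, `|x i 0| <= M%:R.

Lemma bounded_cV_sub A B : A `<=` B -> bounded_cV B -> bounded_cV A.
Proof. by move=> AB [M BM]; exists M => x /AB; exact: BM. Qed.

Lemma bounded_cVU A B : bounded_cV A -> bounded_cV B -> bounded_cV (A `|` B).
Proof.
move=> [M AM] [N BN]; exists (maxn M N) => x [/AM|/BN] h i;
  by rewrite (le_trans (h i))// ler_nat leq_max leqnn ?orbT.
Qed.

Lemma bounded_cV_bigU (I : eqType) (s : seq I) (F : I -> set 'cV[R]_n) :
  (forall i, i \in s -> bounded_cV (F i)) ->
  bounded_cV [set x | exists2 i, i \in s & F i x].
Proof.
elim: s => [|j s IH] h; first by exists 0%N => x [].
apply: (@bounded_cV_sub _ (F j `|` [set x | exists2 i, i \in s & F i x])).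
  move=> x [i]; rewrite inE => /orP[/eqP ->|is_ Fi]; first by left.
  by right; exists i.
apply: bounded_cVU; first by apply: h; rewrite mem_head.
by apply: IH => i is_; apply: h; rewrite inE is_ orbT.
Qed.

Lemma bounded_cV_shift A v : bounded_cV A -> bounded_cV [set x | A (x + v)].
Proof.
move=> [M AM]; exists (M + Num.truncn (\sum_i `|v i 0|)).+1 => x /AM h i.
have := h i; rewrite !mxE -natr1 natrD => hi.
have vs : `|v i 0| <= \sum_i `|v i 0|.
  by rewrite (bigD1 i)//= lerDl sumr_ge0.
have := truncnS_gt (\sum_i `|v i 0|); rewrite -natr1 => ht.
rewrite -[x i 0](addrK (v i 0)) (le_trans (ler_normB _ _))//; lra.
Qed.

Lemma bounded_support_le f g : (forall x, `|f x| <= `|g x|) ->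
  bounded_support g -> bounded_support f.
Proof.
move=> fg [M gM]; exists M => x; split; first exact: le_trans (fg x) (gM x).1.
move=> fx; apply: (gM x).2; rewrite -normr_gt0 (lt_le_trans _ (fg x))//.
by rewrite normr_gt0.
Qed.

Lemma bounded_supportP f : bounded_support f <->
  (exists C, forall x, `|f x| <= C) /\ bounded_cV [set x | f x != 0].
Proof.
split=> [[M fM]|[[C fC] [M fM]]].
  by split; [exists M%:R => x; case: (fM x)|exists M => x; apply (fM x).2].
exists (maxn M (Num.truncn C).+1) => x; split.
  rewrite (le_trans (fC x))// (le_trans (ltW (truncnS_gt _)))// ler_nat.
  by rewrite leq_max leqnn orbT.
by move=> /fM h i; rewrite (le_trans (h i))// ler_nat leq_max leqnn.
Qed.

Lemma bounded_support_linear a f g : bounded_support f -> bounded_support g ->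
  bounded_support (fun x => a * f x + g x).
Proof.
move=> /bounded_supportP[[C fC] bf] /bounded_supportP[[D gD] bg].
apply/bounded_supportP; split.
  exists (`|a| * C + D) => x; rewrite (le_trans (ler_normD _ _))// lerD//.
  by rewrite normrM ler_wpM2l.
apply: bounded_cV_sub (bounded_cVU bf bg) => x /=.
by have [->|] := eqVneq (f x) 0; [rewrite mulr0 add0r; right|left].
Qed.

Lemma bounded_support0 : @bounded_support R n (fun=> 0).
Proof. by exists 0%N => x; rewrite normr0 eqxx. Qed.

Lemma bounded_supportD f g : bounded_support f -> bounded_support g ->
  bounded_support (fun x => f x + g x).
Proof.
move=> bf bg; have := bounded_support_linear 1 bf bg.
by under eq_fun do rewrite mul1r.
Qed.

Lemma bounded_supportZ a f : bounded_support f ->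
  bounded_support (fun x => a * f x).
Proof.
move=> bf; have := bounded_support_linear a bf bounded_support0.
by under eq_fun do rewrite addr0.
Qed.

Lemma bounded_supportB f g : bounded_support f -> bounded_support g ->
  bounded_support (fun x => f x - g x).
Proof.
move=> bf bg; have := bounded_support_linear (-1) bg bf.
by under eq_fun do rewrite mulN1r addrC.
Qed.

Lemma bounded_support_sum (I : Type) (s : seq I) (F : I -> 'cV[R]_n -> R) :
  (forall i, bounded_support (F i)) ->
  bounded_support (fun x => \sum_(i <- s) F i x).
Proof.
move=> bF; elim: s => [|i s IH].
  by under eq_fun do rewrite big_nil; exact: bounded_support0.
by under eq_fun do rewrite big_cons; exact: bounded_supportD.
Qed.

Lemma bounded_support_shift f v :
  bounded_support f -> bounded_support (fun x => f (x + v)).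
Proof.
move=> /bounded_supportP[[C fC] bf]; apply/bounded_supportP; split.
  by exists C.
exact: (bounded_cV_shift v bf).
Qed.

Lemma bounded_support_indic A : bounded_cV A -> bounded_support \1_A.
Proof.
move=> bA; apply/bounded_supportP; split.
  by exists 1 => x; rewrite indicE ger0_norm// lern1 leq_b1.
apply: bounded_cV_sub bA => x /=; rewrite indicE pnatr_eq0 eqb0 negbK.
exact: set_mem.
Qed.

Lemma bounded_supportM f g :
  (forall M : nat, exists C : R, forall x, (forall i, `|x i 0| <= M%:R) -> `|g x| <= C) ->
  bounded_support f -> bounded_support (fun x => g x * f x).
Proof.
move=> bg [M fM]; have [C gC] := bg M.
apply/bounded_supportP; split; last first.
  by exists M => x /=; rewrite mulf_eq0 negb_or => /andP[_ /(fM x).2].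
exists (`|C| * M%:R) => x; have [->|fx] := eqVneq (f x) 0.
  by rewrite mulr0 normr0 mulr_ge0.
rewrite normrM ler_pM//; last exact: (fM x).1.
by rewrite (le_trans (gC x ((fM x).2 fx)))// ler_norm.
Qed.

End BoundedSupport.

Section IntegralTheory.
Variables (R : realType) (n : nat) (L : ('cV[R]_n -> R) -> R).
Hypothesis HL : is_integral L.
Implicit Types (f g : 'cV[R]_n -> R) (x y v : 'cV[R]_n) (A B : set 'cV[R]_n).

Lemma integralD f g : bounded_support f -> bounded_support g ->
  L (fun x => f x + g x) = L f + L g.
Proof.
move=> bf bg; case: HL => + _ _ _ => /(_ 1 _ _ bf bg).
by under eq_fun do rewrite mul1r; rewrite mul1r.
Qed.

Lemma integral0 : L (fun=> 0) = 0.
Proof.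
have := integralD (@bounded_support0 R n) (@bounded_support0 R n).
under eq_fun do rewrite addr0.
by move/eqP; rewrite addrC -subr_eq subrr eq_sym => /eqP.
Qed.

Lemma integralZ a f : bounded_support f -> L (fun x => a * f x) = a * L f.
Proof.
move=> bf; case: HL => + _ _ _ => /(_ a _ _ bf (@bounded_support0 R n)).
by under eq_fun do rewrite addr0; rewrite integral0 addr0.
Qed.

Lemma integralB f g : bounded_support f -> bounded_support g ->
  L (fun x => f x - g x) = L f - L g.
Proof.
move=> bf bg; case: HL => + _ _ _ => /(_ (-1) _ _ bg bf).
by under eq_fun do rewrite mulN1r addrC; rewrite mulN1r addrC.
Qed.

Lemma integral_sum (I : Type) (s : seq I) (F : I -> 'cV[R]_n -> R) :
  (forall i, bounded_support (F i)) ->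
  L (fun x => \sum_(i <- s) F i x) = \sum_(i <- s) L (F i).
Proof.
move=> bF; elim: s => [|i s IH].
  by under eq_fun do rewrite big_nil; rewrite big_nil integral0.
under eq_fun do rewrite big_cons; rewrite big_cons integralD ?IH//.
exact: bounded_support_sum.
Qed.

Lemma integral_le f g : bounded_support f -> bounded_support g ->
  (forall x, f x <= g x) -> L f <= L g.
Proof.
move=> bf bg fg; rewrite -subr_ge0 -integralB//; case: HL => _ + _ _; apply.
  exact: bounded_supportB.
by move=> x; rewrite subr_ge0.
Qed.

Lemma integral_ge0 f : bounded_support f -> (forall x, 0 <= f x) -> 0 <= L f.
Proof. by case: HL => _ + _ _; apply. Qed.

Lemma integral_shift f v : bounded_support f -> L (fun x => f (x + v)) = L f.
Proof. by case: HL => _ _ _ + bf; apply. Qed.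

Lemma le_abs_integral f g : bounded_support g ->
  (forall x, `|f x| <= g x) -> `|L f| <= L g.
Proof.
move=> bg fg.
have bf : bounded_support f.
  by apply: bounded_support_le bg => x; rewrite (le_trans (fg x))// ler_norm.
rewrite ler_norml; apply/andP; split.
  have -> : - L g = L (fun x => 0 - g x).
    by rewrite integralB ?integral0 ?sub0r//; exact: bounded_support0.
  apply: integral_le => //; first exact/bounded_supportB/bg/bounded_support0.
  by move=> x; have := fg x; rewrite ler_norml sub0r => /andP[].
by apply: integral_le => // x; have := fg x; rewrite ler_norml => /andP[].
Qed.

End IntegralTheory.

(** * Finitely additive contents on bounded sets *)

Section Content.
Variables (R : realType) (n : nat).
Implicit Types (x y v : 'cV[R]_n) (A B : set 'cV[R]_n).

(** Isolated from integrals because uniqueness on convex bodies is applied to several contents: the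
    integral of indicators, its normalized pullback by a matrix, and the normalized volume of
    prisms. *)
Definition is_content (l : set 'cV[R]_n -> R) :=
  [/\ forall A, bounded_cV A -> 0 <= l A,
      forall A B, bounded_cV A -> bounded_cV B -> A `&` B = set0 ->
        l (A `|` B) = l A + l B,
      l (@unit_cube R n) = 1 &
      forall A v, bounded_cV A -> l [set x | A (x + v)] = l A].

Lemma indicU A B x : A `&` B = set0 ->
  \1_(A `|` B) x = \1_A x + \1_B x :> R.
Proof.
move=> AB; rewrite !indicE in_setU -natrD; congr (_%:R).
have : ~ (A x /\ B x) by move=> h; rewrite -[False]/(set0 x) -AB.
by case: (boolP (x \in A)) => [/set_mem Ax|_];
  case: (boolP (x \in B)) => [/set_mem Bx|_] => // [[]].
Qed.

Lemma integral_content L : is_integral L -> is_content (fun A => L \1_A).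
Proof.
move=> HL; split.
- by move=> A bA; apply: (integral_ge0 HL) => //; exact: bounded_support_indic.
- move=> A B bA bB AB; rewrite -(integralD HL); [|exact: bounded_support_indic..].
  by congr L; apply/funext => x; exact: indicU.
- by case: HL.
- move=> A v bA; rewrite -[RHS](integral_shift HL v); last exact: bounded_support_indic.
  by congr L; apply/funext => x; rewrite !indicE.
Qed.

Variable l : set 'cV[R]_n -> R.
Hypothesis Hl : is_content l.

Lemma content_le A B : A `<=` B -> bounded_cV B -> l A <= l B.
Proof.
move=> AB bB; case: Hl => l0 lU _ _.
have bA := bounded_cV_sub AB bB.
have bD : bounded_cV (B `\` A) by apply: bounded_cV_sub bB => x [].
have -> : l B = l A + l (B `\` A) by rewrite -lU ?setDUK// setDIK.
by rewrite lerDl l0.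
Qed.

Lemma content0 : l set0 = 0.
Proof.
case: Hl => _ lU _ _; have b0 : bounded_cV (@set0 'cV[R]_n) by exists 0%N.
have := lU _ _ b0 b0; rewrite setU0 setI0 => /(_ erefl)/eqP.
by rewrite -subr_eq subrr eq_sym => /eqP.
Qed.

Lemma content_bigU (I : eqType) (s : seq I) (F : I -> set 'cV[R]_n) :
  uniq s -> (forall i, i \in s -> bounded_cV (F i)) ->
  (forall i j x, F i x -> F j x -> i = j) ->
  l [set x | exists2 i, i \in s & F i x] = \sum_(i <- s) l (F i).
Proof.
move=> + + Fij; elim: s => [|i s IH] /=.
  by rewrite big_nil => _ _; rewrite -content0; congr l; apply/seteqP; split => [x []|].
move=> /andP[ni us] bF; rewrite big_cons -IH//; last first.
  by move=> j js; apply: bF; rewrite inE js orbT.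
case: Hl => _ lU _ _; rewrite -lU.
- congr l; apply/seteqP; split => x.
    by move=> [j]; rewrite inE => /orP[/eqP ->|js] Fj; [left|right; exists j].
  move=> [Fi|[j js Fj]]; first by exists i => //; rewrite mem_head.
  by exists j => //; rewrite inE js orbT.
- by apply: bF; rewrite mem_head.
- by apply: bounded_cV_bigU => j js; apply: bF; rewrite inE js orbT.
- apply/seteqP; split => // x [/= Fi [j js Fj]].
  by move: ni; rewrite (Fij _ _ _ Fi Fj) js.
Qed.

Lemma content_bigU_le (I : eqType) (s : seq I) (F : I -> set 'cV[R]_n) :
  (forall i, i \in s -> bounded_cV (F i)) ->
  l [set x | exists2 i, i \in s & F i x] <= \sum_(i <- s) l (F i).
Proof.
elim: s => [|i s IH] bF.
  rewrite big_nil -content0; apply: content_le => [x []//|]; by exists 0%N.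
have bi : bounded_cV (F i) by apply: bF; rewrite mem_head.
have bs j : j \in s -> bounded_cV (F j) by move=> js; apply: bF; rewrite inE js orbT.
rewrite big_cons; set U := [set x | exists2 j, j \in s & F j x] in IH *.
have bU : bounded_cV U by exact: bounded_cV_bigU.
apply: (@le_trans _ _ (l (F i `|` (U `\` F i)))).
  apply: content_le; last first.
    by apply: bounded_cVU => //; apply: bounded_cV_sub bU => x [].
  move=> x [j]; rewrite inE => /orP[/eqP ->|js Fj]; first by left.
  by case: (pselect (F i x)) => [|nF]; [left|right; split => //; exists j].
case: Hl => _ lU _ _; rewrite lU//; last 2 first.
  by apply: bounded_cV_sub bU => x [].
  by rewrite setDIK.
rewrite lerD2l (le_trans _ (IH bs))//; apply: content_le => // x [].
Qed.

(** Grid cubes of side 1/(K+1), half-open so that they tile the space. *)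
Definition cell (K : nat) (a : 'cV[int]_n) : set 'cV[R]_n :=
  [set x | forall i, (a i 0)%:~R <= K.+1%:R * x i 0 < (a i 0)%:~R + 1].

Lemma bounded_cell K a : bounded_cV (cell K a).
Proof.
exists (\sum_i absz (a i 0%R)).+1 => x /= ax i; have /andP[h1 h2] := ax i.
have h : (absz (a i 0%R))%:R <= (\sum_i absz (a i 0%R))%:R :> R.
  by rewrite ler_nat (bigD1 i)//= leq_addr.
have : `|K.+1%:R * x i 0| <= (absz (a i 0%R)).+1%:R.
  rewrite -[leRHS]natr1 natr_absz intr_norm ler_norml.
  have := ler_norm ((a i 0)%:~R : R); have := ler_norm (- (a i 0)%:~R : R).
  by rewrite normrN => ? ?; apply/andP; split; lra.
rewrite normrM ger0_norm// -!natr1 => h3.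
have : `|x i 0| <= (K%:R + 1) * `|x i 0| by rewrite ler_peMl// lerDr.
lra.
Qed.

Lemma cell_inj K a b x : cell K a x -> cell K b x -> a = b.
Proof.
move=> ax bx; apply/colP => i; have := ax i; have := bx i.
by rewrite -!intrD1 -!floor_eq => /eqP <- /eqP <-.
Qed.

Lemma mem_cell K x : exists a, cell K a x.
Proof.
exists (\col_i Num.floor (K.+1%:R * x i 0)) => i.
by rewrite !mxE -intrD1 floor_itv.
Qed.

(** All cells are translates of one another, and (K+1)^n of them tile the unit cube. *)
Lemma content_cell K a : l (cell K a) = K.+1%:R ^- n.
Proof.
have K0 : K.+1%:R != 0 :> R by rewrite pnatr_eq0.
have shift b : l (cell K b) = l (cell K 0).
  case: Hl => _ _ _ lT.
  rewrite -(lT (cell K b) (K.+1%:R^-1 *: map_mx intr b)); last exact: bounded_cell.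
  congr l; apply/seteqP; split => x h i; have := h i;
    rewrite !mxE mulrDr mulrA mulfV// mul1r => /andP[? ?]; apply/andP; split; lra.
rewrite shift.
have -> : l (cell K 0) = K.+1%:R ^- n * ((K.+1 ^ n)%:R * l (cell K 0)).
  by rewrite natrX mulKf// expf_neq0.
pose h (p : {ffun 'I_n -> 'I_K.+1}) : 'cV[int]_n := \col_i (p i)%:Z.
have -> : (K.+1 ^ n)%:R * l (cell K 0) =
    \sum_(p <- enum {ffun 'I_n -> 'I_K.+1}) l (cell K (h p)).
  under eq_bigr do rewrite shift.
  by rewrite big_enum /= sumr_const card_ffun !card_ord mulr_natl.
rewrite -content_bigU ?enum_uniq//.
- case: Hl => _ _ l1 _; rewrite -[RHS]mulr1 -l1; congr (_ * l _).
  apply/seteqP; split => x.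
    move=> [p _ px] i; have := px i; rewrite !mxE -pmulrn => /andP[p1 p2].
    have pK : (p i)%:R + 1 <= K.+1%:R :> R by rewrite natr1 ler_nat.
    apply/andP; split.
      by rewrite -(pmulr_rge0 _ (ltr0Sn R K)) (le_trans _ p1).
    by rewrite -(ltr_pM2l (ltr0Sn R K)) mulr1 (lt_le_trans p2).
  move=> x01; exists [ffun i => inord (Num.truncn (K.+1%:R * x i 0))].
    by rewrite mem_enum.
  move=> i; have /andP[x0 x1] := x01 i; rewrite !mxE ffunE inordK -?pmulrn.
    by rewrite natr1; apply: truncn_itv; rewrite mulr_ge0.
  by rewrite truncn_lt_nat ?mulr_ge0// -[ltRHS]mulr1 ltr_pM2l.
- by move=> p _; exact: bounded_cell.
- move=> p q x /cell_inj + /[dup] _ => /[apply] /colP pq.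
  apply/ffunP => i; apply/val_inj => /=; have := pq i; rewrite !mxE.
  by case.
Qed.

End Content.

(** Closes the approximation arguments below: errors are arranged as a polynomial in the mesh
    1/(K+1), so that continuity at 0 finishes. *)
Lemma le_horner0 (R : realType) (p : {poly R}) (c : R) :
  (forall K : nat, c <= p.[K.+1%:R^-1]) -> c <= p.[0].
Proof.
move=> h.
have cv : p.[K.+1%:R^-1] @[K --> \oo] --> p.[0].
  by apply: cvg_comp; [exact: cvg_harmonic|exact: continuous_horner].
rewrite -(cvg_lim (@Rhausdorff R) cv); apply: limr_ge; first exact: cvgP cv.
exact: nearW.
Qed.

(** * Contents agree with Lebesgue measure on convex bodies *)

Section ContentVolume.
Variables (R : realType) (n : nat) (l : set 'cV[R]_n -> R).
Hypothesis Hl : is_content l.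
Implicit Types (x y v a b p : 'cV[R]_n) (S : set 'cV[R]_n).

Lemma bounded_box a b : bounded_cV (box a b).
Proof.
exists (Num.truncn (\sum_i (`|a i 0| + `|b i 0|))).+1 => x h i.
apply: (le_trans _ (ltW (truncnS_gt _))).
rewrite (bigD1 i)//=; set s := \sum_(_ | _) _.
have : 0 <= s by apply: sumr_ge0.
have /andP[h1 h2] := h i.
have := ler_norm (b i 0); have := ler_norm (- a i 0); rewrite normrN => h3 h4 h5.
rewrite ler_norml; apply/andP; split.
  have := normr_ge0 (b i 0); lra.
have := normr_ge0 (a i 0); lra.
Qed.

Lemma bounded_unit_cube : bounded_cV (@unit_cube R n).
Proof.
apply: bounded_cV_sub (bounded_box 0 (const_mx 1)) => x h i.
by have /andP[h1 h2] := h i; rewrite !mxE h1 ltW.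
Qed.

(** In direction i, trunc((K+1)(b_i - a_i)) + 1 cells suffice, of total length at most b_i - a_i +
    1/(K+1); [p] at 1/(K+1) is the product of these lengths. *)
Lemma content_box a b : (forall i, a i 0 <= b i 0) ->
  l (box a b) <= box_volume a b.
Proof.
move=> ab.
pose p : {poly R} := \prod_(i < n) ((b i 0 - a i 0)%:P + 'X).
have -> : box_volume a b = p.[0].
  by rewrite horner_prod; apply: eq_bigr => i _; rewrite !hornerE.
apply: le_horner0 => K.
pose m i := (Num.truncn (K.+1%:R * (b i 0 - a i 0))).+1.
pose T := {dffun forall i : 'I_n, 'I_(m i)}.
pose F (q : T) := [set x | cell K (\col_i (q i : nat)%:Z) (x - a)].
have bF q : bounded_cV (F q) by apply/bounded_cV_shift/bounded_cell.
have lF q : l (F q) = K.+1%:R ^- n.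
  case: Hl => _ _ _ lT; rewrite -(content_cell Hl K (\col_i (q i : nat)%:Z)).
  by rewrite -[RHS](lT _ (- a))//; exact: bounded_cell.
apply: (@le_trans _ _ (l [set x | exists2 q, q \in enum T & F q x])).
  apply: (content_le Hl); last by apply: bounded_cV_bigU => q _.
  move=> x xab.
  pose t i := Num.truncn (K.+1%:R * (x i 0 - a i 0)).
  have tm i : (t i < m i)%N.
    rewrite ltnS /t; apply: le_truncn; rewrite ler_pM2l// lerB//.
    by have /andP[] := xab i.
  exists [ffun i => Ordinal (tm i)]; first by rewrite mem_enum.
  move=> i; rewrite !mxE !ffunE /= -pmulrn natr1; apply: truncn_itv.
  by rewrite mulr_ge0// subr_ge0; have /andP[] := xab i.
apply: (le_trans (content_bigU_le Hl _)) => //.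
under eq_bigr do rewrite lF.
rewrite big_enum sumr_const card_dep_ffun foldrE big_map big_enum /=.
under eq_bigr do rewrite card_ord.
rewrite -[_ *+ _]mulr_natl natr_prod -exprVn.
have -> : K.+1%:R^-1 ^+ n = \prod_(i < n) K.+1%:R^-1 :> R.
  by rewrite prodr_const card_ord.
rewrite -big_split horner_prod /=; apply: ler_prod => i _.
rewrite !hornerE mulr_ge0// ?invr_ge0//= ler_pdivrMr// mulrDl mulVf ?pnatr_eq0//.
have : (Num.truncn (K.+1%:R * (b i 0 - a i 0)))%:R <= K.+1%:R * (b i 0 - a i 0).
  have /truncn_itv/andP[] : 0 <= K.+1%:R * (b i 0 - a i 0) by rewrite mulr_ge0// subr_ge0.
  by [].
by rewrite /m -[X in _ -> X <= _]natr1 [_ * K.+1%:R]mulrC lerD2r.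
Qed.

Lemma open_strict_box a b : open [set x : 'cV[R]_n | forall i, a i 0 < x i 0 < b i 0].
Proof.
rewrite openE => x ab.
apply: (@filter_forall _ _
  (fun i => [set y : 'cV[R]_n | a i 0 < y i 0 < b i 0]) (nbhs x)) => i.
have /andP[ai bi] := ab i.
have c := @coord_continuous _ n 1 i 0 x.
near=> y; apply/andP; split.
  by near: y; exact: cvgr_gt c _ ai.
by near: y; exact: cvgr_lt c _ bi.
Unshelve. all: by end_near. Qed.

Lemma sum_half_pow_le1 (s : seq nat) :
  uniq s -> \sum_(k <- s) 2^-1 ^+ k.+1 <= 1 :> R.
Proof.
move=> us; pose m := (\max_(k <- s) k).+1.
have sm k : k \in s -> (k < m)%N by move=> ks; rewrite ltnS leq_bigmax_seq.
have -> : \sum_(k <- s) 2^-1 ^+ k.+1 = \sum_(k <- iota 0 m | k \in s) 2^-1 ^+ k.+1 :> R.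
  rewrite -[RHS]big_filter; apply: perm_big; apply: uniq_perm => //.
    exact/filter_uniq/iota_uniq.
  move=> k; rewrite mem_filter mem_iota add0n /=.
  by case: (boolP (k \in s)) => // /sm ->.
apply: (@le_trans _ _ (\sum_(k <- iota 0 m) 2^-1 ^+ k.+1)).
  rewrite big_mkcond; apply: ler_sum => k _; by case: ifP.
suff -> : \sum_(k <- iota 0 m) 2^-1 ^+ k.+1 = 1 - 2^-1 ^+ m :> R.
  by rewrite gerBl exprn_ge0.
elim: m {sm} => [|m IH]; first by rewrite big_nil expr0 subrr.
by rewrite -addn1 iotaD big_cat IH /= big_seq1 add0n addn1 exprS; lra.
Qed.

Lemma box_volume_enlarge a b (e : R) : 0 < e ->
  exists2 h, 0 < h & box_volume (a - const_mx h) (b + const_mx h) <= box_volume a b + e.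
Proof.
move=> e0; pose p : {poly R} := \prod_(i < n) ((b i 0 - a i 0)%:P + 2%:P * 'X).
have pE h : box_volume (a - const_mx h) (b + const_mx h) = p.[h].
  rewrite horner_prod; apply: eq_bigr => i _; rewrite !hornerE !mxE; lra.
have -> : box_volume a b = p.[0].
  rewrite -pE; apply: eq_bigr => i _; rewrite !mxE; lra.
have [K hK] : exists K : nat, p.[K.+1%:R^-1] < p.[0] + e.
  apply: contrapT => /forallNP h.
  have : p.[0] + e <= p.[0] by apply: le_horner0 => K; rewrite leNgt; exact/negP.
  lra.
by exists K.+1%:R^-1; rewrite ?invr_gt0// pE ltW.
Qed.

(** A content is only finitely subadditive. Enlarging the k-th box of a countable cover to an open
    one at cost e/2^(k+1) allows a finite subcover to be extracted. *)
Lemma content_le_vol S : compact S -> ((l S)%:E <= vol S)%E.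
Proof.
move=> cS; apply: le_ereal_inf_tmp => _ [D [a [b [ab cov ->]]]].
apply/lee_addgt0Pr => e e0.
have e2 k : 0 < e * 2^-1 ^+ k.+1 by rewrite mulr_gt0// exprn_gt0// invr_gt0.
have /choice[h hh] : forall k, exists h, 0 < h /\
    box_volume (a k - const_mx h) (b k + const_mx h)
      <= box_volume (a k) (b k) + e * 2^-1 ^+ k.+1.
  by move=> k; have [h h0 hv] := box_volume_enlarge (a k) (b k) (e2 k); exists h.
pose a' k := a k - const_mx (h k); pose b' k := b k + const_mx (h k).
pose O k := [set x : 'cV[R]_n | forall i, a' k i 0 < x i 0 < b' k i 0].
have a'a k i : a' k i 0 < a k i 0 by rewrite !mxE gtrBl; case: (hh k).
have b'b k i : b k i 0 < b' k i 0 by rewrite !mxE ltrDl; case: (hh k).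
move: cS; rewrite compact_cover => /(_ nat D O)[k _||D' D'D SD'].
- exact: open_strict_box.
- move=> x /cov[k Dk kx]; exists k => // i; have /andP[ax xb] := kx i.
  by rewrite (lt_le_trans (a'a k i))// (le_lt_trans xb).
have lS : l S <= \sum_(k <- D') (box_volume (a k) (b k) + e * 2^-1 ^+ k.+1).
  apply: (@le_trans _ _ (l [set x | exists2 k, k \in (D' : seq nat) & box (a' k) (b' k) x])).
    apply: (content_le Hl); last by apply: bounded_cV_bigU => k _; exact: bounded_box.
    move=> x /SD'[k /= kD' kx]; exists k => // i.
    by have /andP[/ltW -> /ltW ->] := kx i.
  apply: (le_trans (content_bigU_le Hl _)); first by move=> k _; exact: bounded_box.
  apply: ler_sum => k _; apply: le_trans (hh k).2; apply: content_box => i.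
  by rewrite (le_trans (ltW (a'a k i)))// (le_trans (ab k i))// ltW.
apply: (@le_trans _ _ (\sum_(k <- D') (box_volume (a k) (b k))%:E + e%:E)%E).
  rewrite sumEFin -EFinD lee_fin (le_trans lS)// big_split /= lerD2l.
  by rewrite -mulr_sumr ler_piMr ?(ltW e0)// sum_half_pow_le1// finmap.fset_uniq.
rewrite leeD2r//; apply: esum_ge; exists [set` D'].
  split; first exact: finite_fset.
  by move=> k /= /D'D /set_mem.
by rewrite fsbig_finite//= set_fsetK.
Qed.

Definition convex_cV S := forall x y (t : R),
  S x -> S y -> 0 <= t <= 1 -> S (t *: x + (1 - t) *: y).

Definition contains_ball S p (r : R) :=
  0 < r /\ forall y, (forall i, `|y i 0 - p i 0| <= r) -> S y.

Definition convex_body S := [/\ compact S, bounded_cV S, convex_cV S &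
  exists p r, contains_ball S p r].

(** Shrinking S by 1 - t about p leaves a margin t r: the point is the combination of p + z/t, which
    is in the ball, and x, with weights t and 1 - t. *)
Lemma convex_shrink_nbhs S p r (t : R) x (z : 'cV[R]_n) : convex_cV S -> contains_ball S p r ->
  0 < t <= 1 -> S x -> (forall i, `|z i 0| <= t * r) ->
  S (p + (1 - t) *: (x - p) + z).
Proof.
move=> cS [r0 pS] /andP[t0 t1] Sx zt.
have -> : p + (1 - t) *: (x - p) + z = t *: (p + t^-1 *: z) + (1 - t) *: x.
  apply/colP => i; rewrite !mxE; field; exact: lt0r_neq0.
apply: cS => //; last by rewrite (ltW t0).
by apply: pS => i; rewrite !mxE addrAC subrr add0r normrM gtr0_norm ?invr_gt0// ler_pdivrMl.
Qed.

Lemma bounded_shrink S p (t : R) : bounded_cV S ->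
  bounded_cV [set p + (1 - t) *: (x - p) | x in S].
Proof.
move=> [M SM].
exists (Num.truncn (`|1 - t| * M%:R + \sum_i `|t * p i 0|)).+1 => _ [x Sx <-] i.
apply: (le_trans _ (ltW (truncnS_gt _))); rewrite !mxE.
have -> : p i 0 + (1 - t) * (x i 0 - p i 0) = (1 - t) * x i 0 + t * p i 0 by lra.
rewrite (le_trans (ler_normD _ _))// lerD//.
  by rewrite normrM ler_wpM2l// SM.
by rewrite (bigD1 i)//= lerDl sumr_ge0.
Qed.

Lemma finite_cells K S : bounded_cV S ->
  finite_set [set g | exists2 y, S y & @cell R n K g y].
Proof.
move=> [M SM]; apply: sub_finite_set (finite_int_box n (K.+1 * M).+1).
move=> g [y /SM yM gy] i; have /andP[h1 h2] := gy i.
have h3 : `|K.+1%:R * y i 0| <= (K.+1 * M)%:R.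
  by rewrite normrM gtr0_norm// natrM ler_pM2l.
move: h3; rewrite ler_norml => /andP[h3 h4].
have h5 : (g i 0)%:~R <= ((K.+1 * M).+1%:Z)%:~R :> R.
  by rewrite -pmulrn -natr1; lra.
have h6 : (- (K.+1 * M).+1%:Z)%:~R <= (g i 0)%:~R :> R.
  by rewrite mulrNz -pmulrn -natr1; lra.
by move: h5 h6; rewrite !ler_int ler_norml => -> ->.
Qed.

(** Cells meeting the shrunken body lie inside S, so their number times the cell volume is at most l
    S; expanded by 1/(1-t) about p, they cover S. *)
Lemma vol_le_content S p r (t : R) : bounded_cV S -> convex_cV S -> contains_ball S p r ->
  0 < t < 1 -> (vol S <= ((1 - t) ^- n * l S)%:E)%E.
Proof.
move=> bS cS pS /andP[t0 t1]; have r0 := pS.1.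
have t10 : 0 < 1 - t by rewrite subr_gt0.
have tr0 : 0 < t * r by rewrite mulr_gt0.
(* The mesh [h] must not exceed the margin t r left by shrinking. *)
pose K := Num.truncn (t * r)^-1; pose h : R := K.+1%:R^-1.
have h0 : 0 < h by rewrite invr_gt0.
have hK : h <= t * r.
  by rewrite -[leRHS]invrK lef_pV2 ?posrE ?invr_gt0// ltW// truncnS_gt.
pose shr x : 'cV[R]_n := p + (1 - t) *: (x - p).
pose G : set 'cV[int]_n := [set g | exists2 y, (shr @` S) y & cell K g y].
have GS g : G g -> cell K g `<=` S.
  move=> [_ [x Sx <-] gx] y gy; rewrite -[y](subrK (shr x)) addrC.
  apply: (convex_shrink_nbhs cS pS) => //; first by rewrite t0 ltW.
  move=> i; apply: le_trans hK; have /andP[h1 h2] := gx i; have /andP[h3 h4] := gy i.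
  rewrite -(@ler_pM2l _ K.+1%:R)// -{1}[K.+1%:R]gtr0_norm// -normrM mulfV ?pnatr_eq0//.
  have -> : (y - shr x) i 0 = y i 0 - shr x i 0 by rewrite !mxE.
  by rewrite mulrBr ler_norml; apply/andP; split; lra.
have finG : finite_set G.
  by apply: finite_cells; exact: bounded_shrink.
have /finite_seqP[s0 Gs0] := finG.
pose s := undup s0; have us : uniq s by exact: undup_uniq.
have Gs g : (g \in s) <-> G g by rewrite mem_undup Gs0.
have sl : (size s)%:R * h ^+ n <= l S.
  apply: (@le_trans _ _ (l [set x | exists2 g, g \in s & cell K g x])).
    rewrite (content_bigU Hl)//; last first.
    - by move=> i j x; exact: cell_inj.
    - by move=> g _; exact: bounded_cell.
    under eq_bigr do rewrite (content_cell Hl).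
    by rewrite big_const_seq count_predT iter_addr_0 mulr_natl -exprVn.
  by apply: (content_le Hl) => // x [g /Gs gG]; exact: GS.
apply: ge_ereal_inf.
(* Corner of the k-th cell under the inverse of [shr]; the expanded cell has side h/(1-t). *)
pose a (k : nat) : 'cV[R]_n :=
  p + (1 - t)^-1 *: (h *: map_mx intr (nth 0 s k) - p).
pose b k := a k + const_mx ((1 - t)^-1 * h).
have bv k : box_volume (a k) (b k) = (1 - t) ^- n * h ^+ n.
  rewrite /box_volume (eq_bigr (fun=> (1 - t)^-1 * h)) => [|i _]; last first.
    by rewrite [b k i 0]mxE [const_mx _ i 0]mxE addrAC subrr add0r.
  by rewrite prodr_const card_ord exprMn exprVn.
exists (\esum_(k in `I_(size s)) (box_volume (a k) (b k))%:E).
  exists `I_(size s), a, b; split => //.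
    by move=> k i; rewrite [leRHS]mxE lerDl mxE mulr_ge0 ?invr_ge0 ?(ltW t10)// ltW.
  move=> x Sx; have [g gx] := mem_cell K (shr x).
  have gs : g \in s by apply/Gs; exists (shr x) => //; exists x.
  exists (index g s); first by rewrite /= index_mem.
  move=> i; have /andP[h1 h2] := gx i.
  rewrite /b /a !mxE nth_index//.
  have xE : x i 0 = p i 0 + (1 - t)^-1 * (shr x i 0 - p i 0).
    by rewrite /shr !mxE; field; exact: lt0r_neq0.
  have h3 : h * (g i 0)%:~R <= shr x i 0 by rewrite ler_pdivrMl.
  have h4 : shr x i 0 <= h * (g i 0)%:~R + h.
    by rewrite -[X in _ + X]mulr1 -mulrDr ler_pdivlMl// ltW.
  rewrite xE; apply/andP; split.
    by rewrite lerD2l ler_pM2l ?invr_gt0// lerD2r.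
  rewrite -addrA lerD2l -mulrDr ler_pM2l ?invr_gt0//; lra.
rewrite esum_fset//; last first.
  move=> k _; rewrite lee_fin bv mulr_ge0 ?invr_ge0 ?exprn_ge0 ?(ltW t10)//.
  exact: ltW.
under eq_fsbigr do rewrite bv.
rewrite -fsbig_ord sumEFin lee_fin sumr_const card_ord -[leLHS]mulr_natl mulrCA.
by rewrite ler_pM2l// invr_gt0 exprn_gt0.
Qed.

(** Let t tend to 0 in [vol_le_content]. In particular all contents coincide on convex bodies. *)
Lemma content_vol S : convex_body S -> vol S = (l S)%:E.
Proof.
move=> [cS bS vS [p [r pS]]]; apply/eqP; rewrite eq_le content_le_vol// andbT.
have fin : vol S \is a fin_num.
  rewrite fin_numElt; apply/andP; split.
    by apply: lt_le_trans (content_le_vol cS); rewrite ltNyr.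
  have t2 : 0 < (2^-1 : R) < 1 by apply/andP; split; lra.
  by apply: (le_lt_trans (vol_le_content bS vS pS t2)); rewrite ltry.
rewrite -(fineK fin) lee_fin; set V := fine _.
(* The bound V (1 - t)^n <= l S, rewritten as V <= q(2 t) with q(0) = l S. The factor 1/2 keeps t
   below 1 already at K = 0. *)
pose q : {poly R} := (l S)%:P + V%:P - V%:P * (1 - 2^-1 *: 'X) ^+ n.
have : V <= q.[0].
  apply: le_horner0 => K; pose t : R := 2^-1 * K.+1%:R^-1.
  have t01 : 0 < t < 1.
    have : K.+1%:R^-1 <= 1 :> R by rewrite invf_le1// ler1n.
    have : 0 < K.+1%:R^-1 :> R by rewrite invr_gt0.
    by rewrite /t; move: (K.+1%:R^-1) => u u0 u1; apply/andP; split; lra.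
  rewrite !hornerE -/t lerBrDr addrC lerD2r.
  have := vol_le_content bS vS pS t01; rewrite -(fineK fin) lee_fin -/V.
  have /andP[_ t1] := t01.
  by rewrite ler_pdivlMl ?exprn_gt0 ?subr_gt0// mulrC.
by rewrite !hornerE ?mulr0 ?subr0 ?expr1n ?mulr1 addrK.
Qed.

End ContentVolume.

(** * Continuity and boundedness of matrix maps *)

Section MatrixContinuity.
Variable R : realType.

Lemma continuous_mx (T : topologicalType) m n (f : T -> 'M[R]_(m, n)) :
  (forall i j, continuous (fun x => f x i j)) -> continuous f.
Proof.
move=> fc x; apply/cvg_ballP => e e0.
have : \forall y \near x, forall ij : 'I_m * 'I_n, ball (f x ij.1 ij.2) e (f y ij.1 ij.2).
  apply: filter_forall => ij; have /cvg_ballP := fc ij.1 ij.2 x; exact.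
apply: filterS => y h; split => // i j; exact: (h (i, j)).
Qed.

Lemma continuous_sum (T : topologicalType) (I : Type) (r : seq I) (f : I -> T -> R) :
  (forall i, continuous (f i)) -> continuous (fun x => \sum_(i <- r) f i x).
Proof.
move=> fc x; elim: r => [|i r IH].
  by under eq_fun do rewrite big_nil; exact: cvg_cst.
by under eq_fun do rewrite big_cons; apply: continuousD => //; exact: fc.
Qed.

Lemma continuous_mulmx m n p (A : 'M[R]_(m, n)) :
  continuous (fun x : 'M[R]_(n, p) => A *m x).
Proof.
apply: continuous_mx => i j; under eq_fun do rewrite mxE.
apply: continuous_sum => k x.
apply: (@continuousM _ _ (fun=> A i k) (fun y : 'M[R]_(n, p) => y k j)).
  exact: cst_continuous.
exact: coord_continuous.
Qed.

Lemma continuous_trmx m n : continuous (@trmx R m n).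
Proof.
apply: continuous_mx => i j; under eq_fun do rewrite mxE.
by move=> x; exact: coord_continuous.
Qed.

Lemma compact_box n (a b : 'cV[R]_n) : compact (box a b).
Proof.
have -> : box a b = trmx @` [set v : 'rV[R]_n | forall i, `[a i 0, b i 0]%classic (v ord0 i)].
  apply/seteqP; split => [x h|_ [v h <-] i]; last by have := h i; rewrite /= in_itv mxE.
  by exists x^T; rewrite ?trmxK// => i /=; rewrite in_itv/= mxE h.
apply: continuous_compact; last first.
  by apply: (@rV_compact R n (fun i => `[a i 0, b i 0]%classic)) => i; exact: segment_compact.
by apply: continuous_subspaceT => x; exact: continuous_trmx.
Qed.

Lemma compact_mulmx m n (A : 'M[R]_(m, n)) (S : set 'cV[R]_n) :
  compact S -> compact [set A *m x | x in S].
Proof.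
move=> cS; apply: continuous_compact => //.
by apply: continuous_subspaceT => x; exact: continuous_mulmx.
Qed.

Lemma mulmx_bound m n (A : 'M[R]_(m, n)) (c : R) (x : 'cV[R]_n) i :
  (forall j, `|x j 0| <= c) -> 0 <= c ->
  `|(A *m x) i 0| <= (\sum_i \sum_j `|A i j|) * c.
Proof.
move=> xc c0; rewrite mxE (le_trans (ler_norm_sum _ _ _))//.
rewrite (bigD1 i)//= mulrDl mulr_suml -[leLHS]addr0 lerD//.
  by apply: ler_sum => j _; rewrite normrM ler_wpM2l.
by rewrite mulr_ge0// sumr_ge0// => k _; rewrite sumr_ge0.
Qed.

Lemma bounded_mulmx m n (A : 'M[R]_(m, n)) (S : set 'cV[R]_n) :
  bounded_cV S -> bounded_cV [set A *m x | x in S].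
Proof.
move=> [M SM]; exists (Num.truncn ((\sum_i \sum_j `|A i j|) * M%:R)).+1.
move=> _ [x /SM xM <-] i; apply: (le_trans _ (ltW (truncnS_gt _))).
exact: mulmx_bound.
Qed.

End MatrixContinuity.

(** * Full-dimensional polytopes are convex bodies *)

Section ConvexHull.
Variables (R : realType) (d n : nat) (V : 'M[R]_(d, n)).

Let simplex : set 'cV[R]_n := [set w | (forall i, 0 <= w i 0) /\ \sum_i w i 0 = 1].

Let conv_hullE : conv_hull V = [set V *m w | w in simplex].
Proof.
apply/seteqP; split => [x [w [w0 w1 ->]]|_ [w [w0 w1] <-]]; first by exists w.
by exists w.
Qed.

Let simplex_box w : simplex w -> box 0 (const_mx 1) w.
Proof.
move=> [w0 w1] i; rewrite !mxE w0 /= -w1 (bigD1 i)//= lerDl.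
exact: sumr_ge0.
Qed.

Lemma compact_conv_hull : compact (conv_hull V).
Proof.
rewrite conv_hullE; apply: compact_mulmx.
have -> : simplex = [set w : 'cV[R]_n | \sum_i w i 0 = 1] `&` box 0 (const_mx 1).
  apply/seteqP; split => [w sw|w [w1 w01]].
    by split; [case: sw|exact: simplex_box].
  by split => // i; have := w01 i; rewrite mxE => /andP[].
rewrite setIC; apply: compact_closedI; first exact: compact_box.
apply: (@closed_comp _ _ (fun w : 'cV[R]_n => \sum_i w i 0) [set 1]).
  by move=> w _; apply: continuous_sum => i; exact: coord_continuous.
exact: closed_eq.
Qed.

Lemma bounded_conv_hull : bounded_cV (conv_hull V).
Proof.
rewrite conv_hullE; apply: bounded_mulmx.
by apply: bounded_cV_sub (bounded_box _ _) => w; exact: simplex_box.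
Qed.

Lemma convex_conv_hull : convex_cV (conv_hull V).
Proof.
move=> _ _ t [w [w0 w1 ->]] [u [u0 u1 ->]] /andP[t0 t1].
exists (t *: w + (1 - t) *: u); split.
- by move=> i; rewrite !mxE addr_ge0// mulr_ge0// subr_ge0.
- under eq_bigr do rewrite !mxE.
  by rewrite big_split /= -!mulr_sumr w1 u1; lra.
- by rewrite mulmxDr -!scalemxAr.
Qed.

(* A ball around the centroid of the points. *)
Lemma conv_hull_ball : affine_hull V = setT -> exists p r, contains_ball (conv_hull V) p r.
Proof.
move=> aT.
have aff y : affine_hull V y by rewrite aT.
have [w0 [w01 w0E]] := aff 0.
have n0 : (0 < n)%N.
  by rewrite lt0n; apply: contra_eq_neq w01 => n0; subst n; rewrite big_ord0 eq_sym oner_eq0.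
have /choice[W WE] : forall k : 'I_d, exists w : 'cV[R]_n,
    \sum_i w i 0 = 1 /\ delta_mx k 0 = V *m w by move=> k; exact: aff.
pose C := 1 + \sum_k \sum_i `|W k i 0 - w0 i 0|.
have C0 : 0 < C by rewrite ltr_pwDl// sumr_ge0// => k _; rewrite sumr_ge0.
have nR : 0 < n%:R :> R by rewrite ltr0n.
exists (V *m const_mx n%:R^-1), (n%:R^-1 / C); split; first by rewrite divr_gt0 ?invr_gt0.
move=> y yr; set p := V *m _ in yr.
pose z := y - p.
(* [W k - w0] has weight sum 0 and is mapped by V to the k-th basis vector, so the correction moves
   the centroid by z; [C] keeps its entries within 1/n. *)
exists (const_mx n%:R^-1 + \sum_k z k 0 *: (W k - w0)); split.
- move=> i; rewrite mxE summxE [const_mx _ _ _]mxE.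
  rewrite -[X in _ + X]opprK subr_ge0 -sumrN.
  apply: (@le_trans _ _ (\sum_k n%:R^-1 / C * `|W k i 0 - w0 i 0|)).
    apply: ler_sum => k _.
    have -> : (z k 0 *: (W k - w0)) i 0 = (y k 0 - p k 0) * (W k i 0 - w0 i 0).
      by rewrite !mxE.
    by rewrite (le_trans (ler_norm _))// normrN normrM ler_wpM2r.
  rewrite -mulr_sumr -mulrA ler_piMr ?invr_ge0// ler_pdivrMl// mulr1.
  rewrite /C -[leLHS]add0r lerD// ler_sum// => k _.
  by rewrite (bigD1 i)//= lerDl sumr_ge0.
- under eq_bigr do rewrite mxE summxE.
  rewrite big_split /= exchange_big /= [X in _ + X]big1 => [|k _].
    under eq_bigr do rewrite mxE.
    by rewrite sumr_const card_ord -[_ *+ _]mulr_natl mulfV ?gt_eqF// addr0.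
  under eq_bigr do rewrite !mxE.
  by rewrite -mulr_sumr sumrB (WE k).1 w01 subrr mulr0.
- rewrite mulmxDr -/p mulmx_sumr.
  have -> : \sum_k V *m (z k 0 *: (W k - w0)) = z.
    apply/colP => i; rewrite summxE (bigD1 i)//= big1 => [|k ki].
      by rewrite -scalemxAr mulmxBr -w0E subr0 -(WE i).2 !mxE !eqxx mulr1 addr0.
    by rewrite -scalemxAr mulmxBr -w0E subr0 -(WE k).2 !mxE eq_sym (negPf ki) mulr0.
  by rewrite addrC subrK.
Qed.

Lemma convex_body_conv_hull : affine_hull V = setT -> convex_body (conv_hull V).
Proof.
move=> aT; split; [exact: compact_conv_hull|exact: bounded_conv_hull| |exact: conv_hull_ball].
exact: convex_conv_hull.
Qed.

End ConvexHull.

(** * Linear change of variables and the determinant *)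

Section Determinant.
Variables (R : realType) (n : nat) (L : ('cV[R]_n -> R) -> R).
Hypothesis HL : is_integral L.
Implicit Types (A B : 'M[R]_n) (S : set 'cV[R]_n).

(** Written as a preimage, so that disjointness and translation pass through directly; it is the
    image only when A is invertible. *)
Definition linear_image A S : set 'cV[R]_n := [set x | S (invmx A *m x)].

Lemma linear_imageE A S : A \in unitmx -> linear_image A S = [set A *m x | x in S].
Proof.
move=> uA; apply/seteqP; split => [x Sx|_ [x Sx <-]].
  by exists (invmx A *m x) => //; rewrite mulKVmx.
by rewrite /linear_image /= mulKmx.
Qed.

Lemma bounded_linear_image A S : A \in unitmx -> bounded_cV S ->
  bounded_cV (linear_image A S).
Proof. by move=> uA bS; rewrite linear_imageE//; exact: bounded_mulmx. Qed.

Lemma convex_body_linear_image A S : A \in unitmx -> convex_body S ->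
  convex_body (linear_image A S).
Proof.
move=> uA [cS bS vS [p [r [r0 pr]]]]; split.
- by rewrite linear_imageE//; exact: compact_mulmx.
- exact: bounded_linear_image.
- move=> x y t Sx Sy t01; rewrite /linear_image /= mulmxDr -!scalemxAr.
  exact: vS.
- set C := \sum_i \sum_j `|invmx A i j|.
  have C0 : 0 <= C by rewrite sumr_ge0// => i _; rewrite sumr_ge0.
  exists (A *m p), (r / (1 + C)); split; first by rewrite divr_gt0// ltr_pwDl.
  move=> y yr; apply: pr => i.
  have -> : (invmx A *m y) i 0 - p i 0 = (invmx A *m (y - A *m p)) i 0.
    by rewrite mulmxBr mulKmx// !mxE.
  rewrite (le_trans (@mulmx_bound _ _ _ _ (r / (1 + C)) _ _ _ _)) -/C.
  + by [].
  + by move=> j; have := yr j; rewrite !mxE.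
  + by rewrite divr_ge0 ?(ltW r0)// addr_ge0.
  + by rewrite mulrCA ler_piMr ?(ltW r0)// ler_pdivrMr ?mul1r ?lerDr ?ltr_pwDl.
Qed.

Let closed_cube : set 'cV[R]_n := box 0 (const_mx 1).

Let unit_closed_cube : @unit_cube R n `<=` closed_cube.
Proof. by move=> x h i; have /andP[h1 h2] := h i; rewrite !mxE h1 ltW. Qed.

Let convex_body_cube : convex_body closed_cube.
Proof.
split; [exact: compact_box|exact: bounded_box| |].
- move=> x y t hx hy /andP[t0 t1] i.
  have := hx i; have := hy i; rewrite !mxE => /andP[y0 y1] /andP[x0 x1].
  have h : 0 <= 1 - t by rewrite subr_ge0.
  rewrite addr_ge0 ?mulr_ge0//=.
  nra.
- exists (const_mx 2^-1), 2^-1; split; first by rewrite invr_gt0.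
  move=> y h i; have := h i; rewrite !mxE ler_norml => /andP[h1 h2].
  by apply/andP; split; lra.
Qed.

Definition dilation A := L \1_(linear_image A (@unit_cube R n)).

Let bounded_linear_cube A : A \in unitmx -> bounded_cV (linear_image A (@unit_cube R n)).
Proof. by move=> uA; apply: bounded_linear_image => //; exact: bounded_unit_cube. Qed.

(* Finitely many translates of A [0,1)^n cover [0,1)^n. *)
Lemma dilation_gt0 A : A \in unitmx -> 0 < dilation A.
Proof.
move=> uA.
have Hl := integral_content HL; have [l0 _ l1 lT] := Hl.
rewrite lt_neqAle l0 ?andbT; last exact: bounded_linear_cube.
apply/eqP => c0.
have fG := @finite_cells R n 0 _ (bounded_linear_image
  (_ : invmx A \in unitmx) (@bounded_unit_cube R n)).
rewrite unitmx_inv in fG; have /finite_seqP[s Gs] := fG uA.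
pose F g := [set x : 'cV[R]_n | linear_image A (@unit_cube R n) (x - A *m map_mx intr g)].
have bF g : bounded_cV (F g) by apply/bounded_cV_shift/bounded_linear_cube.
suff : 1 <= \sum_(g <- s) L \1_(F g).
  rewrite big1 => [|g _]; first lra.
  by rewrite c0; apply: lT; exact: bounded_linear_cube.
rewrite -[leLHS]l1.
apply: le_trans (content_bigU_le Hl (fun g _ => bF g)).
apply: (content_le Hl); last by apply: bounded_cV_bigU => g _.
move=> x x01; have [g gx] := mem_cell 0 (invmx A *m x).
have gG : g \in s.
  suff : [set` s] g by [].
  rewrite -Gs; exists (invmx A *m x) => //.
  by rewrite /linear_image /= invmxK mulKVmx.
exists g => // i; have := gx i; rewrite mul1r mulmxBr mulKmx// !mxE => /andP[h1 h2].
by apply/andP; split; lra.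
Qed.

Lemma content_linear_image A : A \in unitmx ->
  is_content (fun S => L \1_(linear_image A S) / dilation A).
Proof.
move=> uA; have c0 := dilation_gt0 uA.
have [l0 lU l1 lT] := integral_content HL; split.
- by move=> S bS; rewrite divr_ge0 ?(ltW c0)//; apply/l0/bounded_linear_image.
- move=> S T bS bT ST; rewrite -mulrDl; congr (_ / _); apply: lU.
  + exact: bounded_linear_image.
  + exact: bounded_linear_image.
  + apply/seteqP; split => // x [/= Sx Tx].
    by rewrite -[False]/(set0 (invmx A *m x)) -ST.
- by rewrite mulfV// gt_eqF.
- move=> S v bS; congr (_ / _).
  rewrite -[RHS](lT _ (A *m v)); last exact: bounded_linear_image.
  congr (L \1_ _); apply/seteqP; split => x;
    by rewrite /linear_image /= mulmxDr mulKmx.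
Qed.

(** The pullback of L by A, divided by its value on the unit cube, is again a content, hence equals
    L on convex bodies. *)
Lemma integral_linear_image_dilation A S : A \in unitmx -> convex_body S ->
  L \1_(linear_image A S) = dilation A * L \1_S.
Proof.
move=> uA bS.
have := content_vol (content_linear_image uA) bS.
rewrite (content_vol (integral_content HL) bS) => -[->].
by rewrite mulrC divfK// gt_eqF// dilation_gt0.
Qed.

Let integral_closed_cube : L \1_closed_cube = 1.
Proof.
have Hl := integral_content HL; have [l0 _ l1 lT] := Hl.
apply/eqP; rewrite eq_le; apply/andP; split.
  apply: (le_trans (content_box Hl _)) => [i|]; first by rewrite !mxE.
  by rewrite /box_volume big1// => i _; rewrite !mxE subr0.
by rewrite -[leLHS]l1; apply: (content_le Hl) => //; exact: bounded_box.
Qed.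

(** A content is normalized on the half-open cube, but the uniqueness result asks for compact sets;
    the closed cube connects the two and yields multiplicativity. *)
Let dilationE A : A \in unitmx -> dilation A = L \1_(linear_image A closed_cube).
Proof. by move=> uA; rewrite integral_linear_image_dilation// integral_closed_cube mulr1. Qed.

Lemma linear_imageM A B S : A \in unitmx -> B \in unitmx ->
  linear_image (A *m B) S = linear_image A (linear_image B S).
Proof.
move=> uA uB; have uAB : A *m B \in unitmx by rewrite unitmx_mul uA.
have E x : invmx (A *m B) *m x = invmx B *m (invmx A *m x) :> 'cV[R]_n.
  apply: (can_inj (mulKmx uAB)); rewrite mulKVmx// -mulmxA !mulKVmx//.
by apply/seteqP; split => x; rewrite /linear_image /= E.
Qed.

Lemma dilationM A B : A \in unitmx -> B \in unitmx ->
  dilation (A *m B) = dilation A * dilation B.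
Proof.
move=> uA uB; have uAB : A *m B \in unitmx by rewrite unitmx_mul uA.
rewrite !dilationE// linear_imageM// integral_linear_image_dilation ?dilationE//.
exact: convex_body_linear_image.
Qed.

Lemma dilation1 : dilation 1%:M = 1.
Proof.
have [_ _ l1 _] := integral_content HL; rewrite -[RHS]l1.
congr (L \1_ _); apply/seteqP; split => x; by rewrite /linear_image /= invmx1 mul1mx.
Qed.

(* A [0,1]^n lies in a box with sides \sum_j |A i j|. *)
Lemma dilation_le_row_sums A : A \in unitmx -> dilation A <= \prod_i \sum_j `|A i j|.
Proof.
move=> uA; have Hl := integral_content HL.
pose a : 'cV[R]_n := \col_i \sum_j Num.min (A i j) 0.
pose b : 'cV[R]_n := \col_i \sum_j Num.max (A i j) 0.
have ab i : b i 0 - a i 0 = \sum_j `|A i j|.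
  rewrite !mxE -sumrB; apply: eq_bigr => j _.
  case: (leP (A i j) 0) => h; first by rewrite sub0r ler0_norm.
  by rewrite subr0 gtr0_norm.
rewrite dilationE//.
apply: (@le_trans _ _ (L \1_(box a b))).
  apply: (content_le Hl); last exact: bounded_box.
  rewrite linear_imageE// => _ [x h <-] i; rewrite !mxE; apply/andP.
  by split; apply: ler_sum => j _; have := h j; rewrite !mxE => /andP[x0 x1];
    case: (leP (A i j) 0) => Aij; nra.
apply: (le_trans (content_box Hl _)) => [i|]; last first.
  by rewrite /box_volume (eq_bigr _ (fun i _ => ab i)).
by rewrite -subr_ge0 ab sumr_ge0.
Qed.

(* Conjugating by diag(t ^ w i) kills the off-diagonal entries as t -> 0. *)
Lemma dilation_triangular A (w : 'I_n -> nat) : A \in unitmx ->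
  (forall i j, i != j -> (w i <= w j)%N -> A i j = 0) ->
  dilation A <= \prod_i `|A i i|.
Proof.
move=> uA Aw.
(* [p] at t is the product of the absolute row sums of the conjugate, whose (i, j) entry is t^(w i -
   w j) A i j; off the diagonal only positive exponents survive. *)
pose p : {poly R} := \prod_i (`|A i i|%:P +
  \sum_(j | (w j < w i)%N) `|A i j|%:P * 'X ^+ (w i - w j)).
have -> : \prod_i `|A i i| = p.[0].
  rewrite horner_prod; apply: eq_bigr => i _; rewrite !hornerE horner_sum big1 ?addr0//.
  by move=> j ij; rewrite !hornerE expr0n subn_eq0 leqNgt ij mulr0.
apply: le_horner0 => K; set t := K.+1%:R^-1.
have t0 : 0 < t :> R by rewrite invr_gt0.
pose D := diag_mx (\row_i t ^+ w i).
pose B := \matrix_(i, j) (t ^+ w i * A i j / t ^+ w j).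
have uD : D \in unitmx.
  rewrite unitmxE det_diag unitfE; apply/prodf_neq0 => i _; rewrite mxE.
  by rewrite expf_neq0// gt_eqF.
have DA : D *m A = B *m D.
  rewrite mul_diag_mx mul_mx_diag; apply/matrixP => i j; rewrite !mxE divfK//.
  by rewrite expf_neq0// gt_eqF.
have uB : B \in unitmx.
  have : D *m A \in unitmx by rewrite unitmx_mul uD.
  by rewrite DA unitmx_mul => /andP[].
have -> : dilation A = dilation B.
  apply: (mulfI (lt0r_neq0 (dilation_gt0 uD))).
  by rewrite -dilationM// DA dilationM// mulrC.
rewrite (le_trans (dilation_le_row_sums uB))// horner_prod ler_prod// => i _.
rewrite sumr_ge0//= (bigD1 i)//= !hornerE mxE mulrAC mulfV ?mul1r; last first.
  by rewrite expf_neq0// gt_eqF.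
rewrite lerD2l horner_sum [leLHS]big_mkcond [leRHS]big_mkcond; apply: ler_sum => j _.
case: ifPn => ji; case: ifPn => wji //.
- rewrite mxE !hornerE !normrM (mulrC `|t ^+ w i|) -mulrA ler_wpM2l//.
  rewrite normfV !ger0_norm ?exprn_ge0 ?(ltW t0)//.
  by rewrite ler_pdivrMr ?exprn_gt0// -exprD subnK// ltnW.
- have Aij : A i j = 0 by apply: Aw; [rewrite eq_sym|rewrite leqNgt].
  by rewrite mxE Aij mulr0 mul0r normr0.
- by rewrite !hornerE mulr_ge0// exprn_ge0// ltW.
Qed.

Lemma dilation_perm s : dilation (perm_mx s) <= 1.
Proof.
rewrite (le_trans (dilation_le_row_sums (unitmx_perm _ _)))//.
rewrite big1// => i _; rewrite (bigD1 (s i))//= big1 => [|j ji].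
  by rewrite !mxE eqxx normr1 addr0.
by rewrite !mxE eq_sym (negPf ji) normr0.
Qed.

End Determinant.

(** By the LUP factorization and multiplicativity: the permutation and the unit lower triangular
    factor contribute at most 1, the upper triangular one at most its diagonal product. Dimension 0
    is treated apart since the factorization is stated for positive size. *)
Lemma dilation_le_det (R : realType) n (L : ('cV[R]_n -> R) -> R) (A : 'M[R]_n) :
  is_integral L -> A \in unitmx -> dilation L A <= `|\det A|.
Proof.
case: n => [|n] in L A * => HL uA.
  rewrite det_mx00 normr1 (le_trans (dilation_le_row_sums HL uA))//.
  by rewrite big_ord0.
have := cormen_lup_correct A; have := cormen_lup_perm A.
have := cormen_lup_detL A; have := cormen_lup_lower A; have := cormen_lup_upper A.
case: (cormen_lup A) => [[P Lo] U] /= Up Low detLo /is_perm_mxP[s ->] PA.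
have {}PA : perm_mx s *m A = Lo *m U by exact: PA.
have uLo : Lo \in unitmx by rewrite unitmxE detLo unitr1.
have uU : U \in unitmx.
  have : perm_mx s *m A \in unitmx by rewrite unitmx_mul unitmx_perm.
  by rewrite PA unitmx_mul => /andP[].
have detU : \det U = \prod_i U i i.
  rewrite -det_tr det_trig; first by apply: eq_bigr => i _; rewrite mxE.
  by apply/is_trig_mxP => i j ij; rewrite mxE Up.
have dLo : dilation L Lo <= 1.
  apply: (le_trans (dilation_triangular HL (w := fun i : 'I_n.+1 => i : nat) uLo _)).
    move=> i j ij leij; rewrite Low// (negPf ij)//.
  by rewrite big1// => i _; rewrite Low// eqxx normr1.
have dU : dilation L U <= `|\det U|.
  rewrite detU normr_prod.
  apply: (dilation_triangular HL (w := fun i : 'I_n.+1 => (n - i)%N) uU) => i j ij leij.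
  apply: Up; rewrite ltn_neqAle eq_sym ij /=.
  by have := ltn_ord i; have := ltn_ord j; lia.
have -> : A = perm_mx s^-1 *m (Lo *m U).
  by rewrite -PA mulmxA -perm_mxM mulVg perm_mx1 mul1mx.
have uLU : Lo *m U \in unitmx by rewrite unitmx_mul uLo.
have pos B : B \in unitmx -> 0 <= dilation L B by move=> /(dilation_gt0 HL)/ltW.
rewrite !(dilationM HL)// ?unitmx_perm// !det_mulmx detLo mul1r det_perm normrM.
rewrite normrX normrN1 expr1n mul1r -[leRHS]mul1r.
rewrite ler_pM ?mulr_ge0 ?pos ?unitmx_perm//; first exact: dilation_perm.
by rewrite -[leRHS]mul1r ler_pM ?pos.
Qed.

(** The upper bound for A and for its inverse, together with multiplicativity, forces equality. *)
Lemma dilation_det (R : realType) n (L : ('cV[R]_n -> R) -> R) (A : 'M[R]_n) :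
  is_integral L -> A \in unitmx -> dilation L A = `|\det A|.
Proof.
move=> HL uA; apply/eqP; rewrite eq_le dilation_le_det//=.
have uV : invmx A \in unitmx by rewrite unitmx_inv.
have := dilation_le_det HL uV; rewrite det_inv normfV => h.
have : dilation L A * dilation L (invmx A) = 1.
  by rewrite -(dilationM HL)// mulmxV// (dilation1 HL).
have c0 := dilation_gt0 HL uA.
have d0 : 0 < `|\det A| by rewrite normr_gt0 -unitfE -unitmxE.
move=> E; rewrite -(ler_pM2r (dilation_gt0 HL uV)) E.
by rewrite -(mulfV (lt0r_neq0 d0)) ler_pM2l.
Qed.

Lemma integral_linear_image (R : realType) n (L : ('cV[R]_n -> R) -> R)
    (A : 'M[R]_n) (S : set 'cV[R]_n) :
  is_integral L -> A \in unitmx -> convex_body S ->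
  L \1_(linear_image A S) = `|\det A| * L \1_S.
Proof. by move=> HL uA bS; rewrite integral_linear_image_dilation// dilation_det. Qed.

(** * Negligible sets *)

Section Negligible.
Variables (R : realType) (n : nat) (L : ('cV[R]_n -> R) -> R).
Hypothesis HL : is_integral L.
Implicit Types (f g h : 'cV[R]_n -> R) (x u v : 'cV[R]_n) (Z : set 'cV[R]_n).

(** Tested on functions of bounded support because Z, for instance a hyperplane, may be
    unbounded. *)
Definition negligible Z :=
  forall f, bounded_support f -> (forall x, ~ Z x -> f x = 0) -> L f = 0.

Lemma negligible_sub Z Z' : Z `<=` Z' -> negligible Z' -> negligible Z.
Proof. by move=> ZZ nZ f bf fZ; apply: nZ => // x nx; apply: fZ => /ZZ. Qed.

Lemma negligible0 : negligible set0.
Proof.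
move=> f bf f0; rewrite -(integral0 HL); congr L.
by apply/funext => x; apply: f0.
Qed.

Lemma negligibleU Z Z' : negligible Z -> negligible Z' -> negligible (Z `|` Z').
Proof.
move=> nZ nZ' f bf fZ.
have le1 (A : set 'cV[R]_n) x : `|\1_A x * f x| <= `|f x|.
  by rewrite normrM ler_piMl// indicE ger0_norm// lern1 leq_b1.
have bA A : bounded_support (fun x => \1_A x * f x) by exact: bounded_support_le (le1 A) bf.
have -> : L f = L (fun x => \1_Z x * f x) + L (fun x => \1_(~` Z) x * f x).
  rewrite -(integralD HL)//; congr L; apply/funext => x.
  rewrite -mulrDl !indicE in_setC.
  by case: (x \in Z); rewrite /= ?addr0 ?add0r mul1r.
rewrite nZ ?nZ' ?addr0// => x nx; rewrite indicE.
  case: (boolP (x \in _)) => [/set_mem nZx|]; last by rewrite mul0r.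
  by rewrite fZ ?mulr0// => -[].
by rewrite memNset// mul0r.
Qed.

Lemma negligible_bigU (I : eqType) (s : seq I) (F : I -> set 'cV[R]_n) :
  (forall i, i \in s -> negligible (F i)) ->
  negligible [set x | exists2 i, i \in s & F i x].
Proof.
elim: s => [|j s IH] h; first by apply: negligible_sub negligible0 => x [].
apply: (@negligible_sub _ (F j `|` [set x | exists2 i, i \in s & F i x])).
  move=> x [i]; rewrite inE => /orP[/eqP ->|is_ Fi]; first by left.
  by right; exists i.
apply: negligibleU; first by apply: h; rewrite mem_head.
by apply: IH => i is_; apply: h; rewrite inE is_ orbT.
Qed.

Lemma negligible_shift Z v : negligible Z -> negligible [set x | Z (x + v)].
Proof.
move=> nZ f bf fZ; rewrite -(integral_shift HL (- v))//; apply: nZ.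
  exact: bounded_support_shift.
by move=> x nx; apply: fZ; rewrite /= subrK.
Qed.

(* Disjoint translates of Z along u all fit in one bounded set. *)
Lemma negligible_transversal Z u :
  (forall x (t : R), 0 < t -> Z x -> ~ Z (x + t *: u)) -> negligible Z.
Proof.
move=> Zu f /bounded_supportP[[C fC] bA] fZ; set A := [set x | f x != 0] in bA.
have Hl := integral_content HL; have [l0 _ _ lT] := Hl.
have AZ x : A x -> Z x by move=> fx; apply: contrapT => /fZ; apply/eqP.
suff A0 : L \1_A = 0.
  apply/eqP; rewrite -normr_le0 -(mulr0 C) -A0 -(integralZ HL); last exact: bounded_support_indic.
  apply: (le_abs_integral HL); first exact/bounded_supportZ/bounded_support_indic.
  move=> x; rewrite indicE; case: (boolP (x \in A)) => [_|]; first by rewrite mulr1.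
  by move/negP => nA; rewrite mulr0 normr_le0; apply: contra_notT nA => fx; exact: mem_set.
pose W := [set x | exists2 t : R, 0 <= t <= 1 & A (x - t *: u)].
have bW : bounded_cV W.
  case: bA => M AM; exists (M + Num.truncn (\sum_i `|u i 0|)).+1 => x [t /andP[t0 t1] /AM h] i.
  have := h i; rewrite !mxE -natr1 natrD => hi.
  have us : `|u i 0| <= \sum_i `|u i 0| by rewrite (bigD1 i)//= lerDl sumr_ge0.
  have := truncnS_gt (\sum_i `|u i 0|); rewrite -natr1 => ht.
  have tu : `|t * u i 0| <= `|u i 0| by rewrite normrM ger0_norm// ler_piMl.
  rewrite -[x i 0](subrK (t * u i 0)) (le_trans (ler_normD _ _))//; lra.
have key N : N.+1%:R * L \1_A <= L \1_W.
  pose F (k : nat) := [set x | A (x + - ((k%:R / N.+1%:R) *: u))].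
  have bF k : bounded_cV (F k) by exact: bounded_cV_shift.
  apply: (@le_trans _ _ (L \1_[set x | exists2 k, k \in iota 0 N.+1 & F k x])).
    rewrite (content_bigU Hl (iota_uniq _ _)) => [|//|].
      under eq_bigr do rewrite lT//.
      by rewrite big_const_seq count_predT size_iota iter_addr_0 mulr_natl.
    move=> i j x; wlog ij : i j / (i < j)%N.
      by move=> H Fi Fj; case: (ltngtP i j) => // h; [exact: H|symmetry; exact: H].
    move=> /AZ Fi /AZ Fj; exfalso.
    have t0 : 0 < (j%:R - i%:R) / N.+1%:R :> R by rewrite divr_gt0// subr_gt0 ltr_nat.
    apply: (Zu _ _ t0 Fj); suff -> : x - (j%:R / N.+1%:R) *: u + ((j%:R - i%:R) / N.+1%:R) *: u =
      x - (i%:R / N.+1%:R) *: u by [].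
    by apply/colP => k; rewrite !mxE mulrBl mulrBl; ring.
  apply: (content_le Hl) => // x [k]; rewrite mem_iota add0n => /andP[_ kN] Fk.
  exists (k%:R / N.+1%:R) => //; rewrite divr_ge0//= ler_pdivrMr// mul1r ler_nat ltnW//.
apply/eqP; rewrite eq_le l0// andbT leNgt; apply/negP => A0.
have := key (Num.truncn (L \1_W / L \1_A)).
by rewrite -ler_pdivlMr// leNgt truncnS_gt.
Qed.

Lemma integral_ae f g Z : bounded_support f -> bounded_support g -> negligible Z ->
  (forall x, ~ Z x -> f x = g x) -> L f = L g.
Proof.
move=> bf bg nZ fg; apply/eqP; rewrite -subr_eq0 -(integralB HL)//; apply/eqP.
by apply: nZ => [|x /fg ->]; [exact: bounded_supportB|rewrite subrr].
Qed.

End Negligible.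

(** * Exponential integrals of unbounded functions *)

Section Differences.
Variables (R : realType) (n : nat).
Implicit Types (f g h : 'cV[R]_n -> R) (x y u v : 'cV[R]_n) (vs ws : seq 'cV[R]_n) (xi : 'rV[R]_n).

Definition diff v f x : R := f x - f (x - v).

Definition diffs vs f := foldr diff f vs.

Lemma diff_comm v u f : diff v (diff u f) = diff u (diff v f).
Proof. by apply/funext => x; rewrite /diff (addrAC x (- u) (- v)); ring. Qed.

Lemma diffs_cat vs ws f : diffs (vs ++ ws) f = diffs vs (diffs ws f).
Proof. by rewrite /diffs foldr_cat. Qed.

Lemma diffs_diff vs v f : diffs vs (diff v f) = diff v (diffs vs f).
Proof. by elim: vs => //= u vs IH; rewrite IH diff_comm. Qed.

Lemma diffs_comm vs ws f : diffs vs (diffs ws f) = diffs ws (diffs vs f).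
Proof. by elim: ws => //= u ws IH; rewrite diffs_diff IH. Qed.

Lemma diffs_linear vs a f g :
  diffs vs (fun x => a * f x + g x) = (fun x => a * diffs vs f x + diffs vs g x).
Proof. by elim: vs => //= v vs ->; apply/funext => x; rewrite /diff; ring. Qed.

Lemma bounded_support_diff v f : bounded_support f -> bounded_support (diff v f).
Proof. by move=> bf; apply: bounded_supportB => //; exact: bounded_support_shift. Qed.

Lemma bounded_support_diffs vs f : bounded_support f -> bounded_support (diffs vs f).
Proof. by move=> bf; elim: vs => //= v vs IH; exact: bounded_support_diff. Qed.

Definition chi (xi : 'rV[R]_n) x : R := expR (- (xi *m x) 0 0).

Lemma chi_gt0 xi x : 0 < chi xi x. Proof. exact: expR_gt0. Qed.

Lemma chiD xi x y : chi xi (x + y) = chi xi x * chi xi y.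
Proof. by rewrite /chi mulmxDr mxE opprD expRD. Qed.

Lemma chi_bound (xi : 'rV[R]_n) (M : R) x : (forall i, `|x i 0| <= M) ->
  `|(xi *m x) 0 0| <= (\sum_i `|xi 0 i|) * M.
Proof.
move=> xM; rewrite mxE (le_trans (ler_norm_sum _ _ _))// mulr_suml.
by apply: ler_sum => i _; rewrite normrM ler_wpM2l.
Qed.

Lemma bounded_support_chi xi f : bounded_support f ->
  bounded_support (fun x => chi xi x * f x).
Proof.
apply: bounded_supportM => M; exists (expR ((\sum_i `|xi 0 i|) * M%:R)) => x xM.
rewrite ger0_norm ?expR_ge0// ler_expR (le_trans (ler_norm _))// normrN.
exact: chi_bound.
Qed.

End Differences.

Section ExponentialIntegral.
Variables (R : realType) (n : nat) (L : ('cV[R]_n -> R) -> R).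
Hypothesis HL : is_integral L.
Variable xi : 'rV[R]_n.
Implicit Types (f g h : 'cV[R]_n -> R) (x u v : 'cV[R]_n) (vs ws : seq 'cV[R]_n).

Let E := chi xi.

Lemma integral_chi_shift v f : bounded_support f ->
  L (fun x => E x * f (x - v)) = E v * L (fun x => E x * f x).
Proof.
move=> bf; rewrite -(integralZ HL); last exact: bounded_support_chi.
rewrite -[RHS](integral_shift HL (- v)); last exact/bounded_supportZ/bounded_support_chi.
by congr L; apply/funext => x; rewrite mulrA -chiD [v + _]addrC subrK.
Qed.

Lemma integral_chi_diffs vs f : bounded_support f ->
  L (fun x => E x * diffs vs f x) = (\prod_(v <- vs) (1 - E v)) * L (fun x => E x * f x).
Proof.
move=> bf; elim: vs => [|v vs IH]; first by rewrite big_nil mul1r.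
have bvs := bounded_support_diffs vs bf.
rewrite big_cons -mulrA -IH /= mulrBl mul1r -(integral_chi_shift v bvs) -(integralB HL).
- by congr L; apply/funext => x; rewrite -mulrBr.
- exact: bounded_support_chi.
- exact/bounded_support_chi/bounded_support_shift.
Qed.

Lemma diffs_ae vs f g Z : negligible L Z -> (forall x, ~ Z x -> f x = g x) ->
  exists2 Z', negligible L Z' & forall x, ~ Z' x -> diffs vs f x = diffs vs g x.
Proof.
move=> nZ fg; elim: vs => [|v vs [Z' nZ' IH]] /=; first by exists Z.
exists (Z' `|` [set x | Z' (x - v)]).
  by apply: (negligibleU HL) => //; exact: negligible_shift.
by move=> x /not_orP[h1 h2]; rewrite /diff !IH.
Qed.

(* t is the value assigned to the possibly divergent integral of chi xi * f:
   differences along vs make f boundedly supported and multiply the integral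
   by \prod (1 - chi xi v). *)
Definition exp_integral f (t : R) := exists vs h (Z : set 'cV[R]_n),
  [/\ all (fun v => E v != 1) vs, bounded_support h, negligible L Z,
      forall x, ~ Z x -> diffs vs f x = h x &
      L (fun x => E x * h x) = (\prod_(v <- vs) (1 - E v)) * t].

Lemma exp_integral_ae f g t Z : negligible L Z -> (forall x, ~ Z x -> f x = g x) ->
  exp_integral f t -> exp_integral g t.
Proof.
move=> nZ fg [vs [h [Y [Evs bh nY fh Lh]]]].
have [Z' nZ' fg'] := diffs_ae vs nZ fg.
exists vs, h, (Y `|` Z'); split => //; first exact: negligibleU.
by move=> x /not_orP[/fh <- /fg' <-].
Qed.

(** Applying both sequences of differences regularizes both functions at once; each side then only
    acquires the other's factor. *)
Lemma exp_integral_linear a f g t s : exp_integral f t -> exp_integral g s ->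
  exp_integral (fun x => a * f x + g x) (a * t + s).
Proof.
move=> [vs [h [Y [Evs bh nY fh Lh]]]] [ws [k [Z [Ews bk nZ gk Lk]]]].
have [Y' nY' fh'] := diffs_ae ws nY fh.
have [Z' nZ' gk'] := diffs_ae vs nZ gk.
exists (vs ++ ws), (fun x => a * diffs ws h x + diffs vs k x), (Y' `|` Z'); split.
- by rewrite all_cat Evs.
- by apply: bounded_support_linear; exact: bounded_support_diffs.
- exact: negligibleU.
- move=> x /not_orP[/fh' <- /gk' <-].
  by rewrite diffs_linear diffs_cat diffs_comm !diffs_cat.
- have -> : (fun x => E x * (a * diffs ws h x + diffs vs k x)) =
      (fun x => a * (E x * diffs ws h x) + E x * diffs vs k x).
    by apply/funext => x; ring.
  case: (HL) => lin _ _ _; rewrite lin; last 2 first.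
  + exact/bounded_support_chi/bounded_support_diffs.
  + exact/bounded_support_chi/bounded_support_diffs.
  by rewrite !integral_chi_diffs// Lh Lk big_cat /=; ring.
Qed.

Lemma exp_integral0 : exp_integral (fun=> 0) 0.
Proof.
exists [::], (fun=> 0), set0; split => //.
- exact: bounded_support0.
- exact: (negligible0 HL).
- by under eq_fun do rewrite mulr0; rewrite (integral0 HL) mulr0.
Qed.

Lemma exp_integral_sum (I : Type) (r : seq I) (P : pred I) (a : I -> R)
    (F : I -> 'cV[R]_n -> R) (t : I -> R) :
  (forall i, P i -> exp_integral (F i) (t i)) ->
  exp_integral (fun x => \sum_(i <- r | P i) a i * F i x) (\sum_(i <- r | P i) a i * t i).
Proof.
move=> h; elim: r => [|i r IH].
  by under eq_fun do rewrite big_nil; rewrite big_nil; exact: exp_integral0.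
under eq_fun do rewrite big_cons; rewrite big_cons.
by case: ifP => // Pi; apply: exp_integral_linear => //; exact: h.
Qed.

Lemma prod_chi_neq0 vs : all (fun v => E v != 1) vs -> \prod_(v <- vs) (1 - E v) != 0.
Proof.
elim: vs => [|v vs IH] /=; first by rewrite big_nil oner_eq0.
by move=> /andP[v1 /IH vs1]; rewrite big_cons mulf_neq0// subr_eq0 eq_sym.
Qed.

(** Differences commute, so crossing the two sequences yields the same function almost everywhere;
    the factors 1 - chi(v) are nonzero and cancel. *)
Lemma exp_integral_unique f t s : exp_integral f t -> exp_integral f s -> t = s.
Proof.
move=> [vs [h [Y [Evs bh nY fh Lh]]]] [ws [k [Z [Ews bk nZ gk Lk]]]].
have [Y' nY' fh'] := diffs_ae ws nY fh.
have [Z' nZ' gk'] := diffs_ae vs nZ gk.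
have : L (fun x => E x * diffs ws h x) = L (fun x => E x * diffs vs k x).
  apply: (integral_ae HL _ _ (negligibleU HL nY' nZ')).
  - exact/bounded_support_chi/bounded_support_diffs.
  - exact/bounded_support_chi/bounded_support_diffs.
  - by move=> x /not_orP[/fh' <- /gk' <-]; rewrite diffs_comm.
rewrite !integral_chi_diffs// Lh Lk mulrCA => /(mulfI (prod_chi_neq0 Evs)).
by move/(mulfI (prod_chi_neq0 Ews)).
Qed.

End ExponentialIntegral.

(** From x^(k+1) / (k+1)! <= exp x at x = c (m+1). *)
Lemma pow_expR_le (R : realType) (c : R) (k m : nat) : 0 < c ->
  m.+1%:R ^+ k * expR (- (c * m.+1%:R)) <= (k.+1`!%:R / c ^+ k.+1) * m.+1%:R^-1.
Proof.
move=> c0; have m0 : 0 < m.+1%:R :> R by [].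
have cm : 0 < c * m.+1%:R by rewrite mulr_gt0.
have f0 : 0 < k.+1`!%:R :> R by rewrite ltr0n fact_gt0.
have : (c * m.+1%:R) ^+ k.+1 / k.+1`!%:R <= expR (c * m.+1%:R).
  by apply: le_trans (expR_ge1Dxn k (ltW cm)); rewrite lerDr.
rewrite expRN ler_pdivrMr// ler_pdivrMr ?expR_gt0// => h.
have -> : k.+1`!%:R / c ^+ k.+1 / m.+1%:R * expR (c * m.+1%:R) =
    expR (c * m.+1%:R) * k.+1`!%:R / (c ^+ k.+1 * m.+1%:R).
  by rewrite invfM; ring.
by rewrite ler_pdivlMr ?mulr_gt0 ?exprn_gt0// mulrCA -exprSr -exprMn.
Qed.

Lemma cvg_pow_expR (R : realType) (c : R) (k : nat) : 0 < c ->
  m.+1%:R ^+ k * expR (- (c * m.+1%:R)) @[m --> \oo] --> 0.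
Proof.
move=> c0; set C := k.+1`!%:R / c ^+ k.+1.
apply: (@squeeze_cvgr _ _ _ _ (fun=> 0) (fun m : nat => C * m.+1%:R^-1)).
- by apply: nearW => m; rewrite mulr_ge0 ?exprn_ge0 ?expR_ge0//= pow_expR_le.
- exact: cvg_cst.
- by rewrite -[X in _ --> X](mulr0 C); apply: cvgM; [exact: cvg_cst|exact: cvg_harmonic].
Qed.

(** * Exponential integrals of simplicial cones *)

Section SimplicialCone.
Variables (R : realType) (n : nat) (L : ('cV[R]_n -> R) -> R).
Hypothesis HL : is_integral L.
Implicit Types (G : 'M[R]_n) (x : 'cV[R]_n).

Definition simplicial_cone G : set 'cV[R]_n :=
  [set x | forall i, 0 <= (invmx G *m x) i 0].

Lemma simplicial_coneZ G (t : R) : 0 < t -> G \in unitmx ->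
  simplicial_cone (t *: G) = simplicial_cone G.
Proof.
move=> t0 uG; have utG : t *: G \in unitmx by rewrite unitmxZ// unitfE gt_eqF.
have E x i : (invmx (t *: G) *m x) i 0 = t^-1 * (invmx G *m x) i 0.
  by rewrite invmxZ// -scalemxAl [LHS]mxE.
by apply/seteqP; split => x h i; have := h i; rewrite E pmulr_rge0// invr_gt0.
Qed.

Lemma prod_indicator (b : 'I_n -> bool) :
  \prod_i (b i)%:R = ([forall i, b i])%:R :> R.
Proof.
case: (boolP [forall i, b i]) => [/forallP h|]; first by rewrite big1// => i _; rewrite h.
rewrite negb_forall => /existsP[i nb].
by rewrite (bigD1 i)//= (negPf nb) mul0r.
Qed.

(** In the coordinates G^-1 x the indicator is a product over coordinates, and the difference along
    column i changes only the i-th factor, from [0 <= k_i] to [0 <= k_i < 1]. The induction keeps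
    track of the columns already used. *)
Lemma diffs_cone G : G \in unitmx ->
  diffs [seq col i G | i <- enum 'I_n] \1_(simplicial_cone G) =
  \1_(linear_image G (@unit_cube R n)).
Proof.
move=> uG; pose k x i := (invmx G *m x) i 0.
have kB x i j : k (x - col i G) j = k x j - (j == i)%:R.
  by rewrite /k mulmxBr colE mulKmx// !mxE eqxx andbT.
have key (s : seq 'I_n) : uniq s -> diffs [seq col i G | i <- s] \1_(simplicial_cone G) =
    (fun x => \prod_j ((0 <= k x j) && ((j \in s) ==> (k x j < 1)))%:R).
  elim: s => [_|i s IH /= /andP[nis us]].
    apply/funext => x /=; rewrite prod_indicator indicE; congr ((_ : bool)%:R).
    apply/idP/forallP => [/set_mem h i|h]; first by rewrite h.
    by apply/mem_set => i; have := h i; rewrite andbT.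
  rewrite (IH us); apply/funext => x; rewrite /diff.
  rewrite (bigD1 i)//= [X in _ - X](bigD1 i)//= [RHS](bigD1 i)//=.
  rewrite [X in _ - _ * X](eq_bigr (fun j => ((0 <= k x j) && ((j \in s) ==> (k x j < 1)))%:R)).
    rewrite [X in _ = _ * X](eq_bigr (fun j => ((0 <= k x j) && ((j \in s) ==> (k x j < 1)))%:R)).
      rewrite -mulrBl; congr (_ * _).
      rewrite (negPf nis) mem_head !andbT kB eqxx subr_ge0 -natrB.
        by rewrite /= ltNge; case: (leP 0 (k x i)) => //=; case: (leP 1 (k x i)) => //= ? ?; lra.
      by case: (leP 1 (k x i)) => // h; rewrite lt0b; lra.
    by move=> j ji; rewrite inE (negPf ji).
  by move=> j ji; rewrite kB (negPf ji) subr0.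
rewrite key ?enum_uniq//; apply/funext => x; rewrite prod_indicator indicE.
congr ((_ : bool)%:R); apply/forallP/idP => [h|/set_mem h i].
  by apply/mem_set => i; have := h i; rewrite mem_enum.
by rewrite mem_enum; exact: h.
Qed.

Variable xi : 'rV[R]_n.

Lemma exp_integral_cone_step G : G \in unitmx -> (forall i, (xi *m G) 0 i != 0) ->
  exp_integral L xi \1_(simplicial_cone G)
    (L (fun x => chi xi x * \1_(linear_image G (@unit_cube R n)) x) /
     \prod_i (1 - expR (- (xi *m G) 0 i))).
Proof.
move=> uG a0.
have E i : chi xi (col i G) = expR (- (xi *m G) 0 i).
  by rewrite /chi colE mulmxA -colE mxE.
exists [seq col i G | i <- enum 'I_n], \1_(linear_image G (@unit_cube R n)), set0; split.
- apply/allP => _ /mapP[i _ ->]; rewrite E -expR0; apply: contra (a0 i).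
  by move=> /eqP/expR_inj/eqP; rewrite oppr_eq0.
- apply/bounded_support_indic/bounded_linear_image => //; exact: bounded_unit_cube.
- exact: (negligible0 HL).
- by move=> x _; rewrite diffs_cone.
- rewrite big_map big_enum /=; under [in RHS]eq_bigr do rewrite E.
  rewrite [RHS]mulrC divfK//; apply/prodf_neq0 => i _; rewrite subr_eq0 -expR0.
  by apply: contra (a0 i) => /eqP/expR_inj/eqP; rewrite eq_sym oppr_eq0.
Qed.

(** Both bounds come from 1 + x <= exp x, at x = a/(K+1) and at its opposite; the lower one needs K
    large enough for 1 + a/(K+1) to be positive. *)
Lemma cvg_expR_diff_quotient (a : R) :
  (1 - expR (- (a * K.+1%:R^-1))) * K.+1%:R @[K --> \oo] --> a.
Proof.
apply: (@squeeze_cvgr _ _ _ _ (fun K : nat => a / (1 + a * K.+1%:R^-1)) (fun=> a)).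
- have : \forall K \near \oo, `|a| < K%:R by exact: nbhs_infty_gtr.
  apply: filterS => K aK; have K0 : 0 < K.+1%:R^-1 :> R by rewrite invr_gt0.
  have h : -1 < a * K.+1%:R^-1.
    rewrite ltr_pdivlMr// mulN1r ltrNl (le_lt_trans (ler_norm _))// normrN.
    by rewrite (lt_trans aK)// ltr_nat.
  set t := K.+1%:R^-1 in h K0 *; have -> : K.+1%:R = t^-1 :> R by rewrite invrK.
  have h1 := expR_ge1Dx (- (a * t)); have h2 := expR_ge1Dx (a * t).
  have d0 : 0 < 1 + a * t by lra.
  apply/andP; split; last by rewrite ler_pdivrMr//; lra.
  rewrite ler_pdivlMr// expRN mulrAC.
  have : (expR (a * t))^-1 <= (1 + a * t)^-1 by rewrite lef_pV2 ?posrE ?expR_gt0.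
  have -> : a * t / (1 + a * t) = 1 - (1 + a * t)^-1 by field; exact: lt0r_neq0.
  by lra.
- have : a / (1 + a * K.+1%:R^-1) @[K --> \oo] --> a / (1 + a * 0).
    apply: cvgM; first exact: cvg_cst.
    apply: cvgV; first by rewrite mulr0 addr0 oner_eq0.
    apply: cvgD; first exact: cvg_cst.
    by apply: cvgM; [exact: cvg_cst|exact: cvg_harmonic].
  by rewrite mulr0 addr0 divr1.
- exact: cvg_cst.
Qed.

Lemma cvg_prodr (I : Type) (r : seq I) (u : I -> nat -> R) (l : I -> R) :
  (forall i, u i K @[K --> \oo] --> l i) ->
  \prod_(i <- r) u i K @[K --> \oo] --> \prod_(i <- r) l i.
Proof.
move=> ul; elim: r => [|i r IH].
  by under eq_fun do rewrite big_nil; rewrite big_nil; exact: cvg_cst.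
by under eq_fun do rewrite big_cons; rewrite big_cons; exact: cvgM.
Qed.

(* All the cones generated by G / K.+1 are equal, and chi xi is nearly constant
   on the corresponding half-open parallelepiped. *)
Lemma exp_integral_cone G : G \in unitmx -> (forall i, (xi *m G) 0 i != 0) ->
  exp_integral L xi \1_(simplicial_cone G) (`|\det G| / \prod_i (xi *m G) 0 i).
Proof.
move=> uG a0; pose a i := (xi *m G) 0 i.
have pa : \prod_i a i != 0 by apply/prodf_neq0 => i _; exact: a0.
set t := L (fun x => chi xi x * \1_(linear_image G (@unit_cube R n)) x) /
     \prod_i (1 - expR (- (xi *m G) 0 i)).
have ht := exp_integral_cone_step uG a0; rewrite -/t in ht.
suff <- : t = `|\det G| / \prod_i a i by [].
suff ta : t * \prod_i a i = `|\det G| by rewrite -ta mulfK.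
pose A := \sum_i `|a i|.
(* By uniqueness [t] can be recomputed from the generators G/(K+1). So [u K] is the integral of chi
   xi over their parallelepiped times (K+1)^n, which tends to |det G|, while its definition tends to
   t times the product of the a_i. *)
pose u (K : nat) := t * \prod_i ((1 - expR (- (a i * K.+1%:R^-1))) * K.+1%:R).
have ut : u K @[K --> \oo] --> t * \prod_i a i.
  apply: cvgM; first exact: cvg_cst.
  by apply: cvg_prodr => i; exact: cvg_expR_diff_quotient.
have uK K : `|\det G| * expR (- (A * K.+1%:R^-1)) <= u K <= `|\det G| * expR (A * K.+1%:R^-1).
  have s0 : 0 < K.+1%:R^-1 :> R by rewrite invr_gt0.
  pose H := K.+1%:R^-1 *: G.
  have uH : H \in unitmx by rewrite unitmxZ// unitfE gt_eqF.
  have aH i : (xi *m H) 0 i = a i * K.+1%:R^-1 by rewrite -scalemxAr mxE mulrC.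
  have aH0 i : (xi *m H) 0 i != 0 by rewrite aH; apply: mulf_neq0 (a0 i) (lt0r_neq0 s0).
  have := exp_integral_cone_step uH aH0.
  rewrite simplicial_coneZ// => /(exp_integral_unique HL ht).
  set I := L _ => tI.
  have uE : u K = I * K.+1%:R ^+ n.
    rewrite /u tI big_split /= prodr_const card_ord.
    have -> : \prod_i (1 - expR (- (a i * K.+1%:R^-1))) =
        \prod_i (1 - expR (- (xi *m H) 0 i)) by apply: eq_bigr => i _; rewrite aH.
    rewrite mulrA divfK//; apply/prodf_neq0 => i _; rewrite subr_eq0 -expR0.
    by apply: contra (aH0 i) => /eqP/expR_inj/eqP; rewrite eq_sym oppr_eq0.
  have bH : bounded_cV (linear_image H (@unit_cube R n)).
    by apply: bounded_linear_image => //; exact: bounded_unit_cube.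
  have dH : L \1_(linear_image H (@unit_cube R n)) * K.+1%:R ^+ n = `|\det G|.
    rewrite -/(dilation L H) dilation_det// detZ normrM normrX gtr0_norm//.
    by rewrite mulrAC -exprMn mulVf ?pnatr_eq0// expr1n mul1r.
  have xb x : linear_image H (@unit_cube R n) x -> `|(xi *m x) 0 0| <= A * K.+1%:R^-1.
    move=> hx; have -> : xi *m x = (xi *m H) *m (invmx H *m x).
      by rewrite -mulmxA mulKVmx.
    rewrite mxE (le_trans (ler_norm_sum _ _ _))// /A mulr_suml; apply: ler_sum => i _.
    rewrite normrM aH normrM (gtr0_norm s0) ler_piMr ?mulr_ge0 ?(ltW s0)//.
    by have /andP[h1 h2] := hx i; rewrite (ger0_norm h1) ltW.
  rewrite uE -dH [_ * expR _]mulrAC [X in _ <= _ <= X]mulrAC !ler_pM2r ?exprn_gt0//.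
  rewrite mulrC [X in _ <= _ <= X]mulrC -!(integralZ HL); [|exact: bounded_support_indic..].
  apply/andP; split; apply: (integral_le HL);
    try (by apply/bounded_supportZ/bounded_support_indic);
    try (by apply/bounded_support_chi/bounded_support_indic).
    move=> x; rewrite indicE; case: (boolP (x \in _)) => [/set_mem/xb|]; last by rewrite !mulr0.
    rewrite !mulr1 ler_expR lerN2 => h; exact: le_trans (ler_norm _) h.
  move=> x; rewrite indicE; case: (boolP (x \in _)) => [/set_mem/xb|]; last by rewrite !mulr0.
  by rewrite !mulr1 ler_expR => h; rewrite (le_trans (ler_norm _))// normrN.
have ct (b : R) : `|\det G| * expR (b * K.+1%:R^-1) @[K --> \oo] --> `|\det G|.
  suff : `|\det G| * expR (b * K.+1%:R^-1) @[K --> \oo] --> `|\det G| * expR (b * 0).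
    by rewrite mulr0 expR0 mulr1.
  apply: cvgM; first exact: cvg_cst.
  apply: (@cvg_comp _ _ _ (fun K : nat => b * K.+1%:R^-1) expR _ (nbhs (b * 0))).
    by apply: cvgM; [exact: cvg_cst|exact: cvg_harmonic].
  exact: continuous_expR.
have ud : u K @[K --> \oo] --> `|\det G|.
  apply: (squeeze_cvgr _ _ (ct A)); last first.
    have := ct (- A); under eq_fun do rewrite mulNr; exact.
  by apply: nearW => K; exact: uK.
exact: (cvg_unique (@Rhausdorff R) ut ud).
Qed.

End SimplicialCone.

(** * Regularized values as limits of truncated integrals *)

Section Tail.
Variables (R : realType) (n : nat) (L : ('cV[R]_n -> R) -> R).
Hypothesis HL : is_integral L.
Variables (xi la : 'rV[R]_n) (g : 'cV[R]_n -> R) (B c : R).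
Implicit Types (x w : 'cV[R]_n).

Let lam x : R := (la *m x) 0 0.
Hypotheses (B0 : 0 <= B) (c0 : 0 < c).
Hypothesis g01 : forall x, 0 <= g x <= 1.
Hypothesis gsupp : forall x, g x != 0 ->
  [/\ 0 <= lam x, forall i, `|x i 0| <= B * lam x & c * lam x <= (xi *m x) 0 0].

Let lamB x w : lam (x - w) = lam x - lam w.
Proof. by rewrite /lam mulmxBr !mxE. Qed.

Let E := chi xi.

Definition truncated (T : R) x : R := g x * (lam x <= T)%R%:R.

Let truncated_neq0 T x : truncated T x != 0 -> g x != 0 /\ lam x <= T.
Proof.
rewrite /truncated; case: leP => _; last by rewrite mulr0 eqxx.
by rewrite mulr1.
Qed.

Let truncated01 T x : 0 <= truncated T x <= 1.
Proof.
have /andP[g0 g1] := g01 x; rewrite /truncated mulr_ge0//=.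
by case: (leP (lam x) T) => _; [rewrite mulr1|rewrite mulr0 ler01].
Qed.

Lemma bounded_support_truncated T : bounded_support (truncated T).
Proof.
apply/bounded_supportP; split.
  by exists 1 => x; have /andP[h0 h1] := truncated01 T x; rewrite ger0_norm.
exists (Num.truncn (B * T)).+1 => x /truncated_neq0[/gsupp[l0 xB _] lT] i.
by rewrite (le_trans (xB i))// (le_trans _ (ltW (truncnS_gt _)))// ler_wpM2l.
Qed.

(** The sums of all subsequences of [vs]: the translations occurring in the expansion of an iterated
    difference. *)
Fixpoint shifts (vs : seq 'cV[R]_n) : seq 'cV[R]_n :=
  if vs is v :: vs' then shifts vs' ++ [seq w + v | w <- shifts vs'] else [:: 0].

Lemma diffs_le vs (f : 'cV[R]_n -> R) x :
  `|diffs vs f x| <= \sum_(w <- shifts vs) `|f (x - w)|.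
Proof.
elim: vs x => [|v vs IH] x /=; first by rewrite big_seq1 subr0.
rewrite /diff big_cat big_map /= (le_trans (ler_normB _ _))// lerD//.
rewrite (le_trans (IH _))//; apply: ler_sum => w _.
by rewrite opprD addrA addrAC.
Qed.

Let tail (A T : R) x : R := truncated T x * (T - (A + A) < lam x)%R%:R.

Let bounded_support_tail A T : bounded_support (tail A T).
Proof.
apply: bounded_support_le (bounded_support_truncated T) => x.
rewrite normrM ler_piMr//.
by case: (ltP (T - (A + A)) (lam x)) => _; rewrite ?normr1 ?normr0// ler01.
Qed.

(** The tail lives in a box of side 2 B T and there <xi, x> >= c (T - 2 A), so the exponential beats
    the polynomial volume. *)
Let integral_tail_le A T : 0 <= T ->
  L (fun x => E x * tail A T x) <=
  (expR (c * (A + A)) * (B + B) ^+ n) * (T ^+ n * expR (- (c * T))).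
Proof.
move=> T0; pose b : 'cV[R]_n := const_mx (B * T).
have ab i : (- b) i 0 <= b i 0 by rewrite !mxE -subr_ge0 opprK -mulrDl mulr_ge0// ?addr_ge0.
have Hl := integral_content HL.
apply: (@le_trans _ _ (L (fun x => expR (- (c * (T - (A + A)))) * \1_(box (- b) b) x))).
  apply: (integral_le HL).
  - exact: bounded_support_chi.
  - exact/bounded_supportZ/bounded_support_indic/bounded_box.
  - move=> x; rewrite /tail; have [t0|] := eqVneq (truncated T x) 0.
      by rewrite t0 mul0r mulr0 mulr_ge0 ?expR_ge0// indicE.
    move=> /[dup] tx /truncated_neq0[/gsupp[l0 xB cx] lT].
    rewrite indicE mem_set ?mulr1; last first.
      move=> i; rewrite !mxE -ler_norml (le_trans (xB i))// ler_wpM2l//.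
    case: (ltP (T - (A + A)) (lam x)) => [lt|_]; last by rewrite !mulr0 expR_ge0.
    have /andP[h0 h1] := truncated01 T x.
    rewrite mulr1 (le_trans (y := E x))//; first by rewrite ler_piMr ?expR_ge0.
    by rewrite ler_expR lerN2 (le_trans _ cx)// ler_pM2l// ltW.
rewrite (integralZ HL); last exact/bounded_support_indic/bounded_box.
rewrite mulrBr opprB expRD -!mulrA ler_pM2l ?expR_gt0//.
rewrite [leLHS]mulrC [leRHS]mulrA ler_pM2r ?expR_gt0// -exprMn.
apply: (le_trans (content_box Hl ab)).
rewrite /box_volume (eq_bigr (fun=> (B + B) * T)) => [|i _]; last by rewrite !mxE opprK mulrDl.
by rewrite prodr_const card_ord.
Qed.

(** Shifts change lam by at most A. Where lam x <= T - A the truncation is invisible; above that h x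
    = 0, because M < T - A, and only values at heights beyond T - 2 A enter. *)
Let tail_bound vs h (Z : set 'cV[R]_n) (M A T : R) x :
  ~ Z x -> diffs vs g x = h x ->
  (forall w, w \in shifts vs -> `|lam w| <= A) ->
  (h x != 0 -> `|lam x| <= M) -> M + A < T ->
  `|diffs vs (truncated T) x - h x| <= \sum_(w <- shifts vs) tail A T (x - w).
Proof.
move=> nZ gh wA hM MT.
have [lT|lT] := leP (lam x) (T - A).
  rewrite -gh.
  have -> : diffs vs (truncated T) x - diffs vs g x =
      diffs vs (fun y => -1 * g y + truncated T y) x.
    by rewrite diffs_linear mulN1r addrC.
  rewrite (le_trans (diffs_le _ _ _))//.
  rewrite big_seq [leRHS]big_seq; apply: ler_sum => w ws.
  have lw : lam (x - w) <= T.
    by have := wA w ws; rewrite lamB ler_norml => /andP[h1 h2]; lra.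
  rewrite /truncated lw mulr1 mulN1r addrC subrr normr0 mulr_ge0//.
  by have /andP[] := truncated01 T (x - w).
have -> : h x = 0.
  apply/eqP; apply: contraT => /hM; rewrite ler_norml => /andP[h1 h2]; lra.
rewrite subr0 (le_trans (diffs_le _ _ _))//.
rewrite big_seq [leRHS]big_seq; apply: ler_sum => w ws.
have /andP[h0 h1] := truncated01 T (x - w).
have lw : T - (A + A) < lam (x - w).
  by have := wA w ws; rewrite lamB ler_norml => /andP[h1' h2]; lra.
by rewrite /tail lw mulr1 ger0_norm.
Qed.

(** The error at level T, multiplied by the nonzero factor D, is the integral against chi xi of
    diffs(truncated) - h, which is controlled by tails. *)
Lemma exp_integral_cvg t : exp_integral L xi g t ->
  L (fun x => E x * truncated m.+1%:R x) @[m --> \oo] --> t.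
Proof.
move=> [vs [h [Z [Evs bh nZ gh Lh]]]].
have D0 := prod_chi_neq0 Evs; set D := \prod_(v <- vs) _ in D0 Lh.
pose A := \sum_(w <- shifts vs) `|lam w|.
have wA w : w \in shifts vs -> `|lam w| <= A.
  by move=> ws; rewrite /A (big_rem w)//= lerDl sumr_ge0.
case: (bh) => M0 hM0; pose M := (\sum_i `|la 0 i|) * M0%:R.
have hM x : h x != 0 -> `|lam x| <= M by move=> /(hM0 x).2; exact: chi_bound.
pose S := \sum_(w <- shifts vs) E w.
have S0 : 0 <= S by apply: sumr_ge0 => w _; exact: expR_ge0.
pose C := `|D|^-1 * (S * (expR (c * (A + A)) * (B + B) ^+ n)).
have key T : 0 <= T -> M + A < T ->
    `|L (fun x => E x * truncated T x) - t| <= C * (T ^+ n * expR (- (c * T))).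
  move=> T0 MT; have bT := bounded_support_truncated T.
  have bd := bounded_support_diffs vs bT.
  rewrite -[leLHS](mulKf (lt0r_neq0 (_ : 0 < `|D|))) ?normr_gt0//.
  rewrite -normrM mulrBr -(integral_chi_diffs HL xi vs bT) -/D -Lh -(integralB HL); last 2 first.
  - exact: bounded_support_chi.
  - exact: bounded_support_chi.
  rewrite /C -[leRHS]mulrA ler_pM2l ?invr_gt0 ?normr_gt0//.
  (* The pointwise bound is known only off [Z]; cutting [Z] out makes it hold everywhere without
     changing the integral. *)
  pose F x := \1_(~` Z) x * (E x * diffs vs (truncated T) x - E x * h x).
  have bF0 : bounded_support (fun x => E x * diffs vs (truncated T) x - E x * h x).
    by apply: bounded_supportB; exact: bounded_support_chi.
  rewrite (@integral_ae _ _ _ HL _ F Z)//; last 2 first.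
  - apply: bounded_support_le bF0 => x.
    by rewrite normrM ler_piMl// indicE; case: (x \in _); rewrite ?normr1 ?normr0.
  - by move=> x nx; rewrite /F indicE mem_set// mul1r.
  apply: (@le_trans _ _ (L (fun x => \sum_(w <- shifts vs) E x * tail A T (x - w)))).
    apply: (le_abs_integral HL).
      by apply: bounded_support_sum => w; exact/bounded_support_chi/bounded_support_shift.
    move=> x; rewrite /F indicE -mulrBr -mulr_sumr.
    have s0 : 0 <= \sum_(w <- shifts vs) tail A T (x - w).
      by apply: sumr_ge0 => w _; rewrite mulr_ge0//; have /andP[] := truncated01 T (x - w).
    case: (boolP (x \in _)) => [/set_mem nx|_]; last first.
      by rewrite mul0r normr0 mulr_ge0// expR_ge0.
    rewrite mul1r normrM gtr0_norm ?chi_gt0// ler_pM2l ?chi_gt0//.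
    by apply: (@tail_bound _ _ Z M) => //; [exact: gh|exact: hM].
  rewrite (integral_sum HL); last by move=> w; exact/bounded_support_chi/bounded_support_shift.
  under eq_bigr do rewrite (integral_chi_shift HL)//.
  by rewrite -mulr_suml -[leRHS]mulrA ler_wpM2l// integral_tail_le.
pose u (m : nat) := C * (m.+1%:R ^+ n * expR (- (c * m.+1%:R))).
have u0 : u m @[m --> \oo] --> 0.
  rewrite -[X in _ --> X](mulr0 C); apply: cvgM; first exact: cvg_cst.
  exact: cvg_pow_expR.
apply: (@squeeze_cvgr _ _ _ _ (fun m => t - u m) (fun m => t + u m)).
- have : \forall m \near \oo, M + A < m%:R by exact: nbhs_infty_gtr.
  apply: filterS => m Mm; rewrite -ler_distl key//.
  by rewrite (lt_trans Mm)// ltr_nat.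
- by rewrite -[X in _ --> X]subr0; apply: cvgB => //; exact: cvg_cst.
- by rewrite -[X in _ --> X]addr0; apply: cvgD => //; exact: cvg_cst.
Qed.

End Tail.

(** * The cone over a convex body *)

Section Gamma.
Variables (R : realType) (c : R).
Hypothesis c0 : 0 < c.

(** The antiderivative of t^k exp(- c t) that vanishes at infinity, computed by parts; minus its
    value at 0 is k! / c^(k+1). *)
Fixpoint gamma_prim (k : nat) (t : R) : R :=
  if k is k'.+1 then - c^-1 * (t ^+ k * expR (- (c * t))) + k%:R / c * gamma_prim k' t
  else - c^-1 * expR (- (c * t)).

Lemma is_derive_pow k (t : R) : is_derive t 1 (fun s => s ^+ k.+1) (k.+1%:R * t ^+ k).
Proof.
have := is_deriveX k.+1 (is_derive_id t (1 : R)).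
by rewrite exprfctE /= /GRing.scale /= mulr1.
Qed.

Lemma is_derive_gamma_prim k (t : R) :
  is_derive t 1 (gamma_prim k) (t ^+ k * expR (- (c * t))).
Proof.
have cN : c != 0 by exact: lt0r_neq0.
elim: k => [|k IH] /=.
  by apply: is_derive_eq; rewrite /GRing.scale /=; field.
have ? := is_derive_pow k t.
apply: is_derive_eq; rewrite /GRing.scale /= exprS; field.
exact: cN.
Qed.

Lemma gamma_prim0 k : gamma_prim k 0 = - (k`!%:R / c ^+ k.+1).
Proof.
elim: k => [|k IH] /=; first by rewrite mulr0 oppr0 expR0 mulr1 expr1 mul1r.
rewrite IH expr0n /= mul0r mulr0 add0r factS natrM (exprS _ k.+1) invfM; ring.
Qed.

Lemma cvg_gamma_prim k : gamma_prim k m.+1%:R @[m --> \oo] --> 0.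
Proof.
elim: k => [|k IH] /=.
  rewrite -[X in _ --> X](mulr0 (- c^-1)); apply: cvgM; first exact: cvg_cst.
  have := @cvg_pow_expR R c 0 c0; by under eq_fun do rewrite expr0 mul1r.
rewrite -[X in _ --> X](mulr0 (- c^-1)) -[X in _ --> X]addr0.
rewrite -[X in _ --> _ + X](mulr0 (k.+1%:R / c)).
apply: cvgD; apply: cvgM => //; try exact: cvg_cst.
exact: cvg_pow_expR.
Qed.

Lemma nondecreasing_is_derive (f df : R -> R) (a b : R) :
  (forall t : R, is_derive t 1 f (df t)) -> (forall t, a < t < b -> 0 <= df t) ->
  a <= b -> f a <= f b.
Proof.
move=> fd df0 ab.
have dv (t : R) : derivable f t 1 by have := fd t.
apply: (@ger0_derive1_le_cc _ f a b); rewrite ?in_itv/= ?lexx ?ab//.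
- move=> t; rewrite in_itv/= => tab; rewrite derive1E.
  by have -> := @derive_val _ _ _ _ _ _ _ (fd t); exact: df0.
- apply: continuous_subspaceT => t; apply/differentiable_continuous.
  exact/derivable1_diffP.
Qed.

(** Freeze the exponential at an endpoint [s] of its range and check that the derivative of the
    difference [f s] has constant sign on (a, b). *)
Lemma gamma_prim_bounds k (a b : R) : 0 <= a -> a <= b ->
  expR (- (c * b)) * (b ^+ k.+1 - a ^+ k.+1)
    <= k.+1%:R * (gamma_prim k b - gamma_prim k a)
    <= expR (- (c * a)) * (b ^+ k.+1 - a ^+ k.+1).
Proof.
move=> a0 ab.
pose f s (t : R) := k.+1%:R * gamma_prim k t - s * t ^+ k.+1.
have fd s (t : R) : is_derive t 1 (f s) (k.+1%:R * t ^+ k * (expR (- (c * t)) - s)).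
  have ? := is_derive_gamma_prim k t; have ? := is_derive_pow k t.
  by apply: is_derive_eq; rewrite /GRing.scale /=; ring.
apply/andP; split.
  suff : f (expR (- (c * b))) a <= f (expR (- (c * b))) b by rewrite /f; lra.
  apply: (nondecreasing_is_derive (fd _)) => // t /andP[at_ tb].
  rewrite mulr_ge0 ?mulr_ge0 ?exprn_ge0 ?(le_trans a0 (ltW at_))// subr_ge0 ler_expR.
  by rewrite lerN2 ler_pM2l// ltW.
suff : - f (expR (- (c * a))) a <= - f (expR (- (c * a))) b by rewrite /f; lra.
have fdN (t : R) : is_derive t 1 (fun t => - f (expR (- (c * a))) t)
    (- (k.+1%:R * t ^+ k * (expR (- (c * t)) - expR (- (c * a))))).
  by have ? := fd (expR (- (c * a))) t; apply: is_derive_eq.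
apply: (nondecreasing_is_derive fdN) => // t /andP[at_ tb].
rewrite -mulrN opprB.
rewrite mulr_ge0 ?mulr_ge0 ?exprn_ge0 ?(le_trans a0 (ltW at_))// subr_ge0 ler_expR.
by rewrite lerN2 ler_pM2l// ltW.
Qed.

End Gamma.

(** * Coordinates and heights in R^(d+1) *)

Section Height.
Variables (R : realType) (d : nat).
Implicit Types (x y : 'cV[R]_(d + 1)).

Definition height_row : 'rV[R]_(d + 1) := row_mx 0 1%:M.

Lemma height_rowE x : (height_row *m x) 0 0 = last_coord x.
Proof. by rewrite -{1}[x]vsubmxK mul_row_col mul0mx add0r mul1mx. Qed.

Lemma last_coordD x y : last_coord (x + y) = last_coord x + last_coord y.
Proof. by rewrite /last_coord !mxE. Qed.

Lemma last_coordB x y : last_coord (x - y) = last_coord x - last_coord y.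
Proof. by rewrite /last_coord !mxE. Qed.

Lemma last_coordZ (t : R) x : last_coord (t *: x) = t * last_coord x.
Proof. by rewrite /last_coord !mxE. Qed.

Lemma last_coord_col (u : 'cV[R]_d) (s : 'cV[R]_1) : last_coord (col_mx u s) = s 0 0.
Proof. by rewrite /last_coord col_mxKd. Qed.

Lemma usubmxD x y : usubmx (x + y) = usubmx x + usubmx y.
Proof. by apply/colP => i; rewrite !mxE. Qed.

Lemma usubmxZ (t : R) x : usubmx (t *: x) = t *: usubmx x.
Proof. by apply/colP => i; rewrite !mxE. Qed.

Lemma forall_coord (Q : R -> Prop) x :
  (forall i, Q (x i 0)) <-> (forall i, Q (usubmx x i 0)) /\ Q (last_coord x).
Proof.
split=> [h|[h1 h2] i].
  by split=> [i|]; [rewrite mxE|rewrite /last_coord mxE].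
case: (split_ordP i) => j ->; first by have := h1 j; rewrite mxE.
by rewrite [j]ord1; move: h2; rewrite /last_coord mxE.
Qed.

Lemma negligible_height (L : ('cV[R]_(d + 1) -> R) -> R) (t : R) : is_integral L ->
  negligible L [set x | last_coord x = t].
Proof.
move=> HL; apply: (negligible_transversal HL (u := col_mx 0 1%:M)) => x s s0 /= xt.
rewrite last_coordD last_coordZ last_coord_col mxE eqxx mulr1 xt; lra.
Qed.

End Height.

(** * The truncated cone and the volume of its base *)

Section Pyramid.
Variables (R : realType) (d n : nat) (V : 'M[R]_(d, n)).
Hypothesis aV : affine_hull V = setT.
Variable L : ('cV[R]_(d + 1) -> R) -> R.
Hypothesis HL : is_integral L.
Implicit Types (x y : 'cV[R]_(d + 1)).

Let P := conv_hull V.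

Let bodyP : convex_body P. Proof. exact: convex_body_conv_hull. Qed.

Definition pyramid (T : R) : set 'cV[R]_(d + 1) :=
  [set x | cone_over (conv_hull V) x /\ last_coord x <= T].

(** The points (v, 1) together with the apex 0 exhibit the truncated cone as a polytope, so the
    results on convex bodies apply to it. *)
Lemma pyramid1E :
  pyramid 1 = conv_hull (row_mx 0 (col_mx V (const_mx 1)) : 'M[R]_(d + 1, 1 + n)).
Proof.
have sumE (w : 'cV[R]_n) : ((const_mx 1 : 'rV[R]_n) *m w) 0 0 = \sum_i w i 0.
  by rewrite mxE; apply: eq_bigr => i _; rewrite mxE mul1r.
apply/seteqP; split => x.
  move=> [[s0 [_ [w [w0 w1 ->]] xE]] s1]; set s := last_coord x in s0 xE s1.
  exists (col_mx (1 - s)%:M (s *: w)); split.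
  - move=> i; case: (split_ordP i) => j ->.
      by rewrite col_mxEu [j]ord1 mxE eqxx mulr1n subr_ge0.
    by rewrite col_mxEd mxE mulr_ge0.
  - rewrite big_split_ord /= big_ord1 col_mxEu mxE eqxx mulr1n.
    under eq_bigr do rewrite col_mxEd mxE.
    by rewrite -mulr_sumr w1 mulr1 subrK.
  - rewrite mul_row_col mul0mx add0r mul_col_mx -[LHS]vsubmxK; congr col_mx.
      by rewrite xE scalemxAr.
    apply/colP => i; rewrite [i]ord1 -scalemxAr [RHS]mxE sumE w1 mulr1.
    by rewrite /s /last_coord.
move=> [w [w0 w1 ->]].
rewrite -[w]vsubmxK mul_row_col mul0mx add0r mul_col_mx.
set u := dsubmx w; set s := \sum_i u i 0.
have u0 i : 0 <= u i 0 by rewrite mxE.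
have lE : last_coord (col_mx (V *m u) (const_mx 1 *m u)) = s by rewrite last_coord_col sumE.
have s0 : 0 <= s by exact: sumr_ge0.
have s1 : s <= 1.
  rewrite -w1 big_split_ord /= big_ord1 /s.
  have -> : \sum_i u i 0 = \sum_(i < n) w (rshift 1 i) 0.
    by apply: eq_bigr => i _; rewrite /u mxE.
  by rewrite lerDr.
split; last by rewrite lE.
split; rewrite lE//; rewrite col_mxKu.
(* At height 0 only the apex occurs; any point of P serves as a witness. *)
have [s00|sN] := eqVneq s 0.
  have [p [r [r0 pr]]] := conv_hull_ball aV.
  exists p; first by apply: pr => i; rewrite subrr normr0 ltW.
  have -> : u = 0.
    apply/colP => i; rewrite [RHS]mxE; apply/eqP; rewrite eq_le u0 andbT -s00.
    by rewrite /s (bigD1 i)//= lerDl sumr_ge0.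
  by rewrite mulmx0 s00 scale0r.
exists (V *m (s^-1 *: u)).
  exists (s^-1 *: u); split => //.
    by move=> i; rewrite mxE mulr_ge0 ?invr_ge0.
  by under eq_bigr do rewrite mxE; rewrite -mulr_sumr mulVf.
by rewrite -scalemxAr scalerA mulfV// scale1r.
Qed.

Lemma convex_body_pyramid1 : convex_body (pyramid 1).
Proof.
rewrite pyramid1E; apply: convex_body_conv_hull.
apply/seteqP; split => // x _.
have aff z : affine_hull V z by rewrite aV.
have [w0 [w01 w0E]] := aff 0; have [w [w1 wE]] := aff (usubmx x).
(* [w0] has weight sum 1 and represents 0, so adding a multiple of it adjusts the total weight to s
   without moving the point. *)
pose s := last_coord x; pose v := w + (s - 1) *: w0.
have v1 : \sum_i v i 0 = s.
  by under eq_bigr do rewrite !mxE; rewrite big_split /= -mulr_sumr w01 w1; lra.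
exists (col_mx (1 - s)%:M v); split.
  rewrite big_split_ord /= big_ord1 col_mxEu mxE eqxx mulr1n.
  by under eq_bigr do rewrite col_mxEd; rewrite v1 subrK.
rewrite mul_row_col mul0mx add0r mul_col_mx -[LHS]vsubmxK; congr col_mx.
  by rewrite mulmxDr -scalemxAr -w0E scaler0 addr0.
apply/colP => i; rewrite [i]ord1 [RHS]mxE -[LHS]/s -v1.
by apply: eq_bigr => j _; rewrite [const_mx _ _ _]mxE mul1r.
Qed.

Lemma cone_overZ (T : R) x : 0 < T -> cone_over P (T *: x) <-> cone_over P x.
Proof.
move=> T0; have gen (S : R) y : 0 < S -> cone_over P y -> cone_over P (S *: y).
  move=> S0 [y0 [p Pp yp]]; split; first by rewrite last_coordZ mulr_ge0// ltW.
  by exists p => //; rewrite usubmxZ yp last_coordZ scalerA.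
split=> [/(gen T^-1)|]; last exact: gen.
by rewrite invr_gt0 scalerA mulVf ?gt_eqF// scale1r; exact.
Qed.

Lemma pyramidE (T : R) : 0 < T -> pyramid T = linear_image T%:M (pyramid 1).
Proof.
move=> T0; rewrite /linear_image invmx_scalar.
have T0' : 0 < T^-1 by rewrite invr_gt0.
apply/seteqP; split => x; rewrite /pyramid /= mul_scalar_mx last_coordZ;
  move=> [h1 h2]; (split; first by apply/(cone_overZ _ T0')).
  by rewrite ler_pdivrMl// mulr1.
by move: h2; rewrite ler_pdivrMl// mulr1.
Qed.

Let W := L \1_(pyramid 1).

Lemma bounded_pyramid T : bounded_cV (pyramid T).
Proof.
have uT : (1 + `|T|)%:M \in @unitmx R (d + 1).
  by rewrite unitmxE det_scalar unitfE expf_neq0// gt_eqF// ltr_pwDl.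
apply: (@bounded_cV_sub _ _ _ (pyramid (1 + `|T|))).
  move=> x [h1 h2]; split => //; have := ler_norm T; lra.
rewrite pyramidE; last by rewrite ltr_pwDl.
by apply: bounded_linear_image => //; case: convex_body_pyramid1.
Qed.

Lemma integral_pyramid T : 0 < T -> L \1_(pyramid T) = T ^+ (d + 1) * W.
Proof.
move=> T0; rewrite pyramidE// integral_linear_image//; last exact: convex_body_pyramid1.
  by rewrite det_scalar ger0_norm// exprn_ge0// ltW.
by rewrite unitmxE det_scalar unitfE expf_neq0// gt_eqF.
Qed.

Lemma integral_pyramid0 : L \1_(pyramid 0) = 0.
Proof.
apply: (negligible_height (t := 0) HL); first exact/bounded_support_indic/bounded_pyramid.
move=> x x0; rewrite indicE memNset// => -[[h1 _] h2]; apply: x0.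
by apply/eqP; rewrite eq_le h1 h2.
Qed.

Lemma integral_pyramid_diff (a b : R) : 0 <= a -> a <= b ->
  L (fun x => \1_(pyramid b) x - \1_(pyramid a) x) = (b ^+ (d + 1) - a ^+ (d + 1)) * W.
Proof.
have E T : 0 <= T -> L \1_(pyramid T) = T ^+ (d + 1) * W.
  rewrite le_eqVlt => /orP[/eqP <-|]; last exact: integral_pyramid.
  by rewrite integral_pyramid0 expr0n addn1 mul0r.
move=> a0 ab; rewrite (integralB HL); [|exact/bounded_support_indic/bounded_pyramid..].
by rewrite !E ?mulrBl// (le_trans a0).
Qed.

Definition prism (h : R) (S : set 'cV[R]_d) : set 'cV[R]_(d + 1) :=
  [set x | S (usubmx x) /\ 1 <= last_coord x < 1 + h].

Lemma bounded_prism h S : bounded_cV S -> bounded_cV (prism h S).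
Proof.
move=> [M SM]; exists (M + Num.truncn (1 + `|h|)).+1 => x [/SM xM /andP[x1 xh]].
apply/(forall_coord (fun t => `|t| <= _)); split.
  by move=> i; rewrite (le_trans (xM i))// ler_nat ltnW// ltnS leq_addr.
have := ltW (truncnS_gt (1 + `|h|)); have := ler_norm h; rewrite -!natr1 natrD => h1 h2.
have : 0 <= M%:R :> R by []; rewrite ger0_norm; lra.
Qed.

(** The bridge between dimensions d and d+1: by uniqueness of contents, prisms over a convex body
    have h times its volume. *)
Lemma content_prism h : 0 < h -> is_content (fun S => L \1_(prism h S) / h).
Proof.
move=> h0; have [l0 lU l1 lT] := integral_content HL; split.
- by move=> S bS; rewrite divr_ge0 ?(ltW h0)//; apply/l0/bounded_prism.
- move=> S T bS bT ST; rewrite -mulrDl -lU; [|exact: bounded_prism..|].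
    congr (L \1_ _ / _); apply/seteqP; split => x.
      by move=> [[?|?] ?]; [left|right].
    by move=> [[? ?]|[? ?]]; split => //; [left|right].
  apply/seteqP; split => // x [[Sx _] [Tx _]].
  by rewrite -[set0 x]/(set0 (usubmx x)) -ST.
(* [D] stretches the unit cube of R^(d+1) into the prism over the unit cube of R^d, up to lowering
   it by 1. *)
- pose D : 'M[R]_(d + 1) := block_mx 1%:M 0 0 h%:M.
  have dD : \det D = h by rewrite det_ublock det1 mul1r det_scalar expr1.
  have uD : D \in unitmx by rewrite unitmxE dD unitfE gt_eqF.
  have hE := dilation_det HL uD; rewrite dD gtr0_norm// in hE.
  suff E : L \1_(prism h (@unit_cube R d)) = h by rewrite E mulfV// gt_eqF.
  rewrite -[RHS]hE /dilation -(lT (prism h (@unit_cube R d)) (col_mx 0 1%:M)); last first.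
    exact/bounded_prism/bounded_unit_cube.
  have DE y : usubmx (D *m y) = usubmx y /\ last_coord (D *m y) = h * last_coord y.
    rewrite -{1 3}[y]vsubmxK /D mul_block_col !mul0mx addr0 add0r mul1mx mul_scalar_mx.
    by rewrite col_mxKu last_coord_col mxE.
  congr (L \1_ _); apply/seteqP; split => x; rewrite /linear_image /=;
    have [uE lE] := DE (invmx D *m x); rewrite mulKVmx// in uE lE;
    rewrite /prism /= usubmxD col_mxKu addr0 last_coordD last_coord_col mxE eqxx mulr1n uE lE.
    move=> [xc xl]; apply/(forall_coord (fun t => 0 <= t < 1)); split => //.
    move: xl; set t := last_coord _ => /andP[h1 h2].
    by apply/andP; split; [rewrite -(pmulr_rge0 _ h0)|rewrite -(ltr_pM2l h0)]; lra.
  move=> /(forall_coord (fun t => 0 <= t < 1))[xc xl]; split => //.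
  move: xl; set t := last_coord _ => /andP[h1 h2].
  have : 0 <= h * t by rewrite mulr_ge0// ltW.
  have : h * t < h * 1 by rewrite ltr_pM2l.
  by move=> h3 h4; apply/andP; split; lra.
- move=> S v bS; congr (_ / _); rewrite -[RHS](lT _ (col_mx v 0)); last exact: bounded_prism.
  congr (L \1_ _); apply/seteqP; split => x;
    by rewrite /prism /= usubmxD col_mxKu last_coordD last_coord_col mxE addr0.
Qed.

Let slab (h : R) : set 'cV[R]_(d + 1) :=
  [set x | cone_over P x /\ 1 <= last_coord x < 1 + h].

Let integral_slab (h : R) : 0 < h -> L \1_(slab h) = ((1 + h) ^+ (d + 1) - 1) * W.
Proof.
move=> h0.
have bS : bounded_cV (slab h).
  by apply: bounded_cV_sub (bounded_pyramid (1 + h)) => x [? /andP[_ /ltW]].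
have le1h : 1 <= 1 + h by lra.
rewrite -[X in _ - X](expr1n R (d + 1)) -(integral_pyramid_diff ler01 le1h).
apply: (integral_ae HL _ _ (negligibleU HL (negligible_height (t := 1) HL)
  (negligible_height (t := 1 + h) HL))).
- exact: bounded_support_indic.
- by apply: bounded_supportB; exact/bounded_support_indic/bounded_pyramid.
- move=> x /not_orP[/= x1 xh]; rewrite !indicE.
  have [Cx|nC] := pselect (cone_over P x); last first.
    by rewrite !memNset ?subrr// => -[].
  have E T : (x \in pyramid T) = (last_coord x <= T).
    by apply/idP/idP => [/set_mem[]|xT]//; apply/mem_set.
  have ES : (x \in slab h) = (1 <= last_coord x < 1 + h).
    by apply/idP/idP => [/set_mem[]|xT]//; apply/mem_set.
  rewrite !E ES; have [l1|l1|/x1//] := ltgtP (last_coord x) 1.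
    have -> : last_coord x <= 1 + h by lra.
    by rewrite /= subrr.
  by have [lh|lh|/xh//] := ltgtP (last_coord x) (1 + h); rewrite subr0.
Qed.

Let prism_scaled (Ld : ('cV[R]_d -> R) -> R) (h t : R) (v : 'cV[R]_d) :
  is_integral Ld -> 0 < h -> 0 < t ->
  L \1_(prism h [set x | linear_image t%:M P (x + v)]) = h * (t ^+ d * Ld \1_P).
Proof.
move=> HLd h0 t0.
have ut : t%:M \in @unitmx R d by rewrite unitmxE det_scalar unitfE expf_neq0// gt_eqF.
have Hp := content_prism h0; have [_ _ _ pT] := Hp.
have bT := convex_body_linear_image ut bodyP.
have bT' : bounded_cV (linear_image t%:M P) by case: bT.
have /= pE := pT _ v bT'.
have := content_vol Hp bT; rewrite (content_vol (integral_content HLd) bT) => -[vE].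
rewrite integral_linear_image// det_scalar ger0_norm ?exprn_ge0 ?(ltW t0)// in vE.
by rewrite vE -pE mulrC divfK// gt_eqF.
Qed.

(** The slab of the cone between heights 1 and 1 + h is caught between prisms over P scaled by u and
    by 1/u, with u = 1 - k h. Its volume divided by h is W times the sum of the (1 + h)^i, i <= d,
    which tends to (d+1) W. *)
Lemma pyramid_volume : vol P = ((d + 1)%:R * W)%:E.
Proof.
have [Ld HLd] := @integral_exists R d.
rewrite (content_vol (integral_content HLd) bodyP); congr _%:E.
set VP := Ld \1_P.
have [cP [M PM] vP [p [r pr]]] := bodyP; have r0 := pr.1.
pose B : R := M%:R; have B0 : 0 <= B by [].
(* For heights s in [1, 1 + h), scaling a point of P by s or 1/s moves it by at most h B = (k h) r,
   the margin left by shrinking P by 1 - k h about p. *)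
pose k := B / r; have k0 : 0 <= k by rewrite divr_ge0// ltW.
have key (h : R) : 0 < h -> k * h < 1 ->
    (1 - k * h) ^+ d * VP <= (\sum_(i < d + 1) (1 + h) ^+ i) * W /\
    (1 - k * h) ^+ d * ((\sum_(i < d + 1) (1 + h) ^+ i) * W) <= VP.
  move=> h0 kh; pose u := 1 - k * h; have u0 : 0 < u by rewrite subr_gt0.
  have kr : k * h * r = h * B by rewrite /k; field; exact: lt0r_neq0.
  have slabE : L \1_(slab h) = h * ((\sum_(i < d + 1) (1 + h) ^+ i) * W).
    by rewrite integral_slab// subrX1 mulrA; congr (_ * _ * _); lra.
  have bS : bounded_cV (slab h).
    by apply: bounded_cV_sub (bounded_pyramid (1 + h)) => x [? /andP[_ /ltW]].
  have u1 : 0 <= k * h <= 1 by rewrite mulr_ge0 ?(ltW h0)// ltW.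
  have shr (x z : 'cV[R]_d) : P x -> (forall i, `|z i 0| <= h * B) -> P (p + u *: (x - p) + z).
    move=> Px zb; have [kh0|kh0] := eqVneq (k * h) 0.
      have z0 : z = 0.
        apply/colP => i; rewrite [RHS]mxE; apply/eqP; rewrite -normr_le0.
        by rewrite (le_trans (zb i))// -kr kh0 mul0r.
      by rewrite z0 addr0 /u kh0 subr0 scale1r addrC subrK.
    apply: (convex_shrink_nbhs vP pr) => //; last by move=> i; rewrite kr.
    by case/andP: u1 => h1 ->; rewrite lt_neqAle eq_sym kh0 h1.
  have Hl := integral_content HL.
  have Pbd : bounded_cV P by exists M.
  have bl (t : R) : 0 < t -> bounded_cV (linear_image t%:M P).
    move=> t0; apply: bounded_linear_image => //.
    by rewrite unitmxE det_scalar unitfE expf_neq0// gt_eqF.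
  have hBE (s a : R) : 1 <= s -> s < 1 + h -> `|a| <= B -> `|(s - 1) * a| <= h * B.
    by move=> s1 sh aB; rewrite normrM ler_pM// ger0_norm; lra.
  split.
  (* The translation turns scaling about the origin into scaling about [p], because 1 - u = k h;
     likewise for k h / u in the other inequality. *)
  - rewrite -(ler_pM2l h0) -slabE -/u -(prism_scaled (- (k * h) *: p) HLd h0 u0).
    apply: (content_le Hl) => // x [/=]; rewrite /linear_image /= invmx_scalar mul_scalar_mx.
    set y := u^-1 *: _ => Py /andP[s1 sh]; split => //=; last by rewrite s1.
    set s := last_coord x in s1 sh *.
    have s0 : 0 < s by lra.
    split; first exact: ltW.
    have xE : usubmx x = p + u *: (y - p).
      rewrite scalerBr /y scalerA mulfV ?gt_eqF// scale1r.
      by apply/colP => i; rewrite !mxE /u; ring.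
    have Px : P (usubmx x).
      rewrite xE -[_ + _]addr0; by apply: shr => // i; rewrite mxE normr0 mulr_ge0// ltW.
    exists (s^-1 *: usubmx x); last by rewrite scalerA mulfV ?gt_eqF// scale1r.
    have -> : s^-1 *: usubmx x = p + u *: (y - p) + (s^-1 - 1) *: usubmx x.
      by rewrite -xE scalerBl scale1r addrC subrK.
    apply: shr => // i; rewrite mxE normrM ler_pM//; last exact: PM.
    have : s^-1 <= 1 by rewrite invf_le1.
    have : s * s^-1 = 1 by rewrite mulfV// gt_eqF.
    move: (s^-1) => t st t1; rewrite ler0_norm; nra.
  - have ui0 : 0 < u^-1 by rewrite invr_gt0.
    have -> : VP = u ^+ d * (u^-1 ^+ d * VP).
      by rewrite mulrA -exprMn mulfV ?expr1n ?mul1r// gt_eqF.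
    rewrite -/u ler_pM2l ?exprn_gt0// -(ler_pM2l h0) -slabE.
    rewrite -(prism_scaled ((k * h / u) *: p) HLd h0 ui0).
    apply: (content_le Hl); last first.
      by apply: bounded_prism; apply: bounded_cV_shift; exact: bl.
    move=> x [[_ [a Pa xE]] /andP[s1 sh]]; split; last by rewrite s1.
    rewrite /= /linear_image /= invmx_scalar invrK mul_scalar_mx xE.
    set s := last_coord x in s1 sh *.
    have -> : u *: (s *: a + (k * h / u) *: p) = p + u *: (a - p) + u *: ((s - 1) *: a).
      apply/colP => i; rewrite !mxE.
      have : u * (k * h / u) = 1 - u by rewrite mulrC divfK ?gt_eqF// /u; lra.
      by move=> uE; rewrite mulrDr [u * (_ * p i 0)]mulrA uE; ring.
    apply: shr => // i; rewrite !mxE normrM gtr0_norm//.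
    rewrite (le_trans (y := `|(s - 1) * a i 0|))//; last by apply: hBE => //; exact: PM.
    by rewrite ler_piMl// /u; case/andP: u1; lra.
(* Makes k h < 1 hold for every h = h0/(K+1). *)
pose h0 : R := (1 + k)^-1; have h00 : 0 < h0 by rewrite invr_gt0 ltr_pwDl.
have kh0 : k * h0 < 1 by rewrite ltr_pdivrMr ?ltr_pwDl//; lra.
have keyK (K : nat) : 0 < h0 * K.+1%:R^-1 /\ k * (h0 * K.+1%:R^-1) < 1.
  have K0 : 0 < K.+1%:R^-1 :> R by rewrite invr_gt0.
  split; first by rewrite mulr_gt0.
  rewrite mulrA (le_lt_trans _ kh0)// ler_piMr ?(mulr_ge0 k0 (ltW h00))//.
  by rewrite invf_le1// ler1n.
pose S : {poly R} := \sum_(i < d + 1) (1 + h0 *: 'X) ^+ i.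
have SE t : S.[t] = \sum_(i < d + 1) (1 + h0 * t) ^+ i.
  by rewrite horner_sum; apply: eq_bigr => i _; rewrite !hornerE.
have S0 : S.[0] = (d + 1)%:R.
  rewrite SE (eq_bigr (fun=> 1)) => [|i _]; last by rewrite mulr0 addr0 expr1n.
  by rewrite sumr_const card_ord.
pose Q : {poly R} := (1 - (k * h0) *: 'X) ^+ d.
have QE t : Q.[t] = (1 - k * (h0 * t)) ^+ d by rewrite !hornerE; congr (_ ^+ d); ring.
have Q0 : Q.[0] = 1 by rewrite QE !mulr0 subr0 expr1n.
clearbody S Q.
apply/eqP; rewrite eq_le; apply/andP; split.
  have : 0 <= (S * W%:P - Q * VP%:P).[0].
    apply: le_horner0 => K; have [h1 h2] := keyK K.
    by rewrite !hornerE SE QE subr_ge0; case: (key _ h1 h2).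
  by rewrite !hornerE S0 Q0 mul1r subr_ge0.
have : 0 <= (VP%:P - Q * (S * W%:P)).[0].
  apply: le_horner0 => K; have [h1 h2] := keyK K.
  by rewrite !hornerE SE QE subr_ge0; have [_] := key _ h1 h2; rewrite ?mulrA.
by rewrite hornerD hornerN !hornerM !hornerC S0 Q0 mul1r subr_ge0.
Qed.

End Pyramid.

(** * Stieltjes integrals determined by step bounds *)

Section PartitionArgument.
Variables (R : realType) (c : R) (n : nat).
Hypothesis c0 : 0 < c.

Let step_bounds (V : R) (f : R -> R) := forall a b, 0 <= a -> a <= b ->
  expR (- (c * b)) * (b ^+ n - a ^+ n) * V <= f b - f a
    <= expR (- (c * a)) * (b ^+ n - a ^+ n) * V.

(** Both f and g act as primitives of exp(- c t) d(V t^n). On a step [a, b] their increments differ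
    by at most V c (b - a) (b^n - a^n); over K+1 equal steps this telescopes to a quantity of order
    1/(K+1). *)
Lemma step_bounds_unique (V : R) (f g : R -> R) (T : R) : 0 <= V -> 0 <= T ->
  step_bounds V f -> step_bounds V g -> f T - f 0 = g T - g 0.
Proof.
move=> V0 T0 hf hg.
have pw (a b : R) : 0 <= a -> a <= b -> 0 <= b ^+ n - a ^+ n.
  by move=> a0 ab; rewrite subr_ge0 lerXn2r// nnegrE (le_trans a0).
have step a b : 0 <= a -> a <= b ->
    `|(f b - f a) - (g b - g a)| <= V * c * (b - a) * (b ^+ n - a ^+ n).
  move=> a0 ab; have /andP[f1 f2] := hf a b a0 ab; have /andP[g1 g2] := hg a b a0 ab.
  have := pw a b a0 ab; set D := _ - _ in f1 f2 g1 g2 * => D0.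
  have h : expR (- (c * a)) - expR (- (c * b)) <= c * (b - a).
    have -> : expR (- (c * b)) = expR (- (c * a)) * expR (- (c * (b - a))).
      by rewrite -expRD; congr expR; ring.
    rewrite -{1}[expR (- (c * a))]mulr1 -mulrBr.
    have e1 := expR_ge1Dx (- (c * (b - a))).
    have ea : 0 <= expR (- (c * a)) <= 1.
      by rewrite expR_ge0 expR_le1 oppr_le0 mulr_ge0// ltW.
    have cb : 0 <= c * (b - a) by rewrite mulr_ge0 ?subr_ge0// ltW.
    case/andP: ea => e2 e3.
    apply: (@le_trans _ _ (expR (- (c * a)) * (c * (b - a)))).
      by rewrite ler_wpM2l//; lra.
    by rewrite ler_piMl.
  have DV : 0 <= D * V by rewrite mulr_ge0.
  apply: (@le_trans _ _ ((expR (- (c * a)) - expR (- (c * b))) * (D * V))).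
    by rewrite ler_norml mulrBl; apply/andP; split; lra.
  have -> : V * c * (b - a) * D = c * (b - a) * (D * V) by ring.
  by rewrite ler_wpM2r.
apply/eqP; rewrite -subr_eq0 -normr_le0.
pose p : {poly R} := (V * c * T * (T ^+ n - 0 ^+ n)) *: 'X.
have -> : 0 = p.[0] by rewrite !hornerE.
apply: le_horner0 => K; rewrite !hornerE.
pose a (k : nat) := k%:R * (T * K.+1%:R^-1).
have h0 : 0 <= T * K.+1%:R^-1 by rewrite mulr_ge0// invr_ge0.
have aT : a K.+1 = T by rewrite /a mulrCA mulfV ?mulr1// pnatr_eq0.
have a0 : a 0%N = 0 by rewrite /a mul0r.
have -> : f T - f 0 - (g T - g 0) =
    \sum_(0 <= k < K.+1) ((f (a k.+1) - f (a k)) - (g (a k.+1) - g (a k))).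
  rewrite sumrB (telescope_sumr (fun k => f (a k)))// (telescope_sumr (fun k => g (a k)))//.
  by rewrite aT a0.
apply: (le_trans (ler_norm_sum _ _ _)).
have -> : V * c * T * (T ^+ n - 0 ^+ n) / K.+1%:R =
    \sum_(0 <= k < K.+1) V * c * (T * K.+1%:R^-1) * (a k.+1 ^+ n - a k ^+ n).
  rewrite -mulr_sumr (telescope_sumr (fun k => a k ^+ n))// aT a0; ring.
apply: ler_sum => k _; have ak : a k.+1 - a k = T * K.+1%:R^-1.
  by rewrite /a -mulrBl -natr1; ring.
rewrite -ak; apply: step; first by rewrite mulr_ge0.
by rewrite -subr_ge0 ak.
Qed.

End PartitionArgument.

(** * Exponential integrals over the cone of the polytope *)

Section PyramidIntegral.
Variables (R : realType) (d n : nat) (V : 'M[R]_(d, n)).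
Hypothesis aV : affine_hull V = setT.
Variable L : ('cV[R]_(d + 1) -> R) -> R.
Hypothesis HL : is_integral L.
Implicit Types (x y : 'cV[R]_(d + 1)).

Let W := L \1_(pyramid V 1).

Let W0 : 0 <= W.
Proof. by have [l0 _ _ _] := integral_content HL; apply/l0/bounded_pyramid. Qed.

Lemma chi_heightE (c : R) x : chi (c *: @height_row R d) x = expR (- (c * last_coord x)).
Proof. by rewrite /chi -scalemxAl mxE height_rowE. Qed.

(** As functions of T both sides satisfy the same step bounds: on a layer between two heights the
    weight lies between its values at the ends, and the volume of the layer is known. *)
Lemma integral_exp_pyramid (c T : R) : 0 < c -> 0 <= T ->
  L (fun x => chi (c *: @height_row R d) x * \1_(pyramid V T) x) =
  (d + 1)%:R * (gamma_prim c d T - gamma_prim c d 0) * W.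
Proof.
move=> c0 T0.
pose E := chi (c *: @height_row R d).
pose f T := L (fun x => E x * \1_(pyramid V T) x).
pose g T := (d + 1)%:R * gamma_prim c d T * W.
have bp S := bounded_support_indic (bounded_pyramid aV S).
have f0 : f 0 = 0.
  apply: (negligible_height (t := 0) HL); first exact: bounded_support_chi.
  move=> x x0; rewrite indicE memNset ?mulr0// => -[[h1 _] h2]; apply: x0.
  by apply/eqP; rewrite eq_le h1 h2.
have fE : f T = f T - f 0 by rewrite f0 subr0.
rewrite -/E -/(f T) fE.
have -> : (d + 1)%:R * (gamma_prim c d T - gamma_prim c d 0) * W = g T - g 0.
  by rewrite /g; ring.
apply: (@step_bounds_unique R c (d + 1) c0 W) => //.
- move=> a b ha ab; rewrite -!mulrA -!(integral_pyramid_diff aV HL ha ab).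
  have bd : bounded_support (fun x => \1_(pyramid V b) x - \1_(pyramid V a) x).
    exact: bounded_supportB.
  have -> : f b - f a = L (fun x => E x * (\1_(pyramid V b) x - \1_(pyramid V a) x)).
    rewrite -(integralB HL); [|exact: bounded_support_chi..].
    by congr L; apply/funext => x; rewrite mulrBr.
  rewrite -!(integralZ HL)//.
  have pw x : 0 <= \1_(pyramid V b) x - \1_(pyramid V a) x :> R /\
      (\1_(pyramid V b) x - \1_(pyramid V a) x != 0 :> R -> a <= last_coord x <= b).
    rewrite !indicE; have [Cx|nC] := pselect (cone_over (conv_hull V) x); last first.
      by rewrite !memNset ?subrr ?eqxx// => -[].
    have M S : (x \in pyramid V S) = (last_coord x <= S).
      by apply/idP/idP => [/set_mem[]|xS]//; apply/mem_set.
    rewrite !M; case: (leP (last_coord x) a) => la.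
      have -> : last_coord x <= b by exact: le_trans ab.
      by rewrite subrr eqxx.
    rewrite subr0; split => //; rewrite pnatr_eq0 eqb0 negbK => ->.
    by rewrite (ltW la).
  apply/andP; split; apply: (integral_le HL);
    try exact: bounded_supportZ; try exact: bounded_support_chi;
    move=> x; have [p0 pab] := pw x; move: p0 pab; set D := _ - _ => D0;
    have [->|Dn] := eqVneq D 0; rewrite ?mulr0// => /(_ isT)/andP[l1 l2];
    by rewrite ler_wpM2r// /E chi_heightE ler_expR lerN2 ler_pM2l.
- move=> a b ha ab.
  have /andP[g1 g2] := gamma_prim_bounds c0 d ha ab.
  have -> : g b - g a = (d + 1)%:R * (gamma_prim c d b - gamma_prim c d a) * W.
    by rewrite /g; ring.
  by rewrite !addn1 !ler_wpM2r.
Qed.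

Lemma cvg_exp_pyramid (c : R) : 0 < c ->
  L (fun x => chi (c *: @height_row R d) x * \1_(pyramid V m.+1%:R) x) @[m --> \oo]
  --> d`!%:R / c ^+ (d + 1) * ((d + 1)%:R * W).
Proof.
move=> c0; under eq_fun do rewrite integral_exp_pyramid//.
have -> : d`!%:R / c ^+ (d + 1) * ((d + 1)%:R * W) =
    (d + 1)%:R * (0 - gamma_prim c d 0) * W.
  by rewrite gamma_prim0// addn1; ring.
apply: cvgM; last exact: cvg_cst.
apply: cvgM; first exact: cvg_cst.
apply: cvgB; [exact: cvg_gamma_prim|exact: cvg_cst].
Qed.

(** On the cone <xi, x> lies between (1 - e) and (1 + e) times the height, so truncated integrals
    compare with those of a pure function of the height; then pass to the limit. *)
Lemma exp_integral_cone_over (xi : 'rV[R]_(d + 1)) (e t : R) : 0 <= e -> e < 1 ->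
  (forall x, cone_over (conv_hull V) x ->
    `|(xi *m x) 0 0 - last_coord x| <= e * last_coord x) ->
  exp_integral L xi \1_(cone_over (conv_hull V)) t ->
  d`!%:R / (1 + e) ^+ (d + 1) * ((d + 1)%:R * W) <= t
    <= d`!%:R / (1 - e) ^+ (d + 1) * ((d + 1)%:R * W).
Proof.
move=> e0 e1 xie It.
set C := cone_over (conv_hull V).
have [M VM] := @bounded_conv_hull R d n V.
have ce : 0 < 1 - e by lra.
have g01 x : 0 <= (\1_C x : R) <= 1 by rewrite indicE; case: (_ \in _); rewrite ?lexx ?ler01.
have lE x : (@height_row R d *m x) 0 0 = last_coord x by exact: height_rowE.
have B0 : 0 <= M%:R + 1 :> R by [].
have xb x : C x -> (1 - e) * last_coord x <= (xi *m x) 0 0 <= (1 + e) * last_coord x.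
  by move=> /xie; rewrite ler_norml => /andP[h1 h2]; apply/andP; split; lra.
have gsupp x : \1_C x != 0 :> R -> [/\ 0 <= (@height_row R d *m x) 0 0,
    forall i, `|x i 0| <= (M%:R + 1) * (@height_row R d *m x) 0 0 &
    (1 - e) * (@height_row R d *m x) 0 0 <= (xi *m x) 0 0].
  rewrite indicE pnatr_eq0 eqb0 negbK => /set_mem Cx; rewrite lE.
  have /andP[h1 _] := xb x Cx; case: (Cx) => s0 [p Pp xE]; split => //.
  apply/(forall_coord (fun u => `|u| <= _)); split.
    move=> i; rewrite xE mxE normrM ger0_norm// mulrC ler_wpM2r//.
    by rewrite (le_trans (VM p Pp i))// lerDl.
  by rewrite ger0_norm// ler_peMl// lerDr.
have := exp_integral_cvg HL B0 ce g01 gsupp It.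
have tE T x : truncated (@height_row R d) \1_C T x = \1_(pyramid V T) x.
  rewrite /truncated lE !indicE -natrM mulnb; congr ((_ : bool)%:R).
  by apply/andP/idP => [[/set_mem ? ?]|/set_mem[? ?]]; [apply/mem_set|split => //; apply/mem_set].
under eq_fun => m do under eq_fun do rewrite tE.
move=> cv.
have bp S := bounded_support_indic (bounded_pyramid aV S).
have cmp (c1 c2 : 'rV[R]_(d + 1)) (S : R) :
    (forall x, C x -> (c2 *m x) 0 0 <= (c1 *m x) 0 0) ->
    L (fun x => chi c1 x * \1_(pyramid V S) x) <= L (fun x => chi c2 x * \1_(pyramid V S) x).
  move=> c12; apply: (integral_le HL); [exact: bounded_support_chi..|] => x.
  rewrite indicE; case: (boolP (x \in _)) => [/set_mem[/c12 h _]|_]; last by rewrite !mulr0.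
  by rewrite !mulr1 ler_expR lerN2.
apply/andP; split.
  have c0 : 0 < 1 + e by lra.
  apply: (ler_cvg_to (cvg_exp_pyramid c0) cv); apply: nearW => m.
  by apply: cmp => x /xb/andP[_]; rewrite -scalemxAl [X in _ -> _ <= X]mxE lE.
apply: (ler_cvg_to cv (cvg_exp_pyramid ce)); apply: nearW => m.
by apply: cmp => x /xb/andP[+ _]; rewrite -scalemxAl [X in _ -> X <= _]mxE lE.
Qed.

End PyramidIntegral.

(** * From lattice points to almost every point *)

Section LocallyConstant.
Variables (R : realType).

Definition locally_constant n (S : set 'cV[R]_n) (x : 'cV[R]_n) := exists2 e : R, 0 < e &
  forall y : 'cV[R]_n, (forall i, `|y i 0 - x i 0| <= e) -> (S y <-> S x).

Lemma locally_constant_simplicial_cone n (G : 'M[R]_n) (x : 'cV[R]_n) :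
  (forall i, (invmx G *m x) i 0 != 0) -> locally_constant (simplicial_cone G) x.
Proof.
move=> k0; pose k i := `|(invmx G *m x) i 0|.
have kp i : 0 < k i by rewrite normr_gt0.
pose C := \sum_i \sum_j `|invmx G i j|.
have C0 : 0 <= C by rewrite sumr_ge0// => i _; rewrite sumr_ge0.
have S0 : 0 <= \sum_i (k i)^-1 by rewrite sumr_ge0// => i _; rewrite invr_ge0 ltW.
(* A positive number below every [k i], valid also for an empty index set. *)
pose m := (1 + \sum_i (k i)^-1)^-1.
have m0 : 0 < m by rewrite invr_gt0 ltr_pwDl.
have mk i : m < k i.
  rewrite /m -[ltRHS]invrK ltf_pV2 ?posrE ?invr_gt0 ?ltr_pwDl//.
  rewrite (bigD1 i)//= lerDl sumr_ge0// => j _.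
  by rewrite invr_ge0 ltW.
exists (m / (1 + C)); first by rewrite divr_gt0// ltr_pwDl.
move=> y yx.
have close i : `|(invmx G *m y) i 0 - (invmx G *m x) i 0| < k i.
  apply: le_lt_trans (mk i).
  have -> : (invmx G *m y) i 0 - (invmx G *m x) i 0 = (invmx G *m (y - x)) i 0.
    by rewrite mulmxBr [RHS]mxE; congr (_ + _); rewrite [RHS]mxE.
  apply: (le_trans (@mulmx_bound _ _ _ _ (m / (1 + C)) _ _ _ _)).
  - by move=> j; have := yx j; rewrite !mxE.
  - by rewrite divr_ge0 ?addr_ge0// ltW.
  - by rewrite -/C mulrCA ler_piMr ?(ltW m0)// ler_pdivrMr ?ltr_pwDl// mul1r lerDr.
have sgn i : (0 <= (invmx G *m y) i 0) = (0 <= (invmx G *m x) i 0).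
  have := close i; rewrite /k ltr_norml; have := k0 i.
  case: (ltgtP ((invmx G *m x) i 0) 0) => // h _.
    by rewrite ltr0_norm// => /andP[h1 h2]; apply/negbTE; rewrite -ltNge; lra.
  by rewrite gtr0_norm// => /andP[h1 h2]; lra.
by split => h i; have := h i; rewrite sgn.
Qed.

Lemma negligible_simplicial_cone n (L : ('cV[R]_n -> R) -> R) (G : 'M[R]_n) :
  is_integral L -> G \in unitmx ->
  negligible L [set x | ~ locally_constant (simplicial_cone G) x].
Proof.
move=> HL uG.
apply: (@negligible_sub _ _ _ _ [set x | exists2 i, i \in enum 'I_n & (invmx G *m x) i 0 = 0]).
  move=> x nl; apply: contrapT => h; apply: nl; apply: locally_constant_simplicial_cone => i.
  by apply: contra_notN h => /eqP h; exists i => //; rewrite mem_enum.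
apply: (negligible_bigU HL (F := fun i => [set x | (invmx G *m x) i 0 = 0])) => i _.
(* The sum of the generators raises every coordinate, hence is transversal to every facet
   hyperplane. *)
apply: (negligible_transversal HL (u := G *m const_mx 1)) => x t t0 /= x0.
rewrite mulmxDr -scalemxAr mulKmx// mxE x0 !mxE add0r mulr1.
by move/eqP; rewrite gt_eqF.
Qed.

End LocallyConstant.

Section ConeOver.
Variables (R : realType) (d n : nat) (V : 'M[R]_(d, n)).
Hypothesis aV : affine_hull V = setT.
Let P := conv_hull V.
Let C := cone_over P.
Implicit Types (x y : 'cV[R]_(d + 1)).

Lemma cone_overD x y : C x -> C y -> C (x + y).
Proof.
move=> [sx [p Pp xE]] [sy [q Pq yE]].
have s0 : 0 <= last_coord (x + y) by rewrite last_coordD addr_ge0.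
split => //; have [s00|sN] := eqVneq (last_coord x + last_coord y) 0.
  have [sx0 sy0] : last_coord x = 0 /\ last_coord y = 0 by split; lra.
  by exists p => //; rewrite usubmxD xE yE last_coordD sx0 sy0 addr0 !scale0r addr0.
have sp : 0 < last_coord x + last_coord y by rewrite lt_neqAle eq_sym sN addr_ge0.
pose t := last_coord x / (last_coord x + last_coord y).
exists (t *: p + (1 - t) *: q).
  apply: convex_conv_hull => //; rewrite divr_ge0 ?addr_ge0//=.
  by rewrite ler_pdivrMr// mul1r lerDl.
rewrite usubmxD xE yE last_coordD scalerDr !scalerA; congr (_ *: _ + _ *: _).
  by rewrite /t mulrC divfK.
by rewrite mulrBr mulr1 /t [_ * (_ / _)]mulrC divfK// addrC addKr.
Qed.

(** The point t (p, 1) is interior to the cone: [e] keeps the height at least t/2 and the horizontal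
    deviation at most r times the height. *)
Lemma cone_over_ball p r (t : R) : contains_ball P p r -> 0 < t ->
  exists2 e : R, 0 < e & forall z : 'cV[R]_(d + 1), (forall i, `|z i 0| <= e) ->
    C (t *: col_mx p 1%:M + z).
Proof.
move=> [r0 pr] t0; pose B := \sum_i `|p i 0|; have B0 : 0 <= B by exact: sumr_ge0.
have pB i : `|p i 0| <= B by rewrite /B (bigD1 i)//= lerDl sumr_ge0.
pose e := Num.min (t / 2) (r * (t / 2) / (1 + B)).
have t2 : 0 < t / 2 by rewrite divr_gt0.
have e0 : 0 < e by rewrite lt_min t2 divr_gt0 ?mulr_gt0// ltr_pwDl.
exists e => // z ze.
set w := _ + z; pose zs := last_coord z.
have wl : last_coord w = t + zs.
  by rewrite last_coordD last_coordZ last_coord_col mxE eqxx mulr1.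
have [zu zse] : (forall i, `|usubmx z i 0| <= e) /\ `|zs| <= e.
  exact/(forall_coord (fun u => `|u| <= e)).
have ws : t / 2 <= t + zs.
  have : e <= t / 2 by rewrite ge_min lexx.
  by move: zse; rewrite ler_norml => /andP[h1 h2] h3; lra.
have w0 : 0 < t + zs by lra.
split; first by rewrite wl ltW.
exists ((t + zs)^-1 *: usubmx w); last by rewrite wl scalerA mulfV ?gt_eqF// scale1r.
apply: pr => i.
have -> : ((t + zs)^-1 *: usubmx w) i 0 - p i 0 =
    (t + zs)^-1 * (usubmx z i 0 - zs * p i 0).
  rewrite usubmxD usubmxZ col_mxKu !mxE; field; exact: lt0r_neq0.
rewrite normrM gtr0_norm ?invr_gt0// ler_pdivrMl//.
apply: (@le_trans _ _ (e * (1 + B))).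
  rewrite (le_trans (ler_normB _ _))// mulrDr mulr1 lerD// normrM.
  by rewrite ler_pM.
apply: (@le_trans _ _ (r * (t / 2))); last by rewrite mulrC ler_pM2r.
by rewrite -ler_pdivlMr ?ltr_pwDl// /e ge_min lexx orbT.
Qed.

(** Near x the cone may be cut above height |last_coord x| + 1, and the resulting pyramid is
    compact, hence closed. *)
Lemma cone_over_closed x : ~ C x -> locally_constant C x.
Proof.
move=> nC; pose T := `|last_coord x| + 1.
have T0 : 0 < T by rewrite ltr_pwDr.
have uT : T%:M \in @unitmx R (d + 1).
  by rewrite unitmxE det_scalar unitfE expf_neq0// gt_eqF.
have cp : closed (pyramid V T).
  apply: compact_closed; first exact: norm_hausdorff.
  rewrite pyramidE//.
  by case: (convex_body_linear_image uT (convex_body_pyramid1 aV)).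
have /nbhs_ballP[e /= e0 eb] : nbhs x (~` pyramid V T).
  apply: open_nbhs_nbhs; split; first exact: closed_openC.
  by move=> [].
exists (Num.min (e / 2) 1); first by rewrite lt_min divr_gt0//= ltr01.
move=> y yx; split => // Cy; exfalso.
apply: (eb y).
  split => // i j; rewrite [j]ord1 /ball /= distrC.
  apply: (le_lt_trans (yx i)); rewrite gt_min; apply/orP; left; lra.
have yx' i : `|(y - x) i 0| <= Num.min (e / 2) 1 by have := yx i; rewrite !mxE.
split => //; have [_ l1] := (forall_coord (fun u => `|u| <= Num.min (e / 2) 1) (y - x)).1 yx'.
have : `|last_coord y - last_coord x| <= 1.
  by rewrite -last_coordB (le_trans l1)// ge_min lexx orbT.
rewrite ler_norml => /andP[_ h]; have := ler_norm (last_coord x); rewrite /T; lra.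
Qed.

(** An exceptional point belongs to the cone, and any positive move along the interior direction (p,
    1) leads to an interior point, which is not exceptional. *)
Lemma negligible_cone_over (L : ('cV[R]_(d + 1) -> R) -> R) : is_integral L ->
  negligible L [set x | ~ locally_constant C x].
Proof.
move=> HL; have [p [r pr]] := conv_hull_ball aV.
apply: (negligible_transversal HL (u := col_mx p 1%:M)) => x t t0 /= nl.
have Cx : C x by apply: contrapT => /cone_over_closed.
apply; have [e e0 eC] := cone_over_ball pr t0.
have Cxt : C (x + t *: col_mx p 1%:M).
  apply: cone_overD => //; rewrite -[_ *: _]addr0; apply: eC => i.
  by rewrite mxE normr0 ltW.
exists e => // y ye; split => // _.
have -> : y = x + (t *: col_mx p 1%:M + (y - (x + t *: col_mx p 1%:M))).
  by rewrite addrA addrC subrK.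
apply: cone_overD => //; apply: eC => i; have := ye i.
by move: (x + _) => w; rewrite !mxE.
Qed.

End ConeOver.

Section Lattice.
Variable R : realType.

(* Points of the moment curve avoid finitely many hyperplanes. *)
Lemma int_vector_avoiding m (ws : seq 'rV[R]_m) : all (fun w => w != 0) ws ->
  exists u : 'cV[int]_m, forall w, w \in ws -> (w *m map_mx intr u) 0 0 != 0.
Proof.
move=> ws0; pose pw (w : 'rV[R]_m) : {poly R} := \sum_(k < m) w 0 k *: 'X^k.
have pw0 w : w != 0 -> pw w != 0.
  apply: contraNN => /eqP p0; apply/eqP/rowP => k.
  have := congr1 (fun p : {poly R} => p`_k) p0.
  rewrite coef0 coef_sum (bigD1 k)//= big1 => [|j jk].
    by rewrite addr0 coefZ coefXn eqxx mulr1 mxE.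
  by rewrite coefZ coefXn eq_sym -val_eqE/= in jk *; rewrite (negPf jk) mulr0.
pose p : {poly R} := \prod_(w <- ws) pw w.
have p0 : p != 0.
  by rewrite prodf_seq_neq0; apply/allP => w /(allP ws0); exact: pw0.
have [a pa] : exists a : nat, ~~ root p a%:R.
  apply: contrapT => /forallNP h.
  have : all (root p) [seq k%:R | k <- iota 0 (size p)].
    by apply/allP => _ /mapP[k _ ->]; apply: contrapT => /negP; exact: h.
  move=> /(max_poly_roots p0); rewrite size_map size_iota ltnn => H.
  suff : false by []; apply: H; rewrite map_inj_uniq ?iota_uniq// => i j.
  by move/eqP; rewrite eqr_nat => /eqP.
exists (\col_k (a ^ k)%:Z) => w wws; apply: contraNneq pa => w0.
rewrite /root /p horner_prod prodf_seq_eq0; apply/hasP; exists w => //=.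
rewrite -w0 horner_sum mxE; apply/eqP; apply: eq_bigr => k _.
by rewrite !hornerE !mxE -pmulrn natrX.
Qed.

End Lattice.

Section ConeData.
Variables (R : realType) (d : nat).
Implicit Types K : pointed_simplicial_cone R (d + 1).

Definition cone_poly (beta : 'cV[int]_d) (G : 'M[R]_(d + 1)) : {poly R} :=
  \prod_j ((dsubmx G 0 j)%:P - ((map_mx intr beta)^T *m usubmx G) 0 j *: 'X).

(** Removes the cast from [Vol] by passing to a square generator matrix. *)
Lemma full_dim_cone K : ngens K = (d + 1)%N -> exists G : 'M[R]_(d + 1),
  [/\ G \in unitmx,
      cone_set K = [set x | simplicial_cone G (x - apex K)],
      forall beta, Vol beta K = `|\det G| * CT_inv (cone_poly beta G) &
      forall beta, admissible beta K -> forall j,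
        ~ (((map_mx intr beta)^T *m usubmx G) 0 j = 0 /\ dsubmx G 0 j = 0)].
Proof.
case: K => v m G Gf /= mE; subst m; exists G.
have uG : G \in unitmx by rewrite -unitmx_tr -row_free_unit.
split => //.
- apply/seteqP; split => x; rewrite /cone_set /simplicial_cone /=.
    by move=> [k [k0 ->]] i; rewrite addrC addKr mulKmx.
  move=> h; exists (invmx G *m (x - v)); split => //.
  by rewrite mulKVmx// addrC subrK.
- by move=> beta; rewrite /Vol /=; case: eqP => // h; rewrite castmx_id.
Qed.

Lemma low_dim_cone K : (ngens K < d + 1)%N ->
  exists2 w : 'rV[R]_(d + 1), w != 0 & forall x, cone_set K x -> w *m x = w *m apex K.
Proof.
move=> mK; have : kermx (gens K) != 0.
  by rewrite kermx_eq0 /row_free neq_ltn (leq_ltn_trans (rank_leq_col _) mK).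
move=> /rowV0Pn[w /sub_kermxP wK w0]; exists w => // x [k [_ ->]].
by rewrite mulmxDr mulmxA wK mul0mx addr0.
Qed.

Lemma simplicial_cone_scale n (G : 'M[R]_n) (t : R) (x : 'cV[R]_n) : 0 < t ->
  simplicial_cone G (t *: x) <-> simplicial_cone G x.
Proof.
move=> t0; have E i : (invmx G *m (t *: x)) i 0 = t * (invmx G *m x) i 0.
  by rewrite -scalemxAr [LHS]mxE.
by split => h i; have := h i; rewrite E pmulr_rge0.
Qed.

Lemma eq_indic m (A B : set 'cV[R]_m) (x y : 'cV[R]_m) :
  (A x <-> B y) -> \1_A x = \1_B y :> R.
Proof.
move=> h; rewrite !indicE; have [/h By|nA] := pselect (A x).
  by rewrite !mem_set//; exact/h.
by rewrite !memNset// => /h.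
Qed.

Lemma sigma_indic m (S : set 'cV[R]_m) (a : 'cV[int]_m) :
  (sigma S a)%:~R = \1_S (map_mx intr a) :> R.
Proof.
rewrite /sigma indicE; case: asboolP => h; first by rewrite mem_set.
by rewrite memNset.
Qed.

End ConeData.

Section Decomposition.
Variables (R : realType) (d n : nat) (V : 'M[R]_(d, n)).
Hypothesis aV : affine_hull V = setT.
Variables (N : nat) (s : 'I_N -> int) (K : 'I_N -> pointed_simplicial_cone R (d + 1)).
Hypothesis hK : signed_simplicial_cone_decomposition (conv_hull V) s K.
Hypothesis hdim : forall i : 'I_N, (ngens (K i) <= d + 1)%N.
Variable G : 'I_N -> 'M[R]_(d + 1).
Let full i := ngens (K i) == (d + 1)%N.
Hypothesis hG : forall i, full i ->
  cone_set (K i) = [set x | simplicial_cone (G i) (x - apex (K i))].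
Let C := cone_over (conv_hull V).
Implicit Types (x y : 'cV[R]_(d + 1)).

(* At a point of local constancy the indicators at x agree with those at a
   lattice point near t x, t large; the lattice point is chosen off the
   lower-dimensional cones. *)
Lemma decomposition_locally_constant x : locally_constant C x ->
  (forall i, full i -> locally_constant (simplicial_cone (G i)) x) ->
  \1_C x = \sum_(i < N | full i) (s i)%:~R * \1_(simplicial_cone (G i)) x :> R.
Proof.
move=> [eC eC0 hC] lc.
have /choice[w wP] : forall i, exists w : 'rV[R]_(d + 1),
    w != 0 /\ (~~ full i -> forall y, cone_set (K i) y -> w *m y = w *m apex (K i)).
  move=> i; case: (boolP (full i)) => fi.
    (* A dummy nonzero vector for the full-dimensional cones, which keeps [w] total. *)
    exists (const_mx 1); split => //; apply/eqP => /rowP/(_ (rshift d 0)).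
    by rewrite !mxE => /eqP; rewrite oner_eq0.
  have [|w w0 wK] := @low_dim_cone _ _ (K i); last by exists w.
  by rewrite ltn_neqAle hdim andbT.
have [u uP] : exists u : 'cV[int]_(d + 1), forall i, (w i *m map_mx intr u) 0 0 != 0.
  have [|u uw] := @int_vector_avoiding R _ [seq w i | i <- enum 'I_N].
    by apply/allP => _ /mapP[i _ ->]; case: (wP i).
  by exists u => i; apply: uw; apply/mapP; exists i; rewrite ?mem_enum.
have /choice[e0 e0P] : forall i, exists e : R, 0 < e /\ (full i ->
    forall y, (forall k, `|y k 0 - x k 0| <= e) ->
      (simplicial_cone (G i) y <-> simplicial_cone (G i) x)).
  move=> i; case: (boolP (full i)) => fi; last by exists 1.
  by have [e e0 he] := lc i fi; exists e.
pose e := (eC^-1 + \sum_i (e0 i)^-1)^-1.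
have e0i i : 0 <= (e0 i)^-1 by rewrite invr_ge0 ltW//; case: (e0P i).
have eD : 0 < eC^-1 + \sum_i (e0 i)^-1 by rewrite ltr_pwDl ?invr_gt0// sumr_ge0.
have e_gt0 : 0 < e by rewrite invr_gt0.
have eeC : e <= eC.
  by rewrite /e -[leRHS]invrK lef_pV2 ?posrE ?invr_gt0// lerDl sumr_ge0.
have ee0 i : e <= e0 i.
  have [p _] := e0P i; rewrite /e -[leRHS]invrK lef_pV2 ?posrE ?invr_gt0//.
  rewrite (bigD1 i)//= addrCA lerDl addr_ge0 ?invr_ge0 ?(ltW eC0)//.
  exact: sumr_ge0.
(* Bounds the distance to t x: 1 for rounding, N steps along [u], and the shift by an apex. Then [t]
   is taken with rho / t <= e. *)
pose rho := 1 + N%:R * (\sum_k `|(u k 0)%:~R|) + \sum_i \sum_k `|apex (K i) k 0|.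
pose t : R := (Num.truncn (rho / e)).+1%:R.
have t0 : 0 < t by [].
have rt : rho / t <= e.
  by rewrite ler_pdivrMr// mulrC -ler_pdivrMr// ltW// truncnS_gt.
pose a0 : 'cV[int]_(d + 1) := \col_k Num.floor (t * x k 0).
pose a (j : nat) : 'cV[int]_(d + 1) := a0 + u *+ j.
pose ra (j : nat) : 'cV[R]_(d + 1) := map_mx intr (a j).
have raE j : ra j = map_mx intr a0 + j%:R *: map_mx intr u.
  apply/colP => k; rewrite !mxE mulmxnE; set f := Num.floor _.
  by rewrite intrD mulr_natl (rmorphMn (@intmul R 1)).
(* Pigeonhole: the line of direction [u] meets the hyperplane of each thin cone at most once, so at
   most N of these N+1 lattice points are excluded. *)
have [j jN jP] : exists2 j : nat, (j <= N)%N & forall i, ~~ full i -> ~ cone_set (K i) (ra j).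
  apply: contrapT => h.
  have /choice[f fP] : forall j : 'I_N.+1, exists i, ~~ full i /\ cone_set (K i) (ra j).
    move=> j; apply: contrapT => /forallNP hj; apply: h; exists j; first by rewrite -ltnS.
    by move=> i fi ci; apply: (hj i).
  have finj : injective f.
    move=> j1 j2 f12; have [n1 c1] := fP j1; have [n2 c2] := fP j2.
    rewrite -f12 in c2 n2; have [_ /(_ n1) wf] := wP (f j1).
    have : w (f j1) *m ra j1 = w (f j1) *m ra j2 by rewrite (wf _ c1) (wf _ c2).
    rewrite !raE !mulmxDr => /addrI; rewrite -!scalemxAr => /matrixP/(_ 0 0).
    rewrite [LHS]mxE [RHS]mxE => /(mulIf (uP (f j1)))/eqP; rewrite eqr_nat => /eqP.
    exact: val_inj.
  by have := leq_card f finj; rewrite !card_ord ltnn.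
have near_ra k : `|ra j k 0 - t * x k 0| <= 1 + N%:R * (\sum_k `|(u k 0)%:~R|).
  rewrite raE !mxE addrAC (le_trans (ler_normD _ _))// lerD//.
    have /andP[h1 h2] := floor_itv (t * x k 0); rewrite intrD1 in h2.
    by rewrite ler_norml; apply/andP; split; lra.
  rewrite normrM ler_pM//; first by rewrite ger0_norm// ler_nat.
  by rewrite (bigD1 k)//= lerDl sumr_ge0.
have close (v : 'cV[R]_(d + 1)) : (forall k, `|v k 0| <= \sum_i \sum_k `|apex (K i) k 0|) ->
    forall k, `|(t^-1 *: (ra j - v)) k 0 - x k 0| <= e.
  move=> vb k; apply: le_trans rt.
  have -> : (t^-1 *: (ra j - v)) k 0 - x k 0 = (ra j k 0 - t * x k 0 - v k 0) / t.
    have -> : (t^-1 *: (ra j - v)) k 0 = t^-1 * (ra j k 0 - v k 0).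
      by rewrite [LHS]mxE; congr (_ * _); rewrite [LHS]mxE; congr (_ + _); rewrite mxE.
    by field.
  rewrite normrM normfV (gtr0_norm t0) ler_pM2r ?invr_gt0//.
  by rewrite (le_trans (ler_normB _ _))// lerD.
have SS0 : 0 <= \sum_i \sum_k `|apex (K i) k 0| by apply: sumr_ge0 => i _; exact: sumr_ge0.
have CE : \1_C x = \1_C (ra j) :> R.
  apply: eq_indic; symmetry.
  have h1 : C (t^-1 *: ra j) <-> C x.
    apply: hC => k; apply: le_trans eeC; have := close 0; rewrite subr0; apply => k'.
    by rewrite mxE normr0.
  by rewrite -h1; symmetry; apply: cone_overZ; rewrite invr_gt0.
have KE i : full i -> \1_(simplicial_cone (G i)) x = \1_(cone_set (K i)) (ra j) :> R.
  move=> fi; rewrite hG//; have [_ /(_ fi) he] := e0P i.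
  apply: eq_indic => /=; symmetry.
  have h1 : simplicial_cone (G i) (t^-1 *: (ra j - apex (K i))) <-> simplicial_cone (G i) x.
    apply: he => k; apply: le_trans (ee0 i); apply: close => k'.
    rewrite (bigD1 i)//= (bigD1 k')//= -addrA lerDl addr_ge0 ?sumr_ge0// => i' _.
    exact: sumr_ge0.
  by rewrite -h1; symmetry; apply: simplicial_cone_scale; rewrite invr_gt0.
rewrite CE -sigma_indic hK rmorph_sum /= [RHS]big_mkcond /=; apply: eq_bigr => i _.
rewrite intrM sigma_indic; case: ifPn => fi; first by rewrite KE.
by rewrite indicE memNset ?mulr0//; exact: jP.
Qed.

Lemma decomposition_ae (L : ('cV[R]_(d + 1) -> R) -> R) : is_integral L ->
  (forall i, full i -> G i \in unitmx) -> exists2 Z, negligible L Z &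
  forall x, ~ Z x ->
    \sum_(i < N | full i) (s i)%:~R * \1_(simplicial_cone (G i)) x = \1_C x :> R.
Proof.
move=> HL uG.
pose F i := [set x | full i /\ ~ locally_constant (simplicial_cone (G i)) x].
exists ([set x | ~ locally_constant C x] `|` [set x | exists2 i, i \in enum 'I_N & F i x]).
  apply: (negligibleU HL); first exact: negligible_cone_over.
  apply: (negligible_bigU HL) => i _; case: (boolP (full i)) => fi.
    by apply: negligible_sub (negligible_simplicial_cone HL (uG i fi)) => x [].
  by apply: negligible_sub (negligible0 HL) => x []; rewrite (negPf fi).
move=> x /not_orP[/contrapT lC nF]; rewrite -decomposition_locally_constant//.
move=> i fi; apply: contrapT => nl; apply: nF; exists i => //.
by rewrite mem_enum.
Qed.

End Decomposition.

(** * Constant terms of Laurent expansions *)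

Section Laurent.
Variable R : realType.
Implicit Types (p u U : {poly R}).

Lemma laurent_inv_support p (m : nat) (e : int) : p != 0 -> (size p <= m.+1)%N ->
  e < - m%:Z -> laurent_inv p e = 0.
Proof.
move=> p0 pm; have [[n0 cn0] cE] := laurent_inv_exists p0.
have [k [pk pj]] := poly_ord p0.
have kp : (k < size p)%N by rewrite ltnNge; apply: contra pk => /(nth_default 0) ->.
have up (a : nat) : n0 + a%:Z < - m%:Z -> laurent_inv p (n0 + a%:Z) = 0.
  elim/ltn_ind: a => a IH am.
  have := cE (n0 + a%:Z + k%:Z).
  have -> : (n0 + a%:Z + k%:Z == 0) = false by apply/negbTE; lia.
  rewrite (bigD1 (Ordinal kp))//= addrK big1 ?addr0.
    by move/eqP; rewrite mulf_eq0 (negPf pk) => /eqP.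
  move=> j jk; have [jltk|kltj|kj] := ltngtP j k.
  - by rewrite pj// mul0r.
  - have [ja|aj] := leqP (j - k)%N a.
      have -> : n0 + a%:Z + k%:Z - j%:Z = n0 + (a - (j - k))%N%:Z by lia.
      by rewrite IH ?mulr0//; lia.
    by rewrite cn0 ?mulr0//; lia.
  - by move: jk; rewrite -val_eqE /= kj eqxx.
move=> em; have [/cn0//|n0e] := ltP e n0.
have -> : e = n0 + (absz (e - n0))%:Z by lia.
by apply: up; lia.
Qed.

(** [u] is q^m / p truncated after degree 2 m, a polynomial since the pole order of 1 / p is at most
    m. Its coefficient at m is the constant term of 1 / p. *)
Lemma laurent_truncation p (m : nat) : p != 0 -> (size p <= m.+1)%N ->
  exists u r : {poly R}, u`_m = CT_inv p /\ p * u = 'X^m * (1 + 'X^(m.+1) * r).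
Proof.
move=> p0 pm; have [_ cE] := laurent_inv_exists p0.
pose c := laurent_inv p.
pose u : {poly R} := \poly_(i < (m + m).+1) c (i%:Z - m%:Z).
pose f := p * u - 'X^m.
have f0 l : (l < m + m.+1)%N -> f`_l = 0.
  move=> lm; rewrite coefB coefM coefXn.
  have -> : \sum_(j < l.+1) p`_j * u`_(l - j) = \sum_(j < size p) p`_j * c (l%:Z - m%:Z - j%:Z).
    pose F (j : nat) := p`_j * c (l%:Z - m%:Z - j%:Z).
    rewrite (eq_bigr (fun j : 'I_l.+1 => F j)) => [|j _]; last first.
      rewrite /F coef_poly; have jl : (j <= l)%N by rewrite -ltnS.
      have -> : (l - j < (m + m).+1)%N by lia.
      by congr (_ * c _); lia.
    rewrite -[RHS]/(\sum_(j < size p) F j) -!(big_mkord xpredT F).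
    have [ls|sl] := leqP l.+1 (size p).
      rewrite [RHS](big_cat_nat (n := l.+1))//=.
      have -> : \sum_(l.+1 <= j < size p) F j = 0; last by rewrite addr0.
      rewrite big_nat_cond big1// => j /andP[/andP[lj _] _].
      by rewrite /F /c (@laurent_inv_support _ m) ?mulr0//; lia.
    rewrite (big_cat_nat (n := size p))//=; last exact: ltnW.
    have -> : \sum_(size p <= j < l.+1) F j = 0; last by rewrite addr0.
    rewrite big_nat_cond big1// => j /andP[/andP[sj _] _].
    by rewrite /F nth_default// mul0r.
  rewrite cE subr_eq0 eqz_nat; apply/eqP; by rewrite subr_eq0.
exists u, (drop_poly (m + m.+1) f); split.
  rewrite coef_poly; have -> : (m < (m + m).+1)%N by lia.
  by rewrite subrr.
have E : f = drop_poly (m + m.+1) f * 'X^(m + m.+1).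
  rewrite -[LHS](poly_take_drop (m + m.+1)).
  have -> : take_poly (m + m.+1) f = 0; last by rewrite add0r.
  by apply/polyP => l; rewrite coef_take_poly coef0; case: ifP => // /f0.
have -> : p * u = 'X^m + f by rewrite /f addrC subrK.
move: E; set g := drop_poly _ _ => ->; rewrite exprD; ring.
Qed.

Lemma near_horner_neq0 p : p != 0 -> \forall K \near \oo, p.[K.+1%:R^-1] != 0.
Proof.
have [k] := ubnP (size p); elim: k p => // k IH p pk p0.
have cv : p.[K.+1%:R^-1] @[K --> \oo] --> p.[0].
  by apply: cvg_comp; [exact: cvg_harmonic|exact: continuous_horner].
have [r0|n0] := eqVneq p.[0] 0; last exact: cvgr_neq0 cv n0.
have /factor_theorem[q pq] : root p 0 by rewrite /root r0.
rewrite subr0 in pq.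
have q0 : q != 0 by apply: contra_neq p0 => q0; rewrite pq q0 mul0r.
have qk : (size q < k)%N by move: pk; rewrite pq size_mulX.
apply: filterS (IH q qk q0) => K qK.
by rewrite pq hornerM hornerX mulf_neq0// invr_eq0 pnatr_eq0.
Qed.

(** For m > 0 convergence of U(q) / q^m forces U(0) = 0, so a factor q can be split off from
    both. *)
Lemma cvg_horner_quotient U (m : nat) (l : R) :
  U.[K.+1%:R^-1] * K.+1%:R ^+ m @[K --> \oo] --> l -> U`_m = l.
Proof.
elim: m U => [|m IH] U cv; have cU : U.[K.+1%:R^-1] @[K --> \oo] --> U.[0] by
  (apply: cvg_comp; [exact: cvg_harmonic|exact: continuous_horner]).
  rewrite -horner_coef0; apply: (cvg_unique (@Rhausdorff R) cU).
  by move: cv; under eq_fun do rewrite expr0 mulr1.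
have : U.[0] = 0.
  apply: (cvg_unique (@Rhausdorff R) cU).
  have hm : (K.+1%:R^-1 : R) ^+ m.+1 @[K --> \oo] --> 0.
    have := @continuous_horner R 'X^(m.+1) 0; rewrite /continuous_at hornerXn expr0n /=.
    move=> ch; have := cvg_comp _ _ (@cvg_harmonic R) ch; rewrite /harmonic /comp.
    by under eq_fun do rewrite hornerXn.
  have E : (fun K : nat => U.[K.+1%:R^-1]) =
      (fun K : nat => U.[K.+1%:R^-1] * K.+1%:R ^+ m.+1 * K.+1%:R^-1 ^+ m.+1).
    by apply/funext => K; rewrite -mulrA -exprMn mulfV ?pnatr_eq0// expr1n mulr1.
  by rewrite /= E -(mulr0 l); exact: cvgM.
move=> U0; have /factor_theorem[q Uq] : root U 0 by rewrite /root U0.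
rewrite subr0 in Uq; rewrite Uq coefMX /=; apply: IH.
have E : (fun K : nat => q.[K.+1%:R^-1] * K.+1%:R ^+ m) =
    (fun K : nat => U.[K.+1%:R^-1] * K.+1%:R ^+ m.+1).
  apply/funext => K; rewrite Uq hornerM hornerX exprS -mulrA [_^-1 * _]mulrA.
  by rewrite mulVf ?pnatr_eq0// mul1r.
by rewrite E.
Qed.

Lemma cvg_sumr (I : Type) (r : seq I) (P : pred I) (u : I -> nat -> R) (l : I -> R) :
  (forall i, u i K @[K --> \oo] --> l i) ->
  \sum_(i <- r | P i) u i K @[K --> \oo] --> \sum_(i <- r | P i) l i.
Proof.
move=> ul; elim: r => [|i r IH].
  by under eq_fun do rewrite big_nil; rewrite big_nil; exact: cvg_cst.
under eq_fun do rewrite big_cons; rewrite big_cons.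
by case: ifP => // _; exact: cvgD.
Qed.

(** Poles of single terms may cancel in the sum, so no term is taken to the limit alone: all are
    replaced, up to terms tending to 0, by Laurent polynomials over one denominator q^m. *)
Lemma cvg_CT_inv (N : nat) (P : pred 'I_N) (a : 'I_N -> R) (p : 'I_N -> {poly R}) (l : R) :
  (forall i, P i -> p i != 0) ->
  \sum_(i < N | P i) a i / (p i).[K.+1%:R^-1] @[K --> \oo] --> l ->
  \sum_(i < N | P i) a i * CT_inv (p i) = l.
Proof.
move=> p0 cv; pose m := (\sum_(i < N) size (p i))%N.
have pm i : (size (p i) <= m.+1)%N by rewrite /m (bigD1 i)//= ltnW// ltnS leq_addr.
have /choice[ur urP] : forall i, exists ur : {poly R} * {poly R}, P i ->
    ur.1`_m = CT_inv (p i) /\ p i * ur.1 = 'X^m * (1 + 'X^(m.+1) * ur.2).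
  move=> i; case: (boolP (P i)) => Pi; last by exists (0, 0).
  by have [u [v h]] := laurent_truncation (p0 i Pi) (pm i); exists (u, v).
pose u i := (ur i).1; pose v i := (ur i).2.
pose U : {poly R} := \sum_(i < N | P i) a i *: u i.
have -> : \sum_(i < N | P i) a i * CT_inv (p i) = U`_m.
  by rewrite coef_sum; apply: eq_bigr => i Pi; rewrite coefZ (urP i Pi).1.
apply: cvg_horner_quotient.
pose q (K : nat) : R := K.+1%:R^-1.
pose w i : {poly R} := 1 + 'X^(m.+1) * v i.
(* This is u / q^m - 1 / p, since p u = q^m w with w = 1 + q^(m+1) v; the factor q makes it vanish
   in the limit. *)
pose del i K := (('X * v i * u i).[q K]) / (w i).[q K].
have cvq (f : {poly R}) : f.[q K] @[K --> \oo] --> f.[0].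
  by apply: cvg_comp; [exact: cvg_harmonic|exact: continuous_horner].
have w0 i : (w i).[0] = 1 by rewrite /w !hornerE expr0n /= mul0r addr0.
have cdel i : a i * del i K @[K --> \oo] --> 0.
  rewrite -(mulr0 (a i)); apply: cvgM; first exact: cvg_cst.
  have -> : 0 = ('X * v i * u i).[0] / (w i).[0] :> R.
    by rewrite !hornerM hornerX !mul0r.
  by apply: cvgM; [exact: cvq|apply: cvgV; [rewrite w0 oner_eq0|exact: cvq]].
have cs : \sum_(i < N | P i) a i * del i K @[K --> \oo] --> (0 : R).
  have := @cvg_sumr _ (index_enum 'I_N) P (fun i K => a i * del i K) (fun=> 0) cdel.
  by rewrite big1.
have cvs : \sum_(i < N | P i) a i / (p i).[q K] + \sum_(i < N | P i) a i * del i K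
    @[K --> \oo] --> l by rewrite -[X in _ --> X]addr0; exact: cvgD.
apply: cvg_trans cvs; apply: near_eq_cvg.
have nw : \forall K \near \oo, forall i : 'I_N, (w i).[q K] != 0.
  apply: filter_forall => i; apply: cvgr_neq0 (cvq (w i)) _.
  by rewrite w0 oner_eq0.
have np : \forall K \near \oo, forall i : 'I_N, P i -> (p i).[q K] != 0.
  apply: filter_forall => i; case: (boolP (P i)) => Pi.
    by apply: filterS (near_horner_neq0 (p0 i Pi)).
  exact: nearW.
apply: filterS2 nw np => K wK pK /=.
rewrite -/(q K) horner_sum mulr_suml -big_split /=; apply: eq_bigr => i Pi.
have q0 : q K != 0 by rewrite invr_eq0 pnatr_eq0.
have -> : K.+1%:R = (q K)^-1 by rewrite invrK.
have /(congr1 (horner^~ (q K))) := (urP i Pi).2.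
rewrite -/(u i) -/(v i) -/(w i) !hornerM hornerXn => pu.
have -> : (p i).[q K]^-1 = (u i).[q K] / (q K ^+ m * (w i).[q K]).
  rewrite -pu invfM mulrCA mulfV ?mulr1//.
  apply: contra_eq_neq pu => ->; by rewrite mulr0 eq_sym mulf_neq0// expf_neq0.
rewrite /del !hornerM hornerX hornerZ.
have wE : (w i).[q K] = 1 + q K ^+ m.+1 * (v i).[q K] by rewrite /w !hornerE.
have := wK i; rewrite wE exprS.
move: ((u i).[q K]) ((v i).[q K]) (q K) q0 => ux vx x x0 wN; rewrite exprVn; field.
by rewrite wN expf_neq0.
Qed.

End Laurent.

(** * The linear forms (- q beta, 1) and the conclusion *)

Section SlopeRow.
Variables (R : realType) (d : nat) (beta : 'cV[int]_d).

Definition slope_row (q : R) : 'rV[R]_(d + 1) :=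
  row_mx (- q *: (map_mx intr beta)^T) 1%:M.

Lemma slope_rowE (q : R) m (A : 'M[R]_(d + 1, m)) j :
  (slope_row q *m A) 0 j = dsubmx A 0 j - q * ((map_mx intr beta)^T *m usubmx A) 0 j.
Proof.
rewrite -{1}[A]vsubmxK mul_row_col mul1mx -scalemxAl mxE addrC; congr (_ + _).
by rewrite [LHS]mxE mulNr.
Qed.

Lemma cone_polyE (q : R) (G : 'M[R]_(d + 1)) :
  (cone_poly beta G).[q] = \prod_j (slope_row q *m G) 0 j.
Proof.
rewrite horner_prod; apply: eq_bigr => j _.
by rewrite slope_rowE hornerD hornerN hornerZ hornerX hornerC mulrC.
Qed.

End SlopeRow.

Theorem theorem1p4 (R : realType) (d : nat) (P : set 'cV[R]_d)
    (hP : full_dim_polytope P)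
    (N : nat) (s : 'I_N -> int)
    (K : 'I_N -> pointed_simplicial_cone R (d + 1))
    (hK : signed_simplicial_cone_decomposition P s K)
    (hdim : forall i : 'I_N, (ngens (K i) <= d + 1)%N)
    (beta : 'cV[int]_d)
    (hbeta : forall i : 'I_N, admissible beta (K i)) :
  vol P = ((d`!%:R)^-1 * \sum_(i < N) (s i)%:~R * Vol beta (K i))%:E.
Proof.
case: hP hK => n [V [-> aV]] hK.
have [L HL] := @integral_exists R (d + 1).
pose full i := ngens (K i) == (d + 1)%N.
have /choice[G GP] : forall i, exists G : 'M[R]_(d + 1), full i ->
    [/\ G \in unitmx,
      cone_set (K i) = [set x | simplicial_cone G (x - apex (K i))],
      Vol beta (K i) = `|\det G| * CT_inv (cone_poly beta G) &
      cone_poly beta G != 0].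
  move=> i; case: (boolP (full i)) => [/eqP fi|_]; last by exists 0.
  have [G [uG cG vG aG]] := full_dim_cone fi; exists G => _; split => //.
  apply/prodf_neq0 => j _; apply/eqP => f0; apply: (aG beta (hbeta i) j).
  (* A vanishing factor has m_j = 0, at q = 0, and then beta.nu_j = 0, at q = 1, against
     admissibility. *)
  have := congr1 (horner^~ 0) f0; have := congr1 (horner^~ 1) f0.
  rewrite !hornerD !hornerN !hornerZ !hornerX !hornerC ?horner0 mulr0 mulr1.
  by move=> h1 h2; split; lra.
rewrite (pyramid_volume aV HL); set W := _%:R * _; congr _%:E.
have -> : \sum_(i < N) (s i)%:~R * Vol beta (K i) =
    \sum_(i < N | full i) ((s i)%:~R * `|\det (G i)|) * CT_inv (cone_poly beta (G i)).
  rewrite [RHS]big_mkcond /=; apply: eq_bigr => i _; case: ifPn => fi.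
    by have [_ _ -> _] := GP i fi; rewrite mulrA.
  by rewrite /Vol; case: eqP => [h|_]; [case/eqP: fi|rewrite mulr0].
have f0 : d`!%:R != 0 :> R by rewrite pnatr_eq0 -lt0n fact_gt0.
apply: (canRL (mulKf f0)); symmetry.
apply: cvg_CT_inv => [i fi|]; first by have [] := GP i fi.
pose q (k : nat) : R := k.+1%:R^-1.
have q0 k : 0 < q k by rewrite invr_gt0.
have cq : q k @[k --> \oo] --> (0 : R) by exact: cvg_harmonic.
have [M VM] := @bounded_conv_hull R d n V.
(* Bounds |beta.alpha| on P, so on the cone xi differs from the height by at most q B times the
   height. *)
pose B := (\sum_i `|(map_mx intr beta)^T 0 i : R|) * M%:R.
have B0 : 0 <= B by rewrite mulr_ge0// sumr_ge0.
have slope x k : cone_over (conv_hull V) x ->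
    `|(slope_row beta (q k) *m x) 0 0 - last_coord x| <= (q k * B) * last_coord x.
  move=> [l0 [p Pp xE]]; rewrite slope_rowE -/(last_coord x) addrC addKr normrN.
  rewrite normrM gtr0_norm// -mulrA ler_pM2l// xE -scalemxAr mxE normrM ger0_norm//.
  by rewrite mulrC ler_wpM2r//; apply: chi_bound; exact: VM.
have [Z nZ ZE] := decomposition_ae aV hK hdim (fun i fi => let: And4 _ h _ _ := GP i fi in h)
  HL (fun i fi => let: And4 h _ _ _ := GP i fi in h).
pose theta k := \sum_(i < N | full i) (s i)%:~R * `|\det (G i)| / (cone_poly beta (G i)).[q k].
have bounds : \forall k \near \oo,
    d`!%:R / (1 + q k * B) ^+ (d + 1) * W <= theta k <= d`!%:R / (1 - q k * B) ^+ (d + 1) * W.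
  have nq : \forall k \near \oo, q k * B < 1.
    have c0 : q k * B @[k --> \oo] --> (0 : R).
      by rewrite -(mul0r B); apply: cvgM => //; exact: cvg_cst.
    exact: cvgr_lt c0 _ ltr01.
  have np : \forall k \near \oo, forall i : 'I_N, full i -> (cone_poly beta (G i)).[q k] != 0.
    apply: filter_forall => i; case: (boolP (full i)) => fi; last exact: nearW.
    have [_ _ _ p0] := GP i fi; exact: filterS (near_horner_neq0 p0).
  apply: filterS2 nq np => k qB pk.
  apply: (exp_integral_cone_over aV HL _ qB (slope ^~ k)); first by rewrite mulr_ge0// ltW.
  (* [theta k] is the value assigned to the signed sum of simplicial cones, hence a value of the
     cone over P, and obeys the bounds for the latter. *)
  apply: (exp_integral_ae HL nZ ZE).
  rewrite /theta; under eq_bigr do rewrite -mulrA.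
  apply: (exp_integral_sum HL) => i fi; have [uG _ _ _] := GP i fi.
  rewrite cone_polyE; apply: (exp_integral_cone HL uG) => j.
  by have := pk i fi; rewrite cone_polyE => /prodf_neq0; exact.
(* Used with b = B and b = - B for the two sides of the squeeze. *)
have climit (b : R) : d`!%:R / (1 + q k * b) ^+ (d + 1) * W @[k --> \oo] --> d`!%:R * W.
  apply: cvgM; last exact: cvg_cst.
  rewrite -[X in _ --> X]divr1; apply: cvgM; first exact: cvg_cst.
  apply: cvgV; first by rewrite oner_eq0.
  pose f : {poly R} := (1 + b *: 'X) ^+ (d + 1).
  have f01 : f.[0] = 1 by rewrite horner_exp hornerD hornerC hornerZ hornerX mulr0 addr0 expr1n.
  have fE : (fun k : nat => (1 + q k * b) ^+ (d + 1)) = (fun k => f.[q k]).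
    by apply/funext => k; rewrite horner_exp hornerD hornerC hornerZ hornerX mulrC.
  by rewrite fE -f01; apply: cvg_comp; [exact: cq|exact: continuous_horner].
apply: (squeeze_cvgr bounds); first exact: climit.
by have := climit (- B); under eq_fun do rewrite mulrN.
Qed.
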